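(* Let $E$ be the elliptic curve over $\mathbb{Q}$ defined by $y^2=x(x-1)(x-\lambda)$, where $\lambda\ne 0$ and either $\lambda=-2a^2$, or $\lambda=\frac{1-a^2}{a^2+2}$, or $\lambda=\frac{a(a-2)}{a^2+1}$, with $a\in\mathbb{Q}$. Then $N_3(E,x)\gg x^{1/6}$ for all sufficiently large $x$.
   Context: For a nonzero integer $D$, $E_D$ is the twist $Dy^2=x(x-1)(x-\lambda)$ and $r_E(D)=\mathrm{rank}(E_D(\mathbb{Q}))$; $N_r(E,x)=\#\{D\in\mathbb{Z}\text{ squarefree}: |D|<x,\ r_E(D)\ge r\}$. ''$\gg$ for sufficiently large $x$'' means: at least a positive constant (depending on $E$) times the right side for all $x\ge x_0$. *)

(* Defs.v *)
From HB Require Import structures.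
From mathcomp Require Import all_boot all_order all_algebra.
From mathcomp Require Import finmap.
From mathcomp Require Import all_classical all_reals all_analysis.
Set Implicit Arguments.
Unset Strict Implicit.
Unset Printing Implicit Defensive.
Import Order.TTheory GRing.Theory Num.Theory.
Local Open Scope classical_set_scope.
Local Open Scope ring_scope.

(* Rational points are encoded in [option (rat * rat)]: [None] is the point at
   infinity, which is the neutral element, and [Some (x, y)] is affine. *)
Definition point : Type := option (rat * rat).

(* E_D : D y^2 = x (x - 1) (x - lambda) *)
Definition on_twist (lambda D : rat) (P : point) : bool :=
  if P is Some (x, y) then D * y ^+ 2 == x * (x - 1) * (x - lambda) else true.

Definition ec_opp (P : point) : point :=
  if P is Some (x, y) then Some (x, - y) else None.

(* Chord-and-tangent law.  On E_D, if x1 = x2 and y1 != - y2 then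
   y1 = y2 != 0, and the tangent slope is f'(x1) / (2 D y1), where
   f = x^3 - (1 + lambda) x^2 + lambda x.  The line of slope m through two
   points of E_D meets it again where x1 + x2 + x3 = D m^2 + 1 + lambda. *)
Definition ec_add (lambda D : rat) (P Q : point) : point :=
  match P, Q with
  | None, _ => Q
  | _, None => P
  | Some (x1, y1), Some (x2, y2) =>
    if (x1 == x2) && (y1 == - y2) then None else
    let m := if x1 == x2
             then (3 * x1 ^+ 2 - 2 * (1 + lambda) * x1 + lambda) / (2 * D * y1)
             else (y2 - y1) / (x2 - x1) in
    let x3 := D * m ^+ 2 + 1 + lambda - x1 - x2 in
    Some (x3, - (y1 + m * (x3 - x1)))
  end.

Definition ec_mulz (lambda D : rat) (m : int) (P : point) : point :=
  match m with
  | Posz n => iter n (ec_add lambda D P) None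
  | Negz n => ec_opp (iter n.+1 (ec_add lambda D P) None)
  end.

Definition ec_indep (lambda D : rat) (n : nat) (P : 'I_n -> point) : Prop :=
  forall m : 'I_n -> int,
    \big[ec_add lambda D/None]_(i < n) ec_mulz lambda D (m i) (P i) = None ->
    forall i, m i = 0.

(* The rank of the abelian group E_D(Q): the supremum of the sizes of its
   Z-linearly independent families.  It is taken in the extended reals so that
   the definition does not presuppose the Mordell-Weil theorem. *)
Definition ec_rank (R : realType) (lambda D : rat) : \bar R :=
  ereal_sup [set n%:R%:E | n in [set n : nat |
    exists P : 'I_n -> point,
      (forall i, on_twist lambda D (P i)) /\ ec_indep lambda D P]].

Definition squarefree (D : int) : Prop :=
  forall d : nat, (1 < d)%N -> ~~ (d ^ 2 %| `|D|)%N.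

(* N_r(E, x).  The set is finite, being bounded by x, so [fset_set] does not
   take its default value. *)
Definition num_twists (R : realType) (lambda : rat) (r : nat) (x : R) : nat :=
  #|` fset_set [set D : int | [/\ squarefree D, `|D|%:~R < x
                 & (r%:R%:E <= ec_rank R lambda D%:~R)%E]]|%fset.

(* Main.v *)
Require Import Defs.
From HB Require Import structures.
From mathcomp Require Import all_boot all_order all_algebra all_field.
From mathcomp Require Import finmap.
From mathcomp Require Import all_classical all_reals all_analysis.
From mathcomp Require Import ring lra zify.
Set Implicit Arguments.
Unset Strict Implicit.
Unset Printing Implicit Defensive.
Import Order.TTheory GRing.Theory Num.Theory.

(** Let f(x) = x (x - 1) (x - lambda) = (x - e1) (x - e2) (x - e3).  The Moebius map
    fixing e_i and exchanging the other two roots sends t to some h_i(t) such that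
    f(h_i(t)) / f(t) is a square times a linear polynomial in t.  Making these linear
    polynomials squares for i = 1, 2 amounts to finding points on a conic, which has a
    rational point for the given lambda; so it is parametrized by a rational number a/b,
    and the twist by the squarefree part of f(t) carries points with abscissas t, h_1(t)
    and h_2(t).  Up to squares and constants t - e_i is a binary quartic form F_i(a, b),
    so the twist is by F = F_1 F_2 F_3, of degree 12.

    If F(a, b) is squarefree up to constants, each F_i(a, b) has its own prime factor l_i,
    and the parities of the valuations of D (x - e_i) at these primes (complete 2-descent)
    show that the three points are independent.

    Most pairs |a|, |b| <= X in a suitable congruence class give squarefree values.  Indeed p^2 | F(a, b) restricts a/b to 12 classes
    modulo p^2; for p > X each class contains at most one pair of coprime integers, and
    there are o(X^2) primes p << X^2, which are the only ones to consider as each F_i is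
    quartic.  On average the primes up to X^delta contribute little to log |F(a, b)|, so
    usually the product of the other (boundedly many) prime factors exceeds 2 X^2.  The
    classes of a/b modulo these then determine (a, b), hence every value F(a, b) is taken
    boundedly often, which gives >> X^2 twists with |D| << X^12. *)

(** * Bounds on primes *)

(** The exponent compares a box of N^2 pairs with values of size N^12. D carries all of l_1, l_2,
    l_3 to odd order, while t - e_i carries l_i only. Up to squares and constants, the differences
    of abscissa and roots (e_1, e_2, e_3) are t - e_1, t - e_2, t - e_3 for t; the order becomes 1,
    3, 2 for h_1(t) and 3, 2, 1 for h_2(t). Parities at suitable pairs of a prime and a root thus
    form an invertible matrix over F_2. Fixed constants could disturb both these parities and the
    squarefreeness of D. Keeping (a, b) in one class modulo M makes each F_i(a, b) a fixed integer
    times a factor congruent to 1 modulo B, where B contains all bad primes. Then D = d m with d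
    fixed and m prime to B. For the multiplicity of a value, primes below N^(1/96) usually make up
    at most N^9 of it; the remaining N^3, up to constants, exceeds a b' - a' b, which is of order
    N^2. *)

Lemma prod_primes_dvd (s : seq nat) m :
  uniq s -> (forall p, p \in s -> prime p && (p %| m)) -> \prod_(p <- s) p %| m.
Proof.
elim: s => [|p s IH] /=; first by rewrite big_nil dvd1n.
move=> /andP[ps us] h; rewrite big_cons.
have /andP[pp pm] := h p (mem_head _ _).
rewrite Gauss_dvd ?pm ?IH // => [q qs|]; first by apply: h; rewrite inE qs orbT.
rewrite prime_coprime //; apply/negP.
have hs q : q \in s -> prime q by move=> qs; have /andP[] := h q (mem_behead (s := p :: s) qs).
elim: s {IH us h} ps hs => [|q s IHs].
  by rewrite big_nil dvdn1 => _ _ /eqP p1; move: pp; rewrite p1.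
rewrite inE negb_or => /andP[pq ps] hs; rewrite big_cons Euclid_dvdM // => /orP[|].
  by rewrite dvdn_prime2 ?(hs q (mem_head _ _)) // (negbTE pq).
by apply: IHs => // r rs; apply: hs; rewrite inE rs orbT.
Qed.

Lemma central_bin_le n : 'C(n.*2, n) <= 2 ^ n.*2.
Proof.
rewrite (_ : 2 = 1 + 1) // expnDn.
have le : n < n.*2.+1 by rewrite ltnS -addnn leq_addr.
by rewrite (bigD1 (Ordinal le)) //= !exp1n !muln1 leq_addr.
Qed.

Lemma prime_dvd_fact p n : prime p -> p %| n`! -> p <= n.
Proof.
move=> pp; elim: n => [|n IH]; first by rewrite dvdn1 => /eqP p1; move: pp; rewrite p1.
by rewrite factS Euclid_dvdM // => /orP[/dvdn_leq -> //|/IH /leqW].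
Qed.

(** Chebyshev's argument: with n = 2^j, each prime strictly between n and 2n divides the central
    binomial coefficient, which is at most 4^n, and each of them exceeds n. *)
Lemma primes_dyadic j :
  j * (\sum_(2 ^ j <= p < 2 ^ j.+1 | prime p) 1) <= 2 ^ j.+1.
Proof.
(* For j = 1 the block contains the prime 2 = n, which the binomial argument misses; from j = 2 on,
   n is composite. *)
case: j => [|[|j]]; first by rewrite mul0n.
  by rewrite big_mkcond unlock.
set n := 2 ^ j.+2.
have n2 : 2 ^ j.+3 = n.*2 by rewrite expnS mul2n.
rewrite n2 -(leq_exp2l _ _ (isT : 1 < 2)) sum1_count -size_filter.
set s := [seq p <- _ | _].
have sP p : p \in s -> [/\ prime p, n < p & p < n.*2].
  rewrite mem_filter mem_index_iota => /and3P[pp np ->]; split=> //.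
  rewrite ltn_neqAle np andbT; apply/eqP => nE.
  have : 2 %| p by rewrite -nE /n expnS dvdn_mulr.
  rewrite dvdn_prime2 // => /eqP p2; move: nE; rewrite -p2 /n !expnS.
  have : 0 < 2 ^ j by rewrite expn_gt0.
  by lia.
have n_gt0 : 0 < n by rewrite expn_gt0.
apply: leq_trans (central_bin_le n).
have bin_gt : 0 < 'C(n.*2, n) by rewrite bin_gt0 -addnn leq_addr.
apply: leq_trans (dvdn_leq bin_gt (prod_primes_dvd _ _)); last first.
- move=> p /sP[pp np pn]; rewrite pp /=.
  have : p %| (n.*2)`! by apply: dvdn_fact; rewrite prime_gt0 // ltnW.
  rewrite -(@bin_fact n.*2 n) -?addnn ?leq_addr // addKn !Euclid_dvdM // orbb.
  by case/orP => // /(prime_dvd_fact pp); rewrite leqNgt np.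
- exact: filter_uniq (iota_uniq _ _).
rewrite expnM -/n.
elim: s sP => [|p s IH] sP; first by rewrite big_nil.
rewrite big_cons expnS leq_mul //; last by apply: IH => q qs; apply: sP; rewrite inE qs orbT.
by have [_ /ltnW] := sP p (mem_head _ _).
Qed.

(** Trivial count below 2^h; above it, Chebyshev with 1/j <= 1/h on each dyadic block, and the
    bounds of the blocks add up geometrically. *)
Lemma prime_count_pow2 h J : h <= J ->
  h * (\sum_(0 <= p < 2 ^ J | prime p) 1) <= h * 2 ^ h + 2 ^ J.+1.
Proof.
move=> /subnKC <-; elim: (J - h) => [|k IH].
  rewrite addn0; apply: leq_trans (leq_addr _ _).
  rewrite leq_mul2l; apply/orP; right.
  by rewrite sum1_count (leq_trans (count_size _ _)) // size_iota subn0.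
rewrite (@big_cat_nat _ _ _ (2 ^ (h + k))) //=; last by rewrite leq_exp2l // addnS.
rewrite mulnDr addnS.
have := primes_dyadic (h + k).
set A := \sum_(_ <= p < _ | _) _ in IH *; set B := \sum_(_ <= p < _ | _) _ => hB.
have : h * B <= 2 ^ (h + k).+1 by apply: leq_trans hB; rewrite leq_mul2r leq_addr orbT.
rewrite [2 ^ (h + k).+2]expnS; move: (2 ^ (h + k).+1) IH => X.
by lia.
Qed.

(** The primes have density zero. For h = 3k and J >= 6k the two terms of the previous bound are at
    most 2^J and 2 * 2^J, and the factor 3 cancels. *)
Lemma prime_count_small k : exists J0, forall J, J0 <= J ->
  k * (\sum_(0 <= p < 2 ^ J | prime p) 1) <= 2 ^ J.
Proof.
exists (6 * k) => J hJ.
have := @prime_count_pow2 (3 * k) J (leq_trans _ hJ).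
rewrite leq_mul2r orbT => /(_ isT).
have : 3 * k * 2 ^ (3 * k) <= 2 ^ J.
  apply: leq_trans (_ : 2 ^ (3 * k) * 2 ^ (3 * k) <= _).
    by rewrite leq_mul2r ltnW ?orbT // ltn_expl.
  by rewrite -expnD leq_exp2l //; lia.
rewrite expnS; set S := \sum_(_ <= _ < _ | _) _.
by move: (2 ^ J) (_ * 2 ^ _) => X Y; nia.
Qed.

Local Open Scope ring_scope.

(** Mertens' estimate up to a constant: by Chebyshev the block from 2^y to 2^(y+1) contributes at
    most (y + 1) / 2^y * 2^(y+1) / y <= 4. *)
Lemma sum_log_prime_over_prime y :
  \sum_(0 <= p < 2 ^ y | prime p) ((trunc_log 2 p).+1%:R / p%:R) <= (4 * y)%:R :> rat.
Proof.
elim: y => [|y IH]; first by rewrite big_mkcond unlock.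
rewrite (@big_cat_nat _ _ _ (2 ^ y)) //=; last by rewrite leq_exp2l.
rewrite mulnS addnC natrD lerD //.
have tl p : (2 ^ y <= p < 2 ^ y.+1)%N -> trunc_log 2 p = y by move/(trunc_log_eq (isT : 1 < 2)%N).
have pos : 0 < (2 ^ y)%:R :> rat by rewrite ltr0n expn_gt0.
apply: le_trans (_ : \sum_(2 ^ y <= p < 2 ^ y.+1 | prime p) (y.+1%:R / (2 ^ y)%:R) <= _).
  rewrite big_seq_cond [X in _ <= X]big_seq_cond; apply: ler_sum => p.
  rewrite mem_index_iota => /andP[hp _]; rewrite tl //; case/andP: hp => hp _.
  rewrite ler_pM2l ?ltr0n // lef_pV2 ?posrE ?ler_nat //.
  by rewrite ltr0n (leq_trans _ hp) ?expn_gt0.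
have := primes_dyadic y.
rewrite sum1_count big_const_seq iter_addr_0 -[_ *+ count _ _]mulr_natr mulrAC ler_pdivrMr //.
set c := count _ _; case: y @c {IH tl pos} => [|y] c.
  by rewrite (_ : c = 0%N) // mulr0n mulr0 mulr_ge0.
by rewrite -!natrM ler_nat expnS; move: (2 ^ y.+1)%N => X; lia.
Qed.

Lemma sum_inv_sq z n : (0 < z)%N ->
  \sum_(z.+1 <= k < n) (k%:R ^- 2) <= z%:R^-1 :> rat.
Proof.
move=> z0; case: (leqP n z.+1) => [le|lt]; first by rewrite big_geq // invr_ge0.
suff : \sum_(z.+1 <= k < n) (k%:R ^- 2) <= z%:R^-1 - (n.-1)%:R^-1 :> rat.
  by move/le_trans; apply; rewrite gerBl invr_ge0.
elim: n {lt} (ltnW lt) => // n IH; rewrite leq_eqVlt => /orP[/eqP [<-]|]; last rewrite ltnS => lt.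
  by rewrite big_geq // subrr.
rewrite big_nat_recr //=; apply: le_trans (lerD (IH lt) (lexx _)) _.
have n0 : (0 < n.-1)%N by case: n lt {IH} => // n; rewrite ltnS /=; apply: leq_trans.
have -> : n = n.-1.+1 by case: (n) n0.
move: n0; move: n.-1 => /= m m0.
rewrite -subr_ge0.
have m1 : m%:R != 0 :> rat by rewrite pnatr_eq0 -lt0n.
have m2 : m.+1%:R != 0 :> rat by rewrite pnatr_eq0.
have -> : z%:R^-1 - m.+1%:R^-1 - (z%:R^-1 - m%:R^-1 + m.+1%:R ^- 2) =
   m%:R^-1 * m.+1%:R ^- 2 :> rat.
  rewrite -[m.+1]addn1 natrD in m2 *; field; rewrite m1 m2 /= pnatr_eq0 -lt0n z0 //.
by apply: divr_ge0; rewrite ?invr_ge0 ?exprn_ge0 ?ler0n.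
Qed.

(** * Binary forms modulo primes *)

Definition homog d (h : {poly int}) (a b : int) : int :=
  \sum_(i < d.+1) h`_i * a ^+ i * b ^+ (d - i).

Lemma homog_horner d (h : {poly int}) (a b : int) : (size h <= d.+1)%N -> b != 0 ->
  (homog d h a b)%:~R = b%:~R ^+ d * (map_poly intr h).[a%:~R / b%:~R] :> rat.
Proof.
move=> hs b0; have b0' : b%:~R != 0 :> rat by rewrite intr_eq0.
rewrite (@horner_coef_wide _ d.+1) ?(leq_trans (size_poly _ _)) // mulr_sumr.
rewrite /homog rmorph_sum; apply: eq_bigr => i _.
rewrite coef_map /= !rmorphM !rmorphXn /= expr_div_n.
have -> : b%:~R ^+ d = b%:~R ^+ (d - i) * b%:~R ^+ i :> rat.
  by rewrite -exprD subnK // -ltnS.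
by field; rewrite ?expf_neq0.
Qed.

Lemma homogM d e (g h : {poly int}) (a b : int) :
  (size g <= d.+1)%N -> (size h <= e.+1)%N -> b != 0 ->
  homog (d + e) (g * h) a b = homog d g a b * homog e h a b.
Proof.
move=> gs hs b0; apply: (@intr_inj rat); rewrite rmorphM /= !homog_horner //.
  by rewrite rmorphM /= hornerM exprD; ring.
apply: leq_trans (size_polyMleq _ _) _; move: gs hs.
by case: (size g) => [|m] //=; rewrite ?addSn ?add0n /=; lia.
Qed.

Lemma homog_mull d (h : {poly int}) (r b : int) : (size h <= d.+1)%N ->
  homog d h (r * b) b = b ^+ d * h.[r].
Proof.
move=> hs; rewrite (@horner_coef_wide _ d.+1) // mulr_sumr; apply: eq_bigr => i _.
have -> : b ^+ d = b ^+ (d - i) * b ^+ i by rewrite -exprD subnK // -ltnS.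
by rewrite exprMn; ring.
Qed.

Lemma homog_b1 d (h : {poly int}) (a : int) : (size h <= d.+1)%N -> homog d h a 1 = h.[a].
Proof. by move=> hs; rewrite -[a in LHS]mulr1 homog_mull // expr1n mul1r. Qed.

Lemma dvdz_subX (q x y : int) n : (q %| x - y)%Z -> (q %| x ^+ n - y ^+ n)%Z.
Proof. by move=> h; rewrite subrXX dvdz_mulr. Qed.

Lemma dvdz_subM (q x y x' y' : int) : (q %| x - y)%Z -> (q %| x' - y')%Z ->
  (q %| x * x' - y * y')%Z.
Proof.
move=> h h'; have -> : x * x' - y * y' = (x - y) * x' + y * (x' - y') by ring.
by apply: rpredD; [apply: dvdz_mulr | apply: dvdz_mull].
Qed.

Lemma homog_mod d (h : {poly int}) (q a b a' b' : int) : (q %| a - a')%Z -> (q %| b - b')%Z ->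
  (q %| homog d h a b - homog d h a' b')%Z.
Proof.
move=> ha hb; rewrite /homog -sumrB; apply: rpred_sum => i _.
by rewrite -!mulrA -mulrBr dvdz_mull // dvdz_subM ?dvdz_subX.
Qed.

Lemma horner_mod (h : {poly int}) (q a a' : int) : (q %| a - a')%Z -> (q %| h.[a] - h.[a'])%Z.
Proof.
move=> ha; rewrite -!(@homog_b1 (size h)) ?leqnSn //.
by apply: homog_mod => //; rewrite subrr dvdz0.
Qed.

Definition height (h : {poly int}) : int := \sum_(i < size h) `|h`_i|.

Lemma homog_le d (h : {poly int}) (a b X : int) : (size h <= d.+1)%N -> `|a| <= X -> `|b| <= X ->
  `|homog d h a b| <= height h * X ^+ d.
Proof.
move=> hs ha hb; rewrite /height.
have -> : \sum_(i < size h) `|h`_i| = \sum_(i < d.+1) `|h`_i|.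
  rewrite (big_ord_widen_cond d.+1 xpredT (fun i => `|h`_i|)) //=.
  rewrite big_mkcond; apply: eq_bigr => i _; case: ltnP => // hi.
  by rewrite nth_default // normr0.
rewrite /homog mulr_suml; apply: le_trans (ler_norm_sum _ _ _) _; apply: ler_sum => i _.
rewrite !normrM !normrX -mulrA ler_wpM2l //.
have -> : X ^+ d = X ^+ i * X ^+ (d - i) by rewrite -exprD subnKC // -ltnS.
have X0 : 0 <= X by apply: le_trans ha.
by apply: ler_pM; rewrite ?exprn_ge0 // lerXn2r ?nnegrE.
Qed.

(** The leading term dominates: the other terms add up to at most [height h] * a^d * b <= a^(d+1) /
    2. *)
Lemma homog_ge d (h : {poly int}) (a b : int) : size h = d.+2 -> 1 <= b -> 2 * height h * b <= a ->
  a ^+ d.+1 <= 2 * `|homog d.+1 h a b|.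
Proof.
move=> hs b1 hab.
have hh0 : 0 <= height h by apply: sumr_ge0 => i _; exact: normr_ge0.
have h1 : 1 <= height h.
  rewrite /height hs big_ord_recr /= -[X in X <= _]add0r lerD //.
    by apply: sumr_ge0 => i _; exact: normr_ge0.
  rewrite -gtz0_ge1 normr_gt0 -[d.+1]/(d.+2.-1) -hs -lead_coefE lead_coef_eq0 -size_poly_eq0.
  by rewrite hs.
have a0 : 0 <= a by apply: le_trans hab; nia.
have ba : b <= a by apply: le_trans hab; nia.
rewrite /homog big_ord_recr /= subnn mulr1.
set S := \sum_(i < d.+1) _.
have hS : 2 * `|S| <= a ^+ d.+1.
  have : `|S| <= height h * (a ^+ d * b).
    apply: le_trans (_ : (\sum_(i < d.+1) `|h`_i|) * (a ^+ d * b) <= _); last first.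
      rewrite ler_wpM2r //; first by rewrite mulr_ge0 ?exprn_ge0 ?(le_trans _ b1).
      by rewrite /height hs [X in _ <= X]big_ord_recr /= lerDl.
    rewrite mulr_suml; apply: le_trans (ler_norm_sum _ _ _) _; apply: ler_sum => i _.
    rewrite !normrM !normrX -mulrA ler_wpM2l // (ger0_norm a0) (ger0_norm (le_trans _ b1)) //.
    have -> : (d.+1 - i = (d - i).+1)%N by rewrite subSn // -ltnS.
    have -> : a ^+ d = a ^+ i * a ^+ (d - i) by rewrite -exprD subnKC // -ltnS.
    rewrite exprS -!mulrA ler_wpM2l ?exprn_ge0 // mulrC ler_wpM2r ?(le_trans _ b1) //.
    by rewrite lerXn2r ?nnegrE ?(le_trans _ b1).
  rewrite exprS; have : 0 <= a ^+ d by rewrite exprn_ge0.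
  by move: (a ^+ d) (`|S|) => x y; nia.
have : a ^+ d.+1 <= `|h`_d.+1 * a ^+ d.+1|.
  rewrite normrM [X in _ * X]ger0_norm ?exprn_ge0 // ler_peMl ?exprn_ge0 //.
  rewrite -gtz0_ge1 normr_gt0 -[d.+1]/(d.+2.-1) -hs -lead_coefE lead_coef_eq0 -size_poly_eq0.
  by rewrite hs.
have := ler_normB (S + h`_d.+1 * a ^+ d.+1) S; rewrite [S + _ - S]addrC addKr.
by move: (a ^+ d.+1) (`|S|) (`|_ * _|) (`|_ + _|) hS => x y z w; lia.
Qed.

(** * Roots modulo primes and Hensel's lemma *)

Section RootsModP.
Variables (p : nat) (p_prime : prime p).

Lemma intr_Fp_eq0 (x : int) : (x%:~R == 0 :> 'F_p) = (p %| x)%Z.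
Proof.
have ch : p \in [pchar 'F_p] by rewrite pchar_Fp.
have natE n : ((n%:R : 'F_p) == 0) = (p %| n)%N by rewrite (dvdn_pcharf ch).
case: x => n; first by rewrite -pmulrn natE.
by rewrite NegzE rmorphN /= oppr_eq0 -pmulrn natE dvdzE abszN.
Qed.

Definition roots_mod (h : {poly int}) : seq nat :=
  [seq r <- iota 0 p | (p %| h.[r%:Z])%Z].

Lemma size_roots_mod (h : {poly int}) :
  ~~ (p %| lead_coef h)%Z -> (size (roots_mod h) <= (size h).-1)%N.
Proof.
move=> lh; pose hp := map_poly (intr : int -> 'F_p) h.
have hp0 : (lead_coef h)%:~R != 0 :> 'F_p by rewrite intr_Fp_eq0.
have shp : size hp = size h by rewrite size_poly_eq // intr_eq0.
have hp_neq0 : hp != 0.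
  by rewrite -size_poly_eq0 shp size_poly_eq0 -lead_coef_eq0; apply: contra hp0 => /eqP ->.
pose s := [seq (r%:R : 'F_p) | r <- roots_mod h].
have su : uniq s.
  rewrite map_inj_in_uniq ?filter_uniq ?iota_uniq // => x y.
  rewrite !mem_filter !mem_iota !add0n => /and3P[_ _ xp] /and3P[_ _ yp] /(congr1 val).
  by rewrite /= !val_Fp_nat // !modn_small.
have sr : all (root hp) s.
  apply/allP => x /mapP[r]; rewrite mem_filter => /andP[hr _] ->.
  rewrite /root /hp -[r%:R]/(r%:Z%:~R) horner_map /= intr_Fp_eq0 //.
have := max_poly_roots hp_neq0 sr su; rewrite size_map shp.
by case: (size h).
Qed.

End RootsModP.

Section Hensel.
Variables (u v g : {poly int}) (c : int) (p : nat).
Hypotheses (p_prime : prime p) (uvg : u * g + v * g^`() = c%:P) (pc : ~~ (p %| c)%Z).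

Lemma deriv_root_mod (r : int) : (p %| g.[r])%Z -> ~~ (p %| g^`().[r])%Z.
Proof.
move=> h; apply: contra pc => h'.
by rewrite -(hornerC c r) -uvg hornerD !hornerM rpredD ?dvdz_mull.
Qed.

(** Write g - g(r') = w (X - r'). Then w(r') = g'(r') is a unit modulo p by the Bezout identity,
    hence so is w(r), and p^2 divides w(r) (r - r'). *)
Lemma hensel_uniq (r r' : int) : (p %| r - r')%Z ->
  ((p ^ 2)%N %| g.[r])%Z -> ((p ^ 2)%N %| g.[r'])%Z -> ((p ^ 2)%N %| r - r')%Z.
Proof.
move=> rr' gr gr'.
have [w wE] : exists w, g - g.[r']%:P = w * ('X - r'%:P).
  by apply/factor_theorem; rewrite /root !hornerE subrr.
have pg : (p %| g.[r'])%Z by apply: dvdz_trans gr'; rewrite dvdzE /= dvdn_exp.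
have wr' : w.[r'] = g^`().[r'].
  have := congr1 (fun f => f^`().[r']) wE.
  by rewrite derivB derivC subr0 derivM derivXsubC !hornerE subrr mulr0 add0r.
have wr : ~~ (p %| w.[r])%Z.
  apply: contra (deriv_root_mod pg); rewrite -wr' => h.
  have := horner_mod w rr'; rewrite -rpredN opprB => h'.
  by rewrite -[w.[r']](subrK w.[r]) rpredD.
have : ((p ^ 2)%N %| w.[r] * (r - r'))%Z.
  have := congr1 (fun f => f.[r]) wE; rewrite !hornerE => <-.
  by rewrite rpredB.
rewrite Gauss_dvdzr // coprimezE /= coprimeXl // prime_coprime //.
Qed.

End Hensel.

(** A common root of two factors is a double root of the product, so the product and its derivative
    both vanish there modulo p, and with them c. *)
Lemma disjoint_roots_mod (u v g1 g2 g3 : {poly int}) c p (r : int) :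
  u * (g1 * g2 * g3) + v * (g1 * g2 * g3)^`() = c%:P -> ~~ (p %| c)%Z ->
  (p %| g1.[r])%Z -> (p %| g2.[r])%Z -> False.
Proof.
move=> uvg pc h1 h2; move/negP: pc; apply.
rewrite -(hornerC c r) -uvg !(hornerD, hornerM, derivM).
have -> : u.[r] * (g1.[r] * g2.[r] * g3.[r]) + v.[r] *
    ((g1^`().[r] * g2.[r] + g1.[r] * g2^`().[r]) * g3.[r] + g1.[r] * g2.[r] * g3^`().[r]) =
  g1.[r] * (u.[r] * g2.[r] * g3.[r] + v.[r] * (g2^`().[r] * g3.[r] + g2.[r] * g3^`().[r])) +
  g2.[r] * (v.[r] * g1^`().[r] * g3.[r]) by ring.
by apply: rpredD; apply: dvdz_mulr.
Qed.

(* A representative of the class of a/b modulo q, when b is coprime to q. *)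
Definition ratio_mod (q a b : nat) : nat := (((egcdn b q).1 * a) %% q)%N.

Lemma ratio_modP (q a b : nat) : (0 < b)%N -> coprime b q ->
  (q %| (ratio_mod q a b)%:Z * b%:Z - a%:Z)%Z.
Proof.
move=> b0; rewrite /coprime /ratio_mod => /eqP cop.
case: (egcdnP q b0) => k l kb _ /=; rewrite cop in kb.
have -> : ((k * a) %% q)%N%:Z * b%:Z - a%:Z =
    (((k * a) %% q)%N%:Z - (k * a)%N%:Z) * b%:Z + (l * a)%N%:Z * q%:Z.
  rewrite mulrBl -(PoszM (k * a)) mulnAC kb !PoszM PoszD PoszM; ring.
apply: rpredD; last exact: dvdz_mull.
apply: dvdz_mulr; rewrite -rpredN opprB {1}(divn_eq (k * a) q) PoszD addrK PoszM.
exact: dvdz_mull.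
Qed.

Lemma homog_ratio_mod d (g : {poly int}) (q a b : nat) : (size g <= d.+1)%N ->
  (0 < b)%N -> coprime b q ->
  (q %| homog d g a b)%Z = (q %| g.[(ratio_mod q a b)%:Z])%Z.
Proof.
move=> gs b0 cop; have rP := ratio_modP a b0 cop.
have : (q %| homog d g ((ratio_mod q a b)%:Z * b%:Z) b - homog d g a b)%Z.
  by apply: homog_mod => //; rewrite subrr dvdz0.
rewrite homog_mull // => h.
have -> : (q %| g.[(ratio_mod q a b)%:Z])%Z = (q %| b%:Z ^+ d * g.[(ratio_mod q a b)%:Z])%Z.
  rewrite Gauss_dvdzr // coprimezE abszX /= coprime_sym coprimeXl //.
apply/idP/idP => h'; first by rewrite -[X in (_ %| X)%Z](subrK (homog d g a b)) rpredD.
by rewrite -[X in (_ %| X)%Z](subKr (b%:Z ^+ d * g.[(ratio_mod q a b)%:Z])) rpredB.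
Qed.

Lemma ratio_mod_cross (q a b a' b' : nat) : (0 < b)%N -> (0 < b')%N ->
  coprime b q -> coprime b' q -> (q %| (ratio_mod q a b)%:Z - (ratio_mod q a' b')%:Z)%Z ->
  (q %| a%:Z * b'%:Z - a'%:Z * b%:Z)%Z.
Proof.
move=> b0 b0' cop cop' h.
have h1 := ratio_modP a b0 cop; have h2 := ratio_modP a' b0' cop'.
set r := (ratio_mod q a b)%:Z in h1 h *; set r' := (ratio_mod q a' b')%:Z in h2 h *.
have -> : a%:Z * b'%:Z - a'%:Z * b%:Z =
  (r' * b'%:Z - a'%:Z) * b%:Z - (r * b%:Z - a%:Z) * b'%:Z + (r - r') * (b%:Z * b'%:Z) by ring.
by apply: rpredD; [apply: rpredB|]; apply: dvdz_mulr.
Qed.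

(** The converse of [ratio_mod_cross], with p apart from q so that representatives modulo p^2 can be
    compared modulo p. *)
Lemma cross_ratio_mod (p q a b a' b' : nat) : (0 < b)%N -> (0 < b')%N ->
  coprime b q -> coprime b' q -> (p %| q)%N -> 
  (p %| a%:Z * b'%:Z - a'%:Z * b%:Z)%Z ->
  (p %| (ratio_mod q a b)%:Z - (ratio_mod q a' b')%:Z)%Z.
Proof.
move=> b0 b0' cop cop' pq h.
have h1 := ratio_modP a b0 cop; have h2 := ratio_modP a' b0' cop'.
set r := (ratio_mod q a b)%:Z in h1 *; set r' := (ratio_mod q a' b')%:Z in h2 *.
have cp : coprime b p by apply: coprime_dvdr cop.
have cp' : coprime b' p by apply: coprime_dvdr cop'.
have : (p %| (b%:Z * b'%:Z) * (r - r'))%Z.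
  have -> : (b%:Z * b'%:Z) * (r - r') = (r * b%:Z - a%:Z) * b'%:Z -
     (r' * b'%:Z - a'%:Z) * b%:Z + (a%:Z * b'%:Z - a'%:Z * b%:Z) by ring.
  have pq' : (p%:Z %| q%:Z)%Z by [].
  by apply: rpredD => //; apply: rpredB; apply: dvdz_mulr; apply: dvdz_trans pq' _.
by rewrite Gauss_dvdzr // coprimezE abszM /= coprimeMr ![coprime p _]coprime_sym cp cp'.
Qed.

Section PairLemma.
Variables (u v g : {poly int}) (c : int) (d p : nat).
Hypotheses (p_prime : prime p) (uvg : u * g + v * g^`() = c%:P) (pc : ~~ (p %| c)%Z).
Hypothesis gs : (size g <= d.+1)%N.

(** The representatives of both ratios modulo p^2 are roots of g modulo p^2 that agree modulo p, so
    [hensel_uniq] identifies them. *)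
Lemma square_root_cross (a b a' b' : nat) : (0 < b)%N -> (0 < b')%N ->
  ~~ (p %| b)%N -> ~~ (p %| b')%N ->
  ((p ^ 2)%N %| homog d g a b)%Z -> ((p ^ 2)%N %| homog d g a' b')%Z ->
  ratio_mod p a b = ratio_mod p a' b' ->
  ((p ^ 2)%N %| a%:Z * b'%:Z - a'%:Z * b%:Z)%Z.
Proof.
move=> b0 b0' pb pb' h h' rr.
have cop : coprime b p by rewrite coprime_sym prime_coprime.
have cop' : coprime b' p by rewrite coprime_sym prime_coprime.
have copX : coprime b (p ^ 2) by rewrite coprimeXr.
have copX' : coprime b' (p ^ 2) by rewrite coprimeXr.
apply: ratio_mod_cross => //.
apply: (hensel_uniq p_prime uvg pc); rewrite -?(homog_ratio_mod _ gs) //.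
apply: cross_ratio_mod => //; first by rewrite dvdn_exp.
by apply: ratio_mod_cross => //; rewrite rr subrr dvdz0.
Qed.

End PairLemma.

Lemma card_congr (N q : nat) (P : pred 'I_N) : (0 < q)%N ->
  (forall i j : 'I_N, P i -> P j -> (q %| i%:Z - j%:Z)%Z) -> (#|P| <= (N %/ q).+1)%N.
Proof.
move=> q0 h.
have lt (i : 'I_N) : (i %/ q < (N %/ q).+1)%N by rewrite ltnS leq_div2r // ltnW.
pose f i : 'I_(N %/ q).+1 := Ordinal (lt i).
rewrite -[X in (_ <= X)%N]card_ord -(card_in_image (f := f)) ?max_card // => i j Pi Pj [] fij.
apply: val_inj => /=; rewrite (divn_eq i q) (divn_eq j q) fij; congr (_ + _)%N.
have := h i j Pi Pj.
rewrite {1}(divn_eq i q) {1}(divn_eq j q) fij !PoszD opprD addrACA subrr add0r.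
have := ltn_pmod i q0; have := ltn_pmod j q0; move: (i %% q)%N (j %% q)%N => x y xq yq.
rewrite dvdzE /=; case: (ltngtP x y) => // lt' /dvdn_leq; move: q0; lia.
Qed.

Lemma card_classes (T : finType) (k m : nat) (U : eqType) (P : pred T) (cls : T -> U) (s : seq U) :
  (size s <= k)%N -> (forall i, P i -> cls i \in s) ->
  (forall r, r \in s -> #|[pred i | P i & cls i == r]| <= m)%N -> (#|P| <= k * m)%N.
Proof.
move=> sk cs h; apply: leq_trans (_ : size s * m <= _)%N; last by rewrite leq_mul2r sk orbT.
rewrite -sum1_card.
apply: leq_trans (_ : \sum_(r <- s) \sum_(i | P i && (cls i == r)) 1 <= _)%N.
  rewrite (exchange_big_dep P) /=; last by move=> r i _ /andP[].
  apply: leq_sum => i Pi; rewrite -big_filter.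
  set l := seq.filter _ _; have : cls i \in l by rewrite mem_filter eqxx andbT cs // andbT.
  by case: (l) => // r l' _; rewrite big_cons leq_addr.
elim: s {sk cs} h => [|r s IH] h; first by rewrite big_nil.
rewrite big_cons mulSn leq_add //; last by apply: IH => r' r's; apply: h; rewrite inE r's orbT.
by rewrite sum1_card; apply: h; rewrite mem_head.
Qed.

(** * The sieve *)

Lemma card_has_le (T : finType) (U : Type) (Q : U -> pred T) (s : seq U) :
  (#|[pred x | has (Q^~ x) s]| <= \sum_(r <- s) #|Q r|)%N.
Proof.
elim: s => [|r s IH]; first by rewrite big_nil leqn0; apply/eqP/eq_card0 => x.
rewrite big_cons; apply: leq_trans (leq_add (leqnn _) IH).
rewrite -cardUI; apply: leq_trans (leq_addr _ _).
by apply: subset_leq_card; apply/fintype.subsetP => x; rewrite !inE.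
Qed.

Lemma ler_natM (k m n : nat) : (k * m <= n)%N -> k%:R * m%:R <= n%:R :> rat.
Proof. by rewrite -natrM ler_nat. Qed.

Lemma lef_inv_nat (m n : nat) : (0 < m)%N -> (m <= n)%N -> n%:R^-1 <= m%:R^-1 :> rat.
Proof. by move=> m0 mn; rewrite lef_pV2 ?posrE ?ltr0n ?ler_nat ?(leq_trans m0). Qed.

Lemma leq_mul_cancel (k e m n : nat) : (0 < e)%N -> (k * e * m <= e * n)%N -> (k * m <= n)%N.
Proof. by move=> e0; rewrite -mulnA mulnCA leq_pmul2l. Qed.

Lemma leq_factor (n1 n2 n3 m N : nat) : (0 < n1)%N -> (0 < n2)%N -> (0 < n3)%N ->
  (8 * (n1 * n2 * n3) * m <= N)%N -> (0 < m)%N ->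
  [/\ 4 * n1 <= N, 4 * n2 <= N & 4 * n3 <= N]%N.
Proof.
move=> n10 n20 n30 le m0; have {m0} le : (8 * (n1 * n2 * n3) <= N)%N.
  by apply: leq_trans le; rewrite leq_pmulr.
have le1 : (n1 <= n1 * n2 * n3)%N by rewrite -mulnA leq_pmulr // muln_gt0 n20.
have le2 : (n2 <= n1 * n2 * n3)%N by rewrite [(n1 * n2)%N]mulnC -mulnA leq_pmulr // muln_gt0 n10.
have le3 : (n3 <= n1 * n2 * n3)%N by rewrite leq_pmull // muln_gt0 n10.
by split; lia.
Qed.

Lemma cofactor_gt1 (N n w : nat) :
  (0 < n)%N -> (4 * n <= N)%N -> (N ^ 4 <= 2 * (n * w))%N -> (1 < w)%N.
Proof.
move=> n0 nN le; rewrite ltnNge; apply/negP => w1.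
have : (N <= N ^ 4)%N by rewrite -[X in (X <= _)%N]expn1 leq_pexp2l //; lia.
by nia.
Qed.

Lemma squarefree_prod_primes n : (0 < n)%N -> (forall p, prime p -> ~~ (p ^ 2 %| n)%N) ->
  n = (\prod_(p <- primes n) p)%N.
Proof.
move=> n0 sqf; rewrite {1}(prod_prime_decomp n0) prime_decompE big_map big_seq [RHS]big_seq.
apply: eq_bigr => p; rewrite mem_primes => /and3P[pp _ pn] /=.
have := sqf p pp; rewrite pfactor_dvdn // -ltnNge => l2.
have l1 : (0 < logn p n)%N by rewrite -pfactor_dvdn // expn1.
by rewrite (_ : logn p n = 1%N) ?expn1 //; apply/eqP; rewrite eqn_leq l1 -ltnS l2.
Qed.

(** Here m is a value of size at least N^12 / (8 f), and S <= N^9 its part made of small primes.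
    What is left is at least N^3 / (8 f); the power of N in excess of N^2 pays for the constants. *)
Lemma leq_cancel_large (L S m f N e J w : nat) :
  (N ^ 12 <= 8 * (f * m))%N -> (m = L * S)%N -> (S <= w)%N -> (w = N ^ 9)%N -> (0 < N)%N ->
  (8 * f * e <= N)%N -> (0 < f)%N -> (e * N ^ 2 <= L)%N.
Proof.
move=> h1 mE Sw wE N0 h2 f0; rewrite mE in h1.
have : (N ^ 9 * N ^ 3 <= N ^ 9 * (8 * f * L))%N.
  rewrite -expnD; apply: leq_trans h1 _.
  have : (f * (L * S) <= f * (L * N ^ 9))%N by rewrite !leq_mul2l -wE Sw !orbT.
  by move: (N ^ 9)%N (L * S)%N => A C h; lia.
rewrite leq_pmul2l ?expn_gt0 ?N0 // => h3.
rewrite -(leq_pmul2l (_ : 0 < 8 * f)%N) ?muln_gt0 //.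
by apply: leq_trans h3; rewrite mulnA [(N ^ 3)%N]expnS leq_mul2r h2 orbT.
Qed.

(** * Counting good pairs in a box *)

Section Counting.
Variables (g u v : {poly int}) (c : int) (B M K a0 z J : nat).
Let N := (2 ^ J)%N.
Hypothesis (gs : size g = 13%N) (uvg : u * g + v * g^`() = c%:P).
Hypothesis good_prime : forall p, prime p -> ~~ (p %| B)%N ->
  [/\ (z < p)%N, ~~ (p %| M)%N, ~~ (p %| c)%Z & ~~ (p %| lead_coef g)%Z].
Hypothesis bad_prime : forall p, prime p -> (p %| B)%N -> (p %| M)%N.

(* Since a = a0 and b = 1 modulo M, the part of F(a, b) supported on the primes dividing M
   is constant; the shift by M K N makes a/b large, so that |F(a, b)| is about a^12. *)
Definition coordA (i : nat) : nat := (a0 + M * (K * N + i))%N.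
Definition coordB (j : nat) : nat := (1 + M * j)%N.
Let a := coordA.
Let b := coordB.
Let T : finType := ('I_N * 'I_N)%type.
Let F (x : T) : int := homog 12 g (a x.1) (b x.2).

Variable al : nat.
Hypotheses (M_gt0 : (0 < M)%N) (K_gt0 : (0 < K)%N) (hal : (a0 + M * K.+1 <= 2 ^ al)%N).

Let N_gt0 : (0 < N)%N. Proof. by rewrite expn_gt0. Qed.

Lemma coordA_lt (i : 'I_N) : (a i < 2 ^ (al + J))%N.
Proof.
have iN := ltn_ord i.
rewrite expnD; apply: leq_trans (_ : (a0 + M * K.+1) * N <= _)%N; last first.
  by rewrite leq_mul2r hal orbT.
rewrite /a /coordA; move: (nat_of_ord i) iN N_gt0 M_gt0 => /= k; move: N => n; nia.
Qed.

Lemma coordB_lt (j : 'I_N) : (b j < 2 ^ (al + J))%N.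
Proof.
have iN := ltn_ord j.
rewrite expnD; apply: leq_trans (_ : (a0 + M * K.+1) * N <= _)%N; last first.
  by rewrite leq_mul2r hal orbT.
rewrite /b /coordB; move: (nat_of_ord j) iN N_gt0 M_gt0 K_gt0 => /= k; move: N => n; nia.
Qed.

Lemma coordB_bad j p : prime p -> (p %| B)%N -> ~~ (p %| b j)%N.
Proof.
move=> pp pB; rewrite /b /coordB dvdn_addl ?dvdn_mulr ?bad_prime //.
by rewrite dvdn1; apply: contraTneq pp => ->.
Qed.

Lemma dvd_coordA (q i j : nat) : (q %| (a i)%:Z - (a j)%:Z)%Z = (q %| M%:Z * (i%:Z - j%:Z))%Z.
Proof.
have -> : (a i)%:Z - (a j)%:Z = M%:Z * (i%:Z - j%:Z).
  by rewrite /a /coordA !PoszD !PoszM !PoszD; ring.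
by [].
Qed.

Lemma dvd_coordB (q i j : nat) : (q %| (b i)%:Z - (b j)%:Z)%Z = (q %| M%:Z * (i%:Z - j%:Z))%Z.
Proof.
have -> : (b i)%:Z - (b j)%:Z = M%:Z * (i%:Z - j%:Z) by rewrite /b /coordB !PoszD !PoszM; ring.
by [].
Qed.

Lemma coord_inj (x x' : T) : a x.1 = a x'.1 -> b x.2 = b x'.2 -> x = x'.
Proof.
case: x x' => [i j] [i' j'] /=; rewrite /a /b /coordA /coordB => /addnI ei /addnI ej.
by congr (_, _); apply: val_inj => /=; move: ei ej M_gt0; nia.
Qed.

Lemma card_common_prime p : prime p -> ~~ (p %| B)%N ->
  (#|[pred x : T | (p %| a x.1)%N && (p %| b x.2)%N]| <= (N %/ p).+1 ^ 2)%N.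
Proof.
move=> pp pB; have [_ pM _ _] := good_prime pp pB.
have copM : coprimez p M by rewrite coprimezE /= prime_coprime.
have -> : #|[pred x : T | (p %| a x.1)%N && (p %| b x.2)%N]| =
    (#|[pred i : 'I_N | p %| a i]| * #|[pred j : 'I_N | p %| b j]|)%N.
  by rewrite -cardX; apply: eq_card => x; rewrite !inE.
rewrite expnS expn1; apply: leq_mul; apply: card_congr; rewrite ?prime_gt0 // => i j pi pj.
- rewrite -(Gauss_dvdzr _ copM) -dvd_coordA.
  by apply: rpredB.
rewrite -(Gauss_dvdzr _ copM) -dvd_coordB.
by apply: rpredB.
Qed.

Lemma card_pairs (P : pred T) k : (forall j, #|[pred i | P (i, j)]| <= k)%N -> (#|P| <= N * k)%N.
Proof.
move=> h; apply: (@card_classes _ _ _ _ _ snd (enum 'I_N)); first by rewrite size_enum_ord.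
  by move=> x _; rewrite mem_enum.
move=> j _; apply: leq_trans (h j).
rewrite -(card_in_image (f := fst)); last first.
  by move=> [i1 j1] [i2 j2]; rewrite !inE /= => /andP[_ /eqP ->] /andP[_ /eqP ->] ->.
apply: subset_leq_card; apply/fintype.subsetP => i /fintype.imageP[[i' j']].
rewrite !inE /= => /andP[Px /eqP <-] ->.
by [].
Qed.

Let gs' : (size g <= 13)%N. Proof. by rewrite gs. Qed.

(** For fixed b there are at most 12 classes of a modulo p, one for each root of g; for q = p^2 each
    of them lifts to at most one class modulo p^2, by Hensel uniqueness. *)
Lemma card_dvd_prime p q : prime p -> ~~ (p %| B)%N -> q = p \/ q = (p ^ 2)%N ->
  (#|[pred x : T | ~~ (p %| b x.2)%N && (q %| F x)%Z]| <= N * (12 * (N %/ q).+1))%N.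
Proof.
move=> pp pB qE; have [_ pM pc pl] := good_prime pp pB.
have q_gt0 : (0 < q)%N by case: qE => ->; rewrite ?expn_gt0 prime_gt0.
have copX m : ~~ (p %| m)%N -> coprime m q.
  by move=> pm; case: qE => ->; rewrite ?coprimeXr // coprime_sym prime_coprime.
have pq : (p %| q)%N by case: qE => ->; rewrite ?dvdn_exp.
apply: card_pairs => j.
apply: (@card_classes _ _ _ _ _ (fun i : 'I_N => ratio_mod p (a i) (b j)) (roots_mod p g)).
- by apply: leq_trans (size_roots_mod pp pl) _; rewrite gs.
- move=> i /andP[/= pb qF].
  rewrite mem_filter mem_iota /= ltn_pmod ?prime_gt0 // andbT.
  rewrite -(homog_ratio_mod (d := 12)) //; last by rewrite coprime_sym prime_coprime.
  by apply: dvdz_trans qF.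
move=> r _; apply: card_congr => // i i'; rewrite !inE /=.
move=> /andP[/andP[pb qF] /eqP ri] /andP[/andP[_ qF'] /eqP ri'].
have : (q %| (a i)%:Z * (b j)%:Z - (a i')%:Z * (b j)%:Z)%Z.
  case: qE qF qF' => -> qF qF'.
    apply: ratio_mod_cross => //; rewrite ?(coprime_sym _ p) ?prime_coprime //.
    by rewrite ri ri' subrr dvdz0.
  by apply: (square_root_cross pp uvg pc gs'); rewrite // ri ri'.
rewrite -mulrBl Gauss_dvdzl ?coprimezE /= ?(coprime_sym q) ?copX //.
by rewrite dvd_coordA Gauss_dvdzr // coprimezE /= coprime_sym copX.
Qed.

Let cop (x : T) := coprime (a x.1) (b x.2).

(** The difference a b' - a' b is smaller than q in absolute value, so it vanishes, and proportional
    pairs of coprime positive integers are equal. *)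
Lemma cross_eq0 (x x' : T) (q : nat) : cop x -> cop x' -> (2 ^ (2 * (al + J)) <= q)%N ->
  (q %| (a x.1)%:Z * (b x'.2)%:Z - (a x'.1)%:Z * (b x.2)%:Z)%Z -> x = x'.
Proof.
move=> cx cx' hq; have Alt := coordA_lt x.1; have Blt := coordB_lt x.2.
have Alt' := coordA_lt x'.1; have Blt' := coordB_lt x'.2.
move: hq; rewrite mul2n -addnn expnD => hq.
have e : (a x.1 * b x'.2 = a x'.1 * b x.2)%N -> x = x'.
  move=> e; have bb : b x.2 = b x'.2.
    apply/eqP; rewrite eqn_dvd; apply/andP; split.
      by rewrite -(@Gauss_dvdr _ (a x.1)) ?e ?dvdn_mull // coprime_sym.
    by rewrite -(@Gauss_dvdr _ (a x'.1)) -?e ?dvdn_mull // coprime_sym.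
  apply: coord_inj => //.
  by move/eqP: e; rewrite bb eqn_pmul2r // => /eqP.
rewrite -!PoszM dvdzE /= => h; apply: e.
have {h} := h; move: hq Alt Blt Alt' Blt'.
move: (a x.1) (b x.2) (a x'.1) (b x'.2) (2 ^ (al + J))%N => xa xb xa' xb' X.
move=> hq h1 h2 h3 h4.
have b1 : (xa * xb' < X * X)%N by apply: ltn_mul.
have b2 : (xa' * xb < X * X)%N by apply: ltn_mul.
case: (ltngtP (xa * xb') (xa' * xb)) => // lt; move/dvdn_leq; lia.
Qed.

(* Two pairs in the same class modulo p are in the same class modulo p^2 by Hensel's
   lemma; being small with respect to p they are then proportional, hence equal. *)
Lemma card_large_square p : prime p -> ~~ (p %| B)%N -> (2 ^ (al + J) <= p)%N ->
  (#|[pred x : T | [&& cop x, ~~ (p %| b x.2)%N & ((p ^ 2)%N %| F x)%Z]]| <= 12)%N.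
Proof.
move=> pp pB hp; have [_ pM pc pl] := good_prime pp pB.
rewrite -[X in (_ <= X)%N]muln1.
apply: (@card_classes _ _ _ _ _ (fun x : T => ratio_mod p (a x.1) (b x.2)) (roots_mod p g)).
- by apply: leq_trans (size_roots_mod pp pl) _; rewrite gs.
- move=> x /and3P[/= _ pb qF].
  rewrite mem_filter mem_iota /= ltn_pmod ?prime_gt0 // andbT.
  rewrite -(homog_ratio_mod (d := 12)) //; last by rewrite coprime_sym prime_coprime.
  by apply: dvdz_trans qF; rewrite dvdzE /= dvdn_exp.
move=> r _; apply/card_le1_eqP => x x'; rewrite !inE /=.
move=> /andP[/and3P[cx pb h] /eqP rx] /andP[/and3P[cx' pb' h'] /eqP rx'].
apply: (@cross_eq0 _ _ (p ^ 2)) => //; first by rewrite mulnC expnM leq_sqr.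
by apply: (square_root_cross pp uvg pc gs'); rewrite // rx rx'.
Qed.

(** If p divided b, then F would be congruent to its leading coefficient times a^12, which is prime
    to p since a is. *)
Lemma cop_dvd p (x : T) : prime p -> ~~ (p %| B)%N -> cop x -> (p %| F x)%Z -> ~~ (p %| b x.2)%N.
Proof.
move=> pp pB cx pF; have [_ _ _ pl] := good_prime pp pB; apply/negP => pb.
have pa : ~~ (p %| a x.1)%N.
  apply/negP => pa; have : (p %| gcdn (a x.1) (b x.2))%N by rewrite dvdn_gcd pa.
  by rewrite (eqP cx) dvdn1 => /eqP p1; move: pp; rewrite p1.
have : (p %| homog 12 g (a x.1) 0)%Z.
  rewrite -[homog _ _ _ 0](subKr (F x)); apply: rpredB => //.
  by apply: homog_mod; rewrite ?subrr ?dvdz0 ?subr0.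
rewrite /homog big_ord_recr /= big1 => [|i _]; last first.
  by rewrite (_ : 12 - i = (11 - i).+1)%N ?expr0n ?mulr0 //= subSn // -ltnS.
rewrite add0r subnn mulr1 -[12%N]/(13.-1)%N -gs -lead_coefE gs.
rewrite mulrC Gauss_dvdzr; first exact/negP.
by rewrite coprimezE abszX /= coprimeXr // prime_coprime.
Qed.

Lemma not_cop (x : T) : ~~ cop x ->
  exists p, [/\ prime p, ~~ (p %| B)%N, (p < 2 ^ (al + J))%N, (p %| a x.1)%N & (p %| b x.2)%N].
Proof.
rewrite /cop /coprime => h; pose p := pdiv (gcdn (a x.1) (b x.2)).
have g0 : (0 < gcdn (a x.1) (b x.2))%N by rewrite gcdn_gt0 orbT.
have g1 : (1 < gcdn (a x.1) (b x.2))%N by rewrite ltn_neqAle eq_sym h g0.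
have pp := pdiv_prime g1; have := pdiv_dvd (gcdn (a x.1) (b x.2)).
rewrite -/p dvdn_gcd => /andP[pa pb]; exists p; split=> //.
  by apply/negP => pB; move: pb; apply/negP; apply: coordB_bad.
by apply: leq_ltn_trans (dvdn_leq _ pb) (coordB_lt _).
Qed.

Let admissible p := prime p && ~~ (p %| B)%N.
Hypothesis z_gt0 : (0 < z)%N.

(** Admissible primes exceed z, so sums of p^-2 over them are at most 1/z. *)
Lemma sum_admissible (n : nat) (f : nat -> rat) : (forall p, 0 <= f p) ->
  \sum_(0 <= p < n | admissible p) f p <= \sum_(z.+1 <= p < n) f p.
Proof.
move=> f0.
rewrite (eq_bigl (fun p => admissible p && (z.+1 <= p)%N)).
  rewrite -big_nat_widenl // big_mkcond; apply: ler_sum => p _.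
  by case: ifP.
move=> p; rewrite andb_idr // => /andP[pp pB].
by have [] := good_prime pp pB.
Qed.

Lemma divn_succ_le (p q : nat) : (0 < q)%N -> ((p %/ q).+1)%:R <= p%:R / q%:R + 1 :> rat.
Proof.
move=> q0; rewrite -natr1 lerD2r ler_pdivlMr ?ltr0n // -natrM ler_nat.
exact: leq_trunc_div.
Qed.

(** A prime p costs (N/p + 1)^2 <= 2 N^2 / p^2 + 2. A common prime divides b and is thus below 2^(al
    + J), so the constant terms add up to O(N) only. *)
Lemma card_not_cop :
  #|[pred x | ~~ cop x]|%:R <= 2 * N%:R ^+ 2 / z%:R + 2 * (2 ^ (al + J))%:R :> rat.
Proof.
set n := (2 ^ (al + J))%N.
pose Q p := [pred x : T | (p %| a x.1)%N && (p %| b x.2)%N].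
have le1 : (#|[pred x | ~~ cop x]| <= \sum_(0 <= p < n | admissible p) (N %/ p).+1 ^ 2)%N.
  apply: leq_trans (_ : #|[pred x | has (Q^~ x) [seq p <- index_iota 0 n | admissible p]]| <= _)%N.
    apply: subset_leq_card; apply/fintype.subsetP => x.
    rewrite !inE => /not_cop[p [pp pB pn pa pb]].
    apply/hasP; exists p; last by rewrite /Q /= pa.
    by rewrite mem_filter mem_index_iota /admissible pp pB.
  apply: leq_trans (card_has_le _ _) _; rewrite big_filter; apply: leq_sum => p /andP[pp pB].
  exact: card_common_prime.
apply: le_trans (_ : \sum_(0 <= p < n | admissible p) (2 * N%:R ^+ 2 * p%:R ^- 2 + 2) <= _).
  apply: le_trans (_ : (\sum_(0 <= p < n | admissible p) (N %/ p).+1 ^ 2)%:R <= _).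
    by rewrite ler_nat.
  rewrite natr_sum; apply: ler_sum => p /andP[/prime_gt0 p0 _].
  have := divn_succ_le N p0.
  have t0 : 0 <= N%:R / p%:R :> rat by rewrite divr_ge0.
  have -> : 2 * N%:R ^+ 2 * p%:R ^- 2 + 2 = 2 * (N%:R / p%:R) ^+ 2 + 2 :> rat.
    by rewrite expr_div_n; ring.
  move: t0; move: (N%:R / p%:R) => t t0 h.
  have s0 : 0 <= (N %/ p).+1%:R :> rat by [].
  rewrite natrX; move: s0 h; move: ((N %/ p).+1%:R) => s s0 h.
  have h1 : s ^+ 2 <= (t + 1) ^+ 2 by apply: lerXn2r; rewrite ?nnegrE ?addr_ge0.
  apply: le_trans h1 _; have := sqr_ge0 (t - 1); lra.
apply: le_trans (sum_admissible _ _) _ => [p|].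
  by rewrite addr_ge0 ?mulr_ge0 ?invr_ge0 ?exprn_ge0.
rewrite big_split /= -mulr_sumr lerD //.
  rewrite ler_wpM2l ?mulr_ge0 ?exprn_ge0 //; exact: sum_inv_sq.
rewrite sumr_const_nat -[2 *+ _]mulr_natr ler_wpM2l // ler_nat; exact: leq_subr.
Qed.

Let sqf p := [pred x : T | [&& cop x, ~~ (p %| b x.2)%N & ((p ^ 2)%N %| F x)%Z]].

(** The +1 in the size of a class costs 12 N for each prime, in total 12 N times the number of
    primes up to a constant multiple of N; this is o(N^2) because primes have density zero. *)
Lemma card_small_squares :
  #|[pred x | has (sqf^~ x) [seq p <- index_iota 0 (2 ^ (al + J)) | admissible p]]|%:R <=
  12 * N%:R ^+ 2 / z%:R + 12 * N%:R * (\sum_(0 <= p < 2 ^ (al + J) | prime p) 1)%:R :> rat.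
Proof.
set n := (2 ^ (al + J))%N.
apply: le_trans (_ : (\sum_(0 <= p < n | admissible p) N * (12 * (N %/ (p ^ 2)).+1))%:R <= _).
  rewrite ler_nat; apply: leq_trans (card_has_le _ _) _; rewrite big_filter.
  apply: leq_sum => p /andP[pp pB]; apply: leq_trans (card_dvd_prime pp pB (or_intror (erefl _))).
  by apply: subset_leq_card; apply/fintype.subsetP => x; rewrite !inE => /and3P[_ -> ->].
rewrite natr_sum.
apply: le_trans (_ : \sum_(0 <= p < n | admissible p)
    (12 * N%:R ^+ 2 * p%:R ^- 2 + 12 * N%:R) <= _).
  apply: ler_sum => p /andP[/prime_gt0 p0 _].
  have p20 : (0 < p ^ 2)%N by rewrite expn_gt0 p0.
  have := divn_succ_le N p20; rewrite natrX => h.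
  rewrite !natrM.
  have -> : 12 * N%:R ^+ 2 * p%:R ^- 2 + 12 * N%:R =
      N%:R * (12 * (N%:R / p%:R ^+ 2 + 1)) :> rat by ring.
  apply: ler_wpM2l; first exact: ler0n.
  by apply: ler_wpM2l => //; exact: ler0n.
rewrite big_split /=; apply: lerD.
  apply: le_trans (sum_admissible _ _) _ => [p|]; first by rewrite ?mulr_ge0 ?invr_ge0 ?exprn_ge0.
  rewrite -mulr_sumr ler_wpM2l ?mulr_ge0 ?exprn_ge0 //; exact: sum_inv_sq.
rewrite natr_sum mulr_sumr big_mkcond [X in _ <= X]big_mkcond; apply: ler_sum => p _.
rewrite /admissible mulr1; have h0 : 0 <= 12 * N%:R :> rat by apply: mulr_ge0.
by case: (prime p); case: (p %| B)%N; rewrite /= ?lexx.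
Qed.

(** Each prime costs at most 12 pairs. For n of order N^2 the total is o(N^2), again by the density
    of the primes. *)
Lemma card_large_squares n :
  #|[pred x | has (sqf^~ x) [seq p <- index_iota (2 ^ (al + J)) n | admissible p]]|%:R <=
  12 * (\sum_(0 <= p < n | prime p) 1)%:R :> rat.
Proof.
rewrite -[12]/(12%:R) -natrM ler_nat; apply: leq_trans (card_has_le _ _) _; rewrite big_filter.
rewrite big_distrr /= muln1.
apply: leq_trans (_ : \sum_(2 ^ (al + J) <= p < n | admissible p) 12 <= _)%N.
  rewrite big_seq_cond [X in (_ <= X)%N]big_seq_cond; apply: leq_sum => p.
  rewrite mem_index_iota => /andP[/andP[hp _] /andP[pp pB]].
  exact: card_large_square.
rewrite (big_nat_widenl _ 0) // big_mkcond [X in (_ <= X)%N]big_mkcond; apply: leq_sum => p _.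
by rewrite /admissible; case: (prime p) => //=; case: ifP.
Qed.

Variable y : nat.
Hypothesis (yJ : (96 * y <= J)%N).

(* An upper bound for log_2 of the product of the admissible primes below 2^y dividing F. *)
Definition small_weight (x : T) : nat :=
  \sum_(0 <= p < 2 ^ y | admissible p && (p %| F x)%Z) (trunc_log 2 p).+1.

(** After exchanging the sums, p contributes its weight for at most 24 N^2 / p pairs, and Mertens'
    sum appears; 96 = 24 * 4. *)
Lemma sum_small_weight :
  (\sum_(x | cop x) small_weight x)%:R <= 96 * N%:R ^+ 2 * y%:R :> rat.
Proof.
rewrite /small_weight (exchange_big_dep admissible) /=; last by move=> x p _ /andP[].
rewrite natr_sum.
apply: le_trans (_ : \sum_(0 <= p < 2 ^ y | admissible p) 24 * N%:R ^+ 2 *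
   ((trunc_log 2 p).+1%:R / p%:R) <= _).
  rewrite big_seq_cond [X in _ <= X]big_seq_cond; apply: ler_sum => p.
  rewrite mem_index_iota => /andP[/= py /andP[pp pB]].
  rewrite sum_nat_cond_const.
  have p0 := prime_gt0 pp.
  (* As p <= N, the +1 in the class count is absorbed by a factor 2, so that 12 becomes 24. *)
  have pN : (p <= N)%N.
    apply: leq_trans (ltnW py) _; rewrite leq_exp2l //; apply: leq_trans yJ.
    exact: leq_pmull.
  have c1 : (#|[set x | cop x & admissible p && (p %| F x)%Z]| <= N * (12 * (N %/ p).+1))%N.
    apply: leq_trans (card_dvd_prime pp pB (or_introl (erefl _))).
    apply: subset_leq_card; apply/fintype.subsetP => x; rewrite !inE => /and3P[cx _ pF].
    by rewrite pF (cop_dvd pp pB).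
  rewrite natrM.
  have c2 : #|[set x | cop x & admissible p && (p %| F x)%Z]|%:R <= 24 * N%:R ^+ 2 / p%:R :> rat.
    apply: le_trans (_ : (N * (12 * (N %/ p).+1))%:R <= _); first by rewrite ler_nat.
    rewrite !natrM; have := divn_succ_le N p0.
    have p0' : 0 < p%:R :> rat by rewrite ltr0n.
    have h1 : 1 <= N%:R / p%:R :> rat by rewrite ler_pdivlMr // mul1r ler_nat.
    have N0 : 0 <= N%:R :> rat by [].
    have -> : 24 * N%:R ^+ 2 / p%:R = N%:R * (12 * (2 * (N%:R / p%:R))) :> rat by ring.
    move=> h; apply: ler_wpM2l; first exact: ler0n.
    apply: ler_wpM2l; first exact: ler0n.
    by lra.
  have -> : 24 * N%:R ^+ 2 * ((trunc_log 2 p).+1%:R / p%:R) =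
      (24 * N%:R ^+ 2 / p%:R) * (trunc_log 2 p).+1%:R :> rat by ring.
  by rewrite ler_wpM2r.
rewrite -mulr_sumr.
have -> : 96 * N%:R ^+ 2 * y%:R = 24 * N%:R ^+ 2 * (4 * y)%:R :> rat by rewrite natrM; ring.
rewrite ler_wpM2l ?mulr_ge0 ?exprn_ge0 //; apply: le_trans (sum_log_prime_over_prime y).
rewrite big_mkcond [X in _ <= X]big_mkcond; apply: ler_sum => p _.
rewrite /admissible; case: (prime p) => //=; case: ifP => // _; by rewrite divr_ge0.
Qed.

(** Markov's inequality: the total weight is at most 96 N^2 y <= N^2 J, so at most a ninth of the
    pairs exceed 9 J. *)
Lemma card_heavy : (0 < J)%N ->
  #|[pred x | cop x && (9 * J < small_weight x)%N]|%:R <= N%:R ^+ 2 / 9 :> rat.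
Proof.
move=> J0; set X := #|_|.
have h1 : (X * (9 * J) <= \sum_(x | cop x) small_weight x)%N.
  rewrite -sum_nat_const [X in (_ <= X)%N]big_mkcond /= big_mkcond /=; apply: leq_sum => x _.
  by rewrite inE /=; case: (cop x) => //=; case: ifP => // /ltnW.
have h2 : (X * (9 * J))%:R <= 96 * N%:R ^+ 2 * y%:R :> rat.
  by apply: le_trans sum_small_weight; rewrite ler_nat.
have h3 : 96 * y%:R <= J%:R :> rat by rewrite -natrM ler_nat.
have J0' : 0 < J%:R :> rat by rewrite ltr0n.
have N0 : 0 <= N%:R ^+ 2 :> rat by rewrite exprn_ge0.
rewrite -(ler_pM2r J0') -(ler_pM2r (ltr0Sn rat 8)).
move: h2 h3 N0; rewrite !natrM; move: (N%:R ^+ 2) (y%:R) (X%:R) (J%:R) => n yy x j h2 h3 n0.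
have : n * (96 * yy) <= n * j by rewrite ler_wpM2l.
lra.
Qed.

Variable ga : nat.
(** 40 = 2 * 20 and 240 = 12 * 20: each of the error terms 2 N 2^al, 12 N pi(2^al N) and 12 pi(2^ga
    N^2) then stays below N^2 / 20. *)
Hypotheses (J_gt0 : (0 < J)%N) (z_large : (140 <= z)%N) (J_large : (40 * 2 ^ al <= 2 ^ J)%N).
Hypothesis pi1 : (240 * 2 ^ al * (\sum_(0 <= p < 2 ^ (al + J) | prime p) 1) <= 2 ^ (al + J))%N.
Hypothesis pi2 :
  (240 * 2 ^ ga * (\sum_(0 <= p < 2 ^ (ga + 2 * J) | prime p) 1) <= 2 ^ (ga + 2 * J))%N.

Definition good_pair : pred T := [pred x | [&& cop x,
  ~~ has (sqf^~ x) [seq p <- index_iota 0 (2 ^ (al + J)) | admissible p],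
  ~~ has (sqf^~ x) [seq p <- index_iota (2 ^ (al + J)) (2 ^ (ga + 2 * J)) | admissible p] &
  (small_weight x <= 9 * J)%N]].

(* The proportion lost is at most 2/z + 12/z <= 1/10 for small primes, 3/20 for the three
   error terms, and 1/9 for the pairs of large small_weight. *)
Lemma card_good_pair : (N ^ 2 <= 2 * #|good_pair|)%N.
Proof.
set Q1 := [pred x : T | ~~ cop x].
set Q2 := [pred x | has (sqf^~ x) [seq p <- index_iota 0 (2 ^ (al + J)) | admissible p]].
set Q3 := [pred x | has (sqf^~ x)
  [seq p <- index_iota (2 ^ (al + J)) (2 ^ (ga + 2 * J)) | admissible p]].
set Q4 := [pred x | cop x && (9 * J < small_weight x)%N].
have cardU (P Q : pred T) : (#|[predU P & Q]| <= #|P| + #|Q|)%N.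
  by rewrite -cardUI leq_addr.
have le0 : (N ^ 2 <= #|good_pair| + (#|Q1| + (#|Q2| + (#|Q3| + #|Q4|))))%N.
  have -> : (N ^ 2 = #|T|)%N by rewrite card_prod card_ord expnS expn1.
  apply: leq_trans (_ : #|[predU good_pair & [predU Q1 & [predU Q2 & [predU Q3 & Q4]]]]| <= _)%N.
    apply: subset_leq_card; apply/fintype.subsetP => x _; rewrite !inE /good_pair /=.
    case cx: (cop x) => //=; case: (has _ _) => //=; case: (has _ _) => //=.
    by rewrite leqNgt orNb.
  apply: leq_trans (cardU _ _) _; rewrite leq_add2l.
  apply: leq_trans (cardU _ _) _; rewrite leq_add2l.
  by apply: leq_trans (cardU _ _) _; rewrite leq_add2l cardU.
have q1 := card_not_cop; have q2 := card_small_squares.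
have q3 := card_large_squares (2 ^ (ga + 2 * J)); have q4 := card_heavy J_gt0.
rewrite -/Q1 in q1; rewrite -/Q2 in q2; rewrite -/Q3 in q3; rewrite -/Q4 in q4.
have le0' := le0; rewrite -(ler_nat rat) !natrD natrX in le0'.
rewrite -(ler_nat rat) natrX natrM.
have e0 m : (0 < 2 ^ m)%N by rewrite expn_gt0.
have p1' : 240%:R * (\sum_(0 <= p < 2 ^ (al + J) | prime p) 1)%:R <= N%:R :> rat.
  by apply: ler_natM; apply: leq_mul_cancel (e0 al) _; rewrite -expnD.
have p2' : 240%:R * (\sum_(0 <= p < 2 ^ (ga + 2 * J) | prime p) 1)%:R <= N%:R ^+ 2 :> rat.
  rewrite -natrX; apply: ler_natM; apply: leq_mul_cancel (e0 ga) _.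
  by rewrite -expnM [(J * 2)%N]mulnC -expnD.
have j' : 40%:R * (2 ^ al)%:R <= N%:R :> rat by apply: ler_natM.
have z' : z%:R^-1 <= 140%:R^-1 :> rat by apply: lef_inv_nat.
rewrite expnD natrM in q1.
move: q1 q2 q3 q4 le0' p1' p2' j' z'.
set A := #|good_pair|%:R.
set B1 := #|Q1|%:R; set B2 := #|Q2|%:R; set B3 := #|Q3|%:R; set B4 := #|Q4|%:R.
set S1 := (\sum_(0 <= p < 2 ^ (al + J) | _) 1)%:R.
set S2 := (\sum_(0 <= p < 2 ^ (ga + _) | _) 1)%:R.
rewrite -/N.
have : 0 <= N%:R :> rat by [].
move: (N%:R) (z%:R^-1) ((2 ^ al)%:R) S1 S2 A B1 B2 B3 B4 => n iz za S1 S2 A B1 B2 B3 B4.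
move=> n0 q1 q2 q3 q4 le0' p1 p2 j' z'.
have h1 : n * (40 * za) <= n * n by rewrite ler_wpM2l.
have h2 : n * (240 * S1) <= n * n by rewrite ler_wpM2l.
have h4 := sqr_ge0 n.
have h3 : n ^+ 2 * iz <= n ^+ 2 * 140%:R^-1 by rewrite ler_wpM2l ?exprn_ge0.
lra.
Qed.

(** * Values at good pairs and their multiplicities *)

Variables h1 h2 h3 : {poly int}.
Hypothesis gE : g = h1 * h2 * h3.
Hypotheses (hs1 : size h1 = 5%N) (hs2 : size h2 = 5%N) (hs3 : size h3 = 5%N).
Let f (h : {poly int}) : int := h.[a0%:Z].
Hypotheses (f1_neq0 : f h1 != 0) (f2_neq0 : f h2 != 0) (f3_neq0 : f h3 != 0).
Hypothesis fM : (`|f h1|%N * `|f h2|%N * `|f h3|%N * B %| M)%N.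
Let is_h h := [\/ h = h1, h = h2 | h = h3].
Hypothesis hK : forall h, is_h h -> 2 * height h <= K%:Z.
Hypothesis hga : forall h, is_h h -> height h * 2 ^+ (4 * al) < 2 ^+ (2 * ga).
Hypothesis hJ : (8 * (`|f h1|%N * `|f h2|%N * `|f h3|%N) * 2 ^ (2 * al) <= 2 ^ J)%N.

Definition form_value (h : {poly int}) (x : T) : int := homog 4 h (a x.1) (b x.2).
Definition form_part (h : {poly int}) (x : T) : int := (form_value h x %/ f h)%Z.
Definition value (x : T) : int := form_part h1 x * form_part h2 x * form_part h3 x.

Let is1 : is_h h1. Proof. by constructor 1. Qed.
Let is2 : is_h h2. Proof. by constructor 2. Qed.
Let is3 : is_h h3. Proof. by constructor 3. Qed.
Let size_h h : is_h h -> size h = 5%N. Proof. by case=> ->. Qed.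
Let f_neq0 h : is_h h -> f h != 0. Proof. by case=> ->. Qed.

Lemma form_valueM x : F x = form_value h1 x * form_value h2 x * form_value h3 x.
Proof.
have b0 : (b x.2)%:Z != 0 by [].
rewrite /F gE (@homogM 8 4) ?hs3 // ?(@homogM 4 4) ?hs1 ?hs2 //.
apply: leq_trans (size_polyMleq _ _) _; by rewrite hs1 hs2.
Qed.

(** Since (a, b) is congruent to (a0, 1) modulo M and M is a multiple of [f h] * B, the value h(a,
    b) is congruent to [f h] modulo [f h] * B. *)
Lemma form_partP h x : is_h h ->
  form_value h x = f h * form_part h x /\ (B %| form_part h x - 1)%Z.
Proof.
move=> hh; have h0 := f_neq0 hh.
have fBM : (`|f h|%N * B %| M)%N.
  apply: dvdn_trans fM; rewrite dvdn_mul //.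
  case: hh => ->; last exact: dvdn_mull.
    by rewrite -mulnA dvdn_mulr.
  by apply: dvdn_mulr; apply: dvdn_mull.
have : (M %| form_value h x - f h)%Z.
  rewrite /f -(@homog_b1 4) ?(size_h hh) //; apply: homog_mod.
    by rewrite /a /coordA PoszD PoszM addrAC subrr add0r dvdz_mulr.
  by rewrite /b /coordB PoszD PoszM addrAC subrr add0r dvdz_mulr.
have fBM' : (f h * B%:Z %| M%:Z)%Z by rewrite dvdzE abszM.
move/(dvdz_trans fBM')/dvdzP => [k kE].
have vE : form_value h x = f h * (1 + k * B%:Z).
  by rewrite -[LHS](subrK (f h)) kE; ring.
have pE : form_part h x = 1 + k * B%:Z by rewrite /form_part vE mulrC mulzK.
by rewrite pE; split=> //; rewrite addrC addKr dvdz_mull.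
Qed.

Let ff := f h1 * f h2 * f h3.

Lemma value_mul x : F x = ff * value x.
Proof.
rewrite form_valueM /value /ff.
have [-> _] := form_partP x is1; have [-> _] := form_partP x is2; have [-> _] := form_partP x is3.
by ring.
Qed.

Lemma value_mod x : (B %| value x - 1)%Z.
Proof.
have [_ d1] := form_partP x is1; have [_ d2] := form_partP x is2; have [_ d3] := form_partP x is3.
have -> : value x - 1 = form_part h1 x * form_part h2 x * form_part h3 x - 1 * 1 * 1.
  by rewrite !mulr1.
by apply: dvdz_subM => //; apply: dvdz_subM.
Qed.

Lemma prime_value_bad p x : prime p -> (p %| value x)%Z -> ~~ (p %| B)%N.
Proof.
move=> pp pv; apply/negP => pB.
have : (p %| value x - (value x - 1))%Z.
  by apply: rpredB => //; apply: dvdz_trans (value_mod x).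
rewrite opprB addrC subrK dvdzE /= dvdn1 => /eqP p1; by move: pp; rewrite p1.
Qed.

Lemma form_value_ge h x : is_h h -> (N ^ 4 <= 2 * `|form_value h x|)%N.
Proof.
move=> hh; have jN := ltn_ord x.2.
have ha : 2 * height h * (b x.2)%:Z <= (a x.1)%:Z.
  apply: le_trans (_ : K%:Z * (b x.2)%:Z <= _); first by rewrite ler_wpM2r ?hK.
  rewrite -PoszM lez_nat /a /b /coordA /coordB.
  apply: leq_trans (leq_addl _ _); apply: leq_trans (_ : M * (K * N) <= _)%N.
    rewrite mulnCA leq_mul2l; apply/orP; right.
    apply: leq_trans (_ : M * (x.2).+1 <= _)%N; first by rewrite mulnS leq_add2r.
    by rewrite leq_mul2l jN orbT.
  by rewrite leq_mul2l leq_addr orbT.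
have := @homog_ge 3 h (a x.1) (b x.2) (size_h hh) isT ha.
rewrite -[_ ^+ 4]/((a x.1)%:Z ^+ 4) -abszE -rmorphXn /= -PoszM lez_nat.
apply: leq_trans; rewrite leq_exp2r // /a /coordA.
apply: leq_trans (leq_addl _ _); apply: leq_trans (_ : M * (K * N) <= _)%N.
  by rewrite mulnA leq_pmull // muln_gt0 M_gt0.
by rewrite leq_mul2l leq_addr orbT.
Qed.

(** A prime whose square divides a quartic value is therefore below 2^(ga + 2 J), where the second
    sieving range ends. *)
Lemma form_value_lt h x : is_h h -> (`|form_value h x| < (2 ^ (ga + 2 * J)) ^ 2)%N.
Proof.
move=> hh; rewrite -ltz_nat abszE.
have la : `|(a x.1)%:Z| <= 2 ^+ (al + J) :> int.
  by rewrite -[2]/(2%:Z) -rmorphXn /= lez_nat ltnW ?coordA_lt.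
have lb : `|(b x.2)%:Z| <= 2 ^+ (al + J) :> int.
  by rewrite -[2]/(2%:Z) -rmorphXn /= lez_nat ltnW ?coordB_lt.
have hs : (size h <= 5)%N by rewrite (size_h hh).
apply: le_lt_trans (homog_le hs la lb) _.
rewrite -exprM mulnDl exprD [(al * 4)%N]mulnC mulrA.
have -> : ((2 ^ (ga + 2 * J)) ^ 2)%N%:Z = 2 ^+ (2 * ga) * 2 ^+ (J * 4).
  rewrite -expnM mulnC mulnDr mulnA [(2 * 2 * J)%N]mulnC -exprD.
  by rewrite -[2 in RHS]/(2%:Z) -rmorphXn.
by rewrite ltr_pM2r ?hga // exprn_gt0.
Qed.

Lemma form_value_neq0 h x : is_h h -> form_value h x != 0.
Proof.
move=> hh; rewrite -absz_gt0.
have : (0 < N ^ 4)%N by rewrite expn_gt0 N_gt0.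
by move/leq_trans/(_ (form_value_ge x hh)); rewrite muln_gt0.
Qed.

Lemma value_neq0 x : value x != 0.
Proof.
have := form_value_neq0 x is1; have := form_value_neq0 x is2; have := form_value_neq0 x is3.
have [-> _] := form_partP x is1; have [-> _] := form_partP x is2; have [-> _] := form_partP x is3.
by rewrite /value !mulf_eq0 !negb_or => /andP[_ ->] /andP[_ ->] /andP[_ ->].
Qed.

(** This provides each factor with a prime for the descent. The constant [f h] is at most N / 4 in
    absolute value and cannot account for a value of size N^4 / 2. *)
Lemma form_part_gt1 h x : is_h h -> (1 < `|form_part h x|)%N.
Proof.
move=> hh; have := form_value_ge x hh.
have [-> _] := form_partP x hh; rewrite abszM => le.
have f0 : (0 < `|f h|)%N by rewrite absz_gt0 f_neq0.
have [||||le1 le2 le3] := leq_factor _ _ _ hJ; rewrite ?absz_gt0 ?expn_gt0 //.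
by apply: cofactor_gt1 f0 _ le; case: (hh) => ->.
Qed.

(** Modulo a prime outside B the three forms have no common root, so p^2 divides a single quartic
    value; this puts p in one of the two sieved ranges. *)
Lemma good_sqfree x p : good_pair x -> prime p -> ~~ ((p ^ 2)%N %| value x)%Z.
Proof.
move=> /and4P[cx /hasPn n1 /hasPn n2 _] pp; apply/negP => p2m.
have pm : (p %| value x)%Z by apply: dvdz_trans p2m; rewrite dvdzE /= dvdn_exp.
have pB := prime_value_bad pp pm.
have p2F : ((p ^ 2)%N %| F x)%Z by rewrite value_mul dvdz_mull.
have pF : (p %| F x)%Z by rewrite value_mul dvdz_mull.
have pb := cop_dvd pp pB cx pF.
have [_ _ pc _] := good_prime pp pB.
have copb : coprime (b x.2) p by rewrite coprime_sym prime_coprime.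
have rE h : is_h h -> (p %| form_value h x)%Z = (p %| h.[(ratio_mod p (a x.1) (b x.2))%:Z])%Z.
  by move=> hh; rewrite -(homog_ratio_mod (d := 4)) // (size_h hh).
have disj g1 g2 g3 : is_h g1 -> is_h g2 -> g1 * g2 * g3 = g ->
    (p %| form_value g1 x)%Z -> ~~ (p %| form_value g2 x)%Z.
  move=> i1 i2 E; rewrite !rE // => d1; apply/negP => d2.
  by apply: (@disjoint_roots_mod u v g1 g2 g3 c p) d1 d2 => //; rewrite E.
have E12 : h1 * h2 * h3 = g by rewrite gE.
have E13 : h1 * h3 * h2 = g by rewrite gE; ring.
have E23 : h2 * h3 * h1 = g by rewrite gE; ring.
have E21 : h2 * h1 * h3 = g by rewrite gE; ring.
have E31 : h3 * h1 * h2 = g by rewrite gE; ring.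
have E32 : h3 * h2 * h1 = g by rewrite gE; ring.
have copp w : ~~ (p %| w)%Z -> coprimez (p ^ 2)%N w.
  by move=> pw; rewrite coprimezE /= coprimeXl // prime_coprime.
have [h hh h2F] : exists2 h, is_h h & ((p ^ 2)%N %| form_value h x)%Z.
  move: pF p2F; rewrite form_valueM dvdzE !abszM /= !Euclid_dvdM //.
  have toZ w : (p %| `|w|)%N -> (p %| w)%Z by [].
  move=> /orP[/orP[]|] /toZ d.
  - rewrite Gauss_dvdzl ?copp ?(disj _ _ _ is1 is3 E13 d) //.
    by rewrite Gauss_dvdzl ?copp ?(disj _ _ _ is1 is2 E12 d) // => h; exists h1.
  - rewrite Gauss_dvdzl ?copp ?(disj _ _ _ is2 is3 E23 d) //.
    by rewrite Gauss_dvdzr ?copp ?(disj _ _ _ is2 is1 E21 d) // => h; exists h2.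
  rewrite -mulrA Gauss_dvdzr ?copp ?(disj _ _ _ is3 is1 E31 d) //.
  by rewrite Gauss_dvdzr ?copp ?(disj _ _ _ is3 is2 E32 d) // => h; exists h3.
have pn : (p < 2 ^ (ga + 2 * J))%N.
  rewrite -ltn_sqr; apply: leq_ltn_trans (form_value_lt x hh).
  by apply: dvdn_leq; rewrite ?absz_gt0 ?form_value_neq0.
have sq : sqf p x by apply/and3P.
case: (ltnP p (2 ^ (al + J))) => hp.
  by move: (n1 p); rewrite mem_filter mem_index_iota /admissible pp pB hp => /(_ isT) /negP; apply.
by move: (n2 p); rewrite mem_filter mem_index_iota /admissible pp pB hp pn => /(_ isT) /negP; apply.
Qed.

Lemma value_ge x : (N ^ 12 <= 8 * (`|ff| * `|value x|))%N.
Proof.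
have := form_value_ge x is1; have := form_value_ge x is2; have := form_value_ge x is3.
rewrite -abszM -value_mul form_valueM !abszM => l3 l2 l1.
have := leq_mul (leq_mul l1 l2) l3; rewrite -!expnD => le.
by apply: leq_trans le _; apply: eq_leq; ring.
Qed.

Lemma value_lt x : (`|value x| < 2 ^ (6 * ga + 12 * J))%N.
Proof.
have := form_value_lt x is1; have := form_value_lt x is2; have := form_value_lt x is3 => l3 l2 l1.
have := ltn_mul (ltn_mul l1 l2) l3.
rewrite -!abszM -form_valueM value_mul abszM -!expnM -!expnD => le.
have -> : (6 * ga + 12 * J = (ga + 2 * J) * 2 + (ga + 2 * J) * 2 + (ga + 2 * J) * 2)%N by ring.
apply: leq_ltn_trans le; rewrite leq_pmull // absz_gt0 /ff !mulf_eq0 !negb_or.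
by rewrite f1_neq0 f2_neq0 f3_neq0.
Qed.

Lemma prod_small_le x :
  (\prod_(p <- primes `|value x| | (p < 2 ^ y)%N) p <= 2 ^ small_weight x)%N.
Proof.
apply: leq_trans (_ : 2 ^ (\sum_(p <- primes `|value x| | p < 2 ^ y) (trunc_log 2 p).+1) <= _)%N.
  elim: (primes _) => [|p s IH]; first by rewrite !big_nil.
  rewrite !big_cons; case: ifP => // _; rewrite expnD leq_mul //.
  by rewrite ltnW // trunc_log_ltn.
rewrite leq_exp2l // /small_weight.
apply: (@uniq_sub_le_big_cond nat addn leq leqnn (fun m n => leq_addr n m)).
- exact: filter_uniq (primes_uniq _).
- exact: filter_uniq (iota_uniq _ _).
move=> p; rewrite !mem_filter mem_primes => /and3P[py pp /andP[_ pv]].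
rewrite mem_index_iota py /admissible pp andbT /=.
by rewrite (prime_value_bad pp pv) value_mul dvdz_mull.
Qed.

(* The product of the primes p >= 2^y dividing the value divides a b' - a' b, which is
   smaller in absolute value. *)
Lemma fibre_inj (x x' : T) : good_pair x -> good_pair x' -> value x = value x' ->
  (forall p, p \in primes `|value x| -> (2 ^ y <= p)%N ->
     ratio_mod p (a x.1) (b x.2) = ratio_mod p (a x'.1) (b x'.2)) -> x = x'.
Proof.
move=> gx gx' vv rr; have [cx _ _ wx] := and4P gx; have [cx' _ _ _] := and4P gx'.
set m := `|value x|%N in rr.
have m0 : (0 < m)%N by rewrite absz_gt0 value_neq0.
have mE : m = (\prod_(p <- primes m) p)%N.
  by apply: squarefree_prod_primes => // p pp; apply: good_sqfree gx pp.
pose L := (\prod_(p <- primes m | ~~ (p < 2 ^ y)) p)%N.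
pose S := (\prod_(p <- primes m | p < 2 ^ y) p)%N.
have mLS : m = (L * S)%N by rewrite {1}mE (bigID (fun p => p < 2 ^ y)%N) mulnC.
have Sw : (S <= 2 ^ (9 * J))%N.
  by apply: leq_trans (prod_small_le x) _; rewrite leq_exp2l.
have Lbig : (2 ^ (2 * (al + J)) <= L)%N.
  have -> : (2 ^ (2 * (al + J)) = 2 ^ (2 * al) * N ^ 2)%N.
    by rewrite mulnDr expnD [(2 * J)%N]mulnC (expnM 2 J).
  have w9 : (2 ^ (9 * J) = N ^ 9)%N by rewrite [(9 * J)%N]mulnC expnM.
  have fJ : (8 * `|ff| * 2 ^ (2 * al) <= N)%N by rewrite /ff !abszM.
  have ff0 : (0 < `|ff|)%N.
    by rewrite absz_gt0 /ff !mulf_eq0 !negb_or f1_neq0 f2_neq0 f3_neq0.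
  exact: leq_cancel_large (value_ge x) mLS Sw w9 N_gt0 fJ ff0.
apply: (cross_eq0 cx cx' Lbig).
rewrite dvdzE /= /L -big_filter; apply: prod_primes_dvd => [|p].
  exact: filter_uniq (primes_uniq _).
rewrite mem_filter -leqNgt => /andP[yp pm].
move: (pm); rewrite mem_primes => /and3P[pp _ pv]; rewrite pp /=.
have pB := prime_value_bad pp pv.
have pF : (p %| F x)%Z by rewrite value_mul dvdz_mull.
have pF' : (p %| F x')%Z by rewrite value_mul -vv dvdz_mull.
have pb := cop_dvd pp pB cx pF; have pb' := cop_dvd pp pB cx' pF'.
apply: (ratio_mod_cross (q := p)); rewrite // ?(coprime_sym _ p) ?prime_coprime //.
by rewrite rr // subrr dvdz0.
Qed.

Variable t : nat.
Hypothesis (y_gt0 : (0 < y)%N) (tP : (6 * ga + 12 * J <= t * y)%N).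

(** For each of the at most t primes p >= 2^y dividing m, record which of the at most 12 roots of g
    modulo p is the class of a/b. By [fibre_inj] the record determines the pair. *)
Lemma card_fibre (m : int) : (#|[pred x | good_pair x & value x == m]| <= 12 ^ t)%N.
Proof.
pose L := [seq p <- primes `|m| | (2 ^ y <= p)%N].
(* [nth] pads L with 0 up to length t; only the genuine entries are read back. *)
pose code (x : T) : {ffun 'I_t -> 'I_12} := [ffun i : 'I_t =>
  inord (index (ratio_mod (nth 0%N L i) (a x.1) (b x.2)) (roots_mod (nth 0%N L i) g))].
have -> : (12 ^ t)%N = #|{ffun 'I_t -> 'I_12}| by rewrite card_ffun !card_ord.
rewrite -(card_in_image (f := code)) ?max_card // => x x'.
rewrite !inE => /andP[gx /eqP vx] /andP[gx' /eqP vx'] cc.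
have [cx _ _ _] := and4P gx; have [cx' _ _ _] := and4P gx'.
have sL : (size L <= t)%N.
  rewrite -(leq_pmul2r y_gt0); apply: leq_trans tP.
  rewrite -(leq_exp2l _ _ (isT : 1 < 2)%N) mulnC expnM.
  apply: leq_trans (_ : `|m| <= _)%N; last by rewrite -vx ltnW // value_lt.
  have m0 : (0 < `|m|)%N by rewrite -vx absz_gt0 value_neq0.
  have dv : (\prod_(p <- L) p %| `|m|)%N.
    apply: prod_primes_dvd => [|p]; first exact: filter_uniq (primes_uniq _).
    by rewrite mem_filter mem_primes => /and3P[_ -> /andP[_ ->]].
  apply: leq_trans (dvdn_leq m0 dv).
  rewrite /L; elim: (primes _) => [|p s IH] /=; first by rewrite big_nil.
  case: ifP => // py.
  by rewrite /= expnS big_cons leq_mul.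
apply: fibre_inj => //; first by rewrite vx'.
move=> p; rewrite vx => pm py.
have pL : p \in L by rewrite mem_filter py.
have it : (index p L < t)%N by apply: leq_trans sL; rewrite index_mem.
move: (pm); rewrite mem_primes => /and3P[pp _ pv].
have pvx : (p %| value x)%Z by rewrite dvdzE vx.
have pB := prime_value_bad pp pvx; have [_ _ _ pl] := good_prime pp pB.
have root_in x1 : good_pair x1 -> value x1 = m -> ratio_mod p (a x1.1) (b x1.2) \in roots_mod p g.
  move=> gx1 vx1; have [cx1 _ _ _] := and4P gx1.
  have pF : (p %| F x1)%Z by rewrite value_mul vx1 -vx dvdz_mull.
  have pb := cop_dvd pp pB cx1 pF.
  rewrite mem_filter mem_iota /= ltn_pmod ?prime_gt0 // andbT.
  by rewrite -(homog_ratio_mod (d := 12)) // coprime_sym prime_coprime.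
have sR : (size (roots_mod p g) <= 12)%N by apply: leq_trans (size_roots_mod pp pl) _; rewrite gs.
have r1 := root_in x gx vx; have r2 := root_in x' gx' vx'.
have := congr1 (fun h : {ffun 'I_t -> 'I_12} => h (Ordinal it)) cc.
rewrite !ffunE /= nth_index // => /(congr1 val); rewrite /= !inordK; last first.
- by apply: leq_trans sR; rewrite index_mem.
- by apply: leq_trans sR; rewrite index_mem.
move=> ii; by rewrite -(nth_index 0%N r1) ii nth_index.
Qed.

Lemma many_values : exists s : seq int, [/\ uniq s, (N ^ 2 <= 2 * 12 ^ t * size s)%N &
  forall m, m \in s ->
    [/\ (`|m| < 2 ^ (6 * ga + 12 * J))%N, coprime `|m| B,
      forall p, prime p -> ~~ (p ^ 2 %| `|m|)%N &
      exists a b m1 m2 m3 : int, [/\ b != 0, m = m1 * m2 * m3,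
        [/\ (1 < `|m1|)%N, (1 < `|m2|)%N & (1 < `|m3|)%N] &
        [/\ homog 4 h1 a b = h1.[a0%:Z] * m1, homog 4 h2 a b = h2.[a0%:Z] * m2 &
            homog 4 h3 a b = h3.[a0%:Z] * m3]]]].
Proof.
exists (undup [seq value x | x <- enum good_pair]); split; first exact: undup_uniq.
  apply: leq_trans card_good_pair _; rewrite -mulnA leq_mul2l /= mulnC.
  apply: (card_classes (cls := value) (leqnn _)) => [x gx|m _]; last exact: card_fibre.
  by rewrite mem_undup map_f // mem_enum.
move=> m; rewrite mem_undup => /mapP[x]; rewrite mem_enum => gx ->; split.
- exact: value_lt.
- rewrite coprime_sym.
  have v0 : (0 < `|value x|)%N by rewrite absz_gt0 value_neq0.
  apply: contraT; rewrite /coprime => h; pose p := pdiv (gcdn B `|value x|).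
  have g1 : (1 < gcdn B `|value x|)%N by rewrite ltn_neqAle eq_sym h gcdn_gt0 v0 orbT.
  have pp := pdiv_prime g1; have := pdiv_dvd (gcdn B `|value x|).
  rewrite -/p dvdn_gcd => /andP[pB pv].
  by have := prime_value_bad pp (pv : p %| value x)%Z; rewrite pB.
- by move=> p pp; apply: good_sqfree gx pp.
exists (a x.1)%:Z, (b x.2)%:Z, (form_part h1 x), (form_part h2 x), (form_part h3 x).
have [e1 _] := form_partP x is1; have [e2 _] := form_partP x is2; have [e3 _] := form_partP x is3.
by split=> //; split; rewrite ?form_part_gt1.
Qed.

End Counting.

(** * Choosing the constants of the sieve *)

Lemma separable_int_bezout (g : {poly int}) : separable_poly (map_poly intr g : {poly rat}) ->
  exists u v : {poly int}, exists2 c : int, c != 0 & u * g + v * g^`() = c%:P.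
Proof.
rewrite unlock => /Bezout_eq1_coprimepP[[u v] /= uv].
have [u0 [du du0 uE]] := rat_poly_scale u; have [v0 [dv dv0 vE]] := rat_poly_scale v.
exists (dv *: u0), (du *: v0); exists (du * dv); first by rewrite mulf_neq0.
apply: (@map_inj_poly _ rat intr intr_inj (rmorph0 _)).
have fM (p q : {poly int}) : map_poly intr (p * q) =
     map_poly intr p * map_poly intr q :> {poly rat}.
  by rewrite rmorphM.
have fZ k (p : {poly int}) : map_poly intr (k *: p) = k%:~R *: map_poly intr p :> {poly rat}.
  by rewrite map_polyZ.
rewrite rmorphD /= (fM (_ *: _)) (fM (_ *: _)) !fZ map_polyC /= -deriv_map rmorphM /=.
have du0' : du%:~R != 0 :> rat by rewrite intr_eq0.
have dv0' : dv%:~R != 0 :> rat by rewrite intr_eq0.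
have -> : map_poly intr u0 = du%:~R *: u by rewrite uE scalerA mulfV // scale1r.
have -> : map_poly intr v0 = dv%:~R *: v by rewrite vE scalerA mulfV // scale1r.
rewrite !scalerA [dv%:~R * _]mulrC -!scalerAl -scalerDr uv.
by rewrite alg_polyC.
Qed.

Lemma leq_summands n1 n2 n3 n4 n5 J : (n1 + n2 + n3 + n4 + n5 <= J)%N ->
  [/\ n1 <= J, n2 <= J, n3 <= J, n4 <= J & n5 <= J]%N.
Proof. by move=> h; split; lia. Qed.

Lemma ler_abs_sum (x1 x2 x3 x : int) : [\/ x = x1, x = x2 | x = x3] ->
  x <= (`|x1| + `|x2| + `|x3|)%N%:Z.
Proof. by case=> ->; lia. Qed.

Lemma leq_quotient J y : (J < y.+1 * 96)%N -> (0 < y)%N -> (J <= 191 * y)%N.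
Proof. by lia. Qed.

Theorem sieve_binary_quartics (h1 h2 h3 : {poly int}) (B0 : nat) :
  size h1 = 5%N -> size h2 = 5%N -> size h3 = 5%N ->
  separable_poly (map_poly intr (h1 * h2 * h3) : {poly rat}) -> (0 < B0)%N ->
  exists (B : nat) (f1 f2 f3 : int) (C J0 : nat),
    [/\ (0 < B)%N, (B0 %| B)%N, (0 < C)%N,
      [/\ f1 != 0, f2 != 0, f3 != 0 & (f1 * f2 * f3 %| B%:Z)%Z] &
    forall J, (J0 <= J)%N -> exists s : seq int,
      [/\ uniq s, (4 ^ J <= C * size s)%N & forall m, m \in s ->
       [/\ (`|m| <= C * 2 ^ (12 * J))%N, coprime `|m| B,
          forall p, prime p -> ~~ (p ^ 2 %| `|m|)%N &
          exists a b m1 m2 m3 : int, [/\ b != 0, m = m1 * m2 * m3,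
            [/\ (1 < `|m1|)%N, (1 < `|m2|)%N & (1 < `|m3|)%N] &
            [/\ homog 4 h1 a b = f1 * m1, homog 4 h2 a b = f2 * m2 & homog 4 h3 a b = f3 * m3]]]]].
Proof.
move=> hs1 hs2 hs3 sep B0_gt0; set g := h1 * h2 * h3 in sep.
have [u [v [c c0 uvg]]] := separable_int_bezout sep.
have h1n0 : h1 != 0 by rewrite -size_poly_eq0 hs1.
have h2n0 : h2 != 0 by rewrite -size_poly_eq0 hs2.
have h3n0 : h3 != 0 by rewrite -size_poly_eq0 hs3.
have gn0 : g != 0 by rewrite !mulf_neq0.
have gs : size g = 13%N by rewrite /g !size_mul ?mulf_neq0 // hs1 hs2 hs3.
(* Thirteen candidates suffice for a polynomial of degree 12. *)
have [a0 ga0] : exists a0 : nat, g.[a0%:Z] != 0.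
  pose r := [seq i%:Z | i <- iota 0 13].
  have : ~~ all (root g) r.
    apply/negP => /(max_poly_roots gn0); rewrite gs size_map size_iota ltnn.
    by rewrite map_inj_uniq ?iota_uniq //; [move/(_ isT) | move=> i j []].
  by case/allPn => _ /mapP[i _ ->] ri; exists i.
move: (ga0); rewrite /g !hornerM !mulf_eq0 !negb_or => /andP[/andP[f10 f20] f30].
set f1 := h1.[a0%:Z] in f10; set f2 := h2.[a0%:Z] in f20; set f3 := h3.[a0%:Z] in f30.
(* Behind the existential z stays a variable, and its factorial is never evaluated. *)
have [z z140] : exists z, (140 <= z)%N by exists 140%N.
pose fn := (`|f1| * `|f2| * `|f3|)%N.
have fn0 : (0 < fn)%N by rewrite !muln_gt0 !absz_gt0 f10 f20 f30.
(* [B0] comes from the caller, z! removes the primes up to z, [fn] the fixed parts of the values, c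
   the primes with multiple roots, and the leading coefficient those where the degree drops. *)
pose B := (B0 * z`! * fn * `|c| * `|lead_coef g|)%N.
have B_gt0 : (0 < B)%N.
  rewrite /B !(muln_gt0 _ `|_|) !absz_gt0 c0 lead_coef_eq0 gn0.
  by rewrite muln_gt0 muln_gt0 B0_gt0 fact_gt0 fn0.
(* The extra factor [fn] keeps the cofactors congruent to 1 modulo B after division by [f1], [f2],
   [f3]. *)
pose M := (fn * B)%N.
have M_gt0 : (0 < M)%N by rewrite muln_gt0 fn0.
have fnB : (fn %| B)%N by do 2!apply: dvdn_mulr; apply: dvdn_mull.
have good_prime p : prime p -> ~~ (p %| B)%N ->
    [/\ (z < p)%N, ~~ (p %| M)%N, ~~ (p %| c)%Z & ~~ (p %| lead_coef g)%Z].
  move=> pp pB; split.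
  - rewrite ltnNge; apply: contra pB => pz.
    by do 3!apply: dvdn_mulr; apply: dvdn_mull; rewrite dvdn_fact // prime_gt0.
  - by rewrite Euclid_dvdM // negb_or pB andbT; apply: contra pB => /dvdn_trans; apply.
  - by apply: contra pB => pc; rewrite /B dvdn_mulr // dvdn_mull.
  by apply: contra pB => pl; rewrite /B dvdn_mull.
have bad_prime p : prime p -> (p %| B)%N -> (p %| M)%N by move=> _ pB; rewrite dvdn_mull.
pose H := (`|height h1| + `|height h2| + `|height h3|)%N.
have hH h : [\/ h = h1, h = h2 | h = h3] -> height h <= H%:Z.
  by move=> hh; apply: ler_abs_sum; case: hh => ->; [constructor 1 | constructor 2 | constructor 3].
pose K := (2 * H).+1.
have hK h : [\/ h = h1, h = h2 | h = h3] -> 2 * height h <= K%:Z.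
  move=> /hH hle; apply: le_trans (_ : (2 * H)%N%:Z <= _); last by rewrite lez_nat.
  by rewrite PoszM; apply: ler_wpM2l.
pose al := (a0 + M * K.+1)%N.
have hal : (a0 + M * K.+1 <= 2 ^ al)%N by rewrite ltnW // ltn_expl.
pose ga := (H * 2 ^ (4 * al))%N.
have hga h : [\/ h = h1, h = h2 | h = h3] -> height h * 2 ^+ (4 * al) < 2 ^+ (2 * ga).
  move/hH => hle.
  apply: le_lt_trans (_ : ga%:Z < _).
    by rewrite /ga PoszM -[2 in X in X <= _]/(2%:Z) -[X in _ * X <= _]rmorphXn ler_wpM2r.
  rewrite -[2 in X in _ < X]/(2%:Z) -[X in _ < X]rmorphXn ltz_nat.
  by apply: leq_trans (ltn_expl ga (isT : 1 < 2)%N) _; rewrite leq_exp2l // leq_pmull.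
have [J1 J1P] := prime_count_small (240 * 2 ^ al).
have [J2 J2P] := prime_count_small (240 * 2 ^ ga).
(* With y the quotient of J by 96 and y >= 1, J <= 96 y + 95 <= 191 y; hence t y bounds the
   logarithm 6 ga + 12 J of every value. *)
pose t := (6 * ga + 12 * 191)%N.
pose J3 := (40 * 2 ^ al)%N; pose J4 := (8 * fn * 2 ^ (2 * al))%N.
exists B, f1, f2, f3, (2 * 12 ^ t + 2 ^ (6 * ga))%N, (96 + J1 + J2 + J3 + J4)%N.
split=> //; first by do 4!apply: dvdn_mulr.
- by rewrite addn_gt0 orbC expn_gt0.
- by split=> //; rewrite dvdzE !abszM.
move=> J hJ.
have [J96 J1J J2J J3J J4J] := leq_summands hJ.
have hJ1 : (J1 <= al + J)%N by apply: leq_trans J1J (leq_addl _ _).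
have hJ2 : (J2 <= ga + 2 * J)%N.
  by apply: leq_trans J2J (leq_trans _ (leq_addl _ _)); rewrite leq_pmull.
have JJ : (J <= 2 ^ J)%N by rewrite ltnW // ltn_expl.
have hJ3 : (J3 <= 2 ^ J)%N := leq_trans J3J JJ.
have hJ4 : (J4 <= 2 ^ J)%N := leq_trans J4J JJ.
pose y := (J %/ 96)%N.
have yJ : (96 * y <= J)%N by rewrite mulnC leq_trunc_div.
have y0 : (0 < y)%N by rewrite divn_gt0.
have tP : (6 * ga + 12 * J <= t * y)%N.
  rewrite mulnDl leq_add //; first by rewrite leq_pmulr.
  rewrite -mulnA leq_mul2l; apply/orP; right.
  by apply: leq_quotient => //; apply: ltn_ceil.
have [s [us ss sP]] := many_values gs uvg good_prime bad_prime M_gt0 (isT : 0 < K)%N hal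
  (leq_trans (isT : 0 < 140)%N z140) yJ (leq_trans (isT : 0 < 96)%N J96) z140 hJ3
  (J1P _ hJ1) (J2P _ hJ2) (erefl g) hs1 hs2 hs3 f10 f20 f30 (dvdnn _) hK hga hJ4 y0 tP.
exists s; split=> //.
  rewrite (_ : 4 = 2 ^ 2)%N // -expnM mulnC expnM.
  by apply: leq_trans ss _; rewrite leq_mul2r leq_addr orbT.
move=> m /sP[lt cop sqf ex]; split=> //.
by apply: leq_trans (ltnW lt) _; rewrite expnD leq_mul2r leq_addl orbT.
Qed.

(** * Parity of valuations *)

(** The parity of the l-adic valuation: a homomorphism from nonzero rationals modulo squares to Z/2,
    used as the character in the descent. *)
Definition vparity (l : nat) (x : rat) : bool :=
  odd (logn l `|numq x|) (+) odd (logn l `|denq x|).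

Lemma vparity_frac l (n d : int) : n != 0 -> d != 0 ->
  vparity l (n%:~R / d%:~R) = odd (logn l `|n|) (+) odd (logn l `|d|).
Proof.
move=> n0 d0; set x := _ / _.
have d0' : d%:~R != 0 :> rat by rewrite intr_eq0.
have x0 : x != 0 by rewrite mulf_neq0 ?invr_neq0 ?intr_eq0.
have e : n * denq x = numq x * d.
  apply: (@intr_inj rat); rewrite !rmorphM /= numqE.
  by rewrite /x; field.
have := congr1 (fun m => odd (logn l `|m|)) e.
rewrite /= !abszM !lognM ?absz_gt0 ?numq_eq0 ?denq_neq0 // !oddD /vparity.
by do 4!case: (odd _).
Qed.

Lemma vparity_int l (n : int) : n != 0 -> vparity l n%:~R = odd (logn l `|n|).
Proof.
by move=> n0; rewrite -[_%:~R]divr1 (vparity_frac l n0 (oner_neq0 _)) logn1 addbF.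
Qed.

Lemma vparityM l x y : x != 0 -> y != 0 -> vparity l (x * y) = vparity l x (+) vparity l y.
Proof.
move=> x0 y0; have [nx ny] : numq x != 0 /\ numq y != 0 by rewrite !numq_eq0.
have {1}-> : x * y = (numq x * numq y)%:~R / (denq x * denq y)%:~R.
  rewrite -{1}[x]divq_num_den -{1}[y]divq_num_den !rmorphM /=.
  by field; rewrite !intr_eq0 !denq_neq0.
rewrite vparity_frac ?mulf_neq0 ?denq_neq0 // !abszM !lognM ?absz_gt0 ?denq_neq0 // !oddD /vparity.
by do 4!case: (odd _).
Qed.

Lemma vparityV l x : vparity l x^-1 = vparity l x.
Proof.
case: (eqVneq x 0) => [->|x0]; first by rewrite invr0.
have := vparityM l x0 (invr_neq0 x0); rewrite mulfV // (vparity_int l (oner_neq0 _)) logn1.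
by case: (vparity l x); case: (vparity l x^-1).
Qed.

Lemma vparity_sq l x : x != 0 -> vparity l (x ^+ 2) = false.
Proof. by move=> x0; rewrite expr2 vparityM // addbb. Qed.

Lemma vparityN1 l : vparity l (- 1) = false.
Proof. by rewrite -[-1]/((-1)%:~R) vparity_int // logn1. Qed.

Lemma vparity_coprime l (x : rat) : ~~ (l %| `|(numq x * denq x)%R|)%N -> vparity l x = false.
Proof.
rewrite /vparity abszM => h.
have h1 : ~~ (l %| `|numq x|)%N by apply: contra h; apply: dvdn_mulr.
have h2 : ~~ (l %| `|denq x|)%N by apply: contra h; apply: dvdn_mull.
have log0 n : ~~ (l %| n)%N -> logn l n = 0%N.
  by move=> ln; apply/eqP; rewrite -leqn0 leqNgt logn_gt0 mem_primes; apply: contra ln => /and3P[].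
by rewrite !log0.
Qed.

Lemma sqrt_prime_irrational (l : nat) (x : rat) : prime l -> x ^+ 2 != l%:R.
Proof.
move=> pl; apply/eqP => h.
have l0 : (l%:Z != 0) by rewrite -absz_gt0 prime_gt0.
have x0 : x != 0.
  apply: contraTneq (prime_gt0 pl) => x0; move/eqP: h.
  by rewrite x0 expr0n eq_sym pnatr_eq0 => /eqP ->.
have := vparity_sq l x0; rewrite h -[l%:R]/(l%:Z%:~R) vparity_int //=.
by rewrite -{2}(expn1 l) pfactorK.
Qed.

(** * The conic *)

Section ConicPoint.
Variables (K : fieldType) (p q s0 r0 x : K).
Let k := p - q.
Let a1 := p * (p - 2 * q).
Let a2 := q * (q - 2 * p).
Let n := p ^+ 2 - p * q + q ^+ 2.
Hypothesis conic0 : a1 * s0 ^+ 2 + a2 * r0 ^+ 2 = n.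
Hypotheses (two0 : 2 != 0 :> K) (p0 : p != 0) (q0 : q != 0) (k0 : k != 0) (n0 : n != 0).
Hypotheses (pq0 : 2 * p - q != 0) (qp0 : 2 * q - p != 0).

(* (conic_s : conic_r : conic_z) is the second intersection point of the conic
   a1 s^2 + a2 r^2 = n z^2 with the line through (s0 : r0 : 1) and (x : 1 : 0). *)
Definition conic_s := - a1 * s0 * x ^+ 2 - 2 * a2 * r0 * x + a2 * s0.
Definition conic_r := a1 * r0 * x ^+ 2 - 2 * a1 * s0 * x - a2 * r0.
Definition conic_z := a1 * x ^+ 2 + a2.
Let s := conic_s.
Let r := conic_r.
Let z := conic_z.
Let s' := - 2 * a1 * s0 * x - 2 * a2 * r0.
Let r' := 2 * a1 * r0 * x - 2 * a1 * s0.
Let z' := 2 * a1 * x.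

Lemma conic_point : a1 * s ^+ 2 + a2 * r ^+ 2 = n * z ^+ 2.
Proof. by rewrite -conic0 /s /r /z /conic_s /conic_r /conic_z; ring. Qed.

Let a10 : a1 != 0.
Proof. by rewrite mulf_neq0 // -oppr_eq0 opprB. Qed.
Let a20 : a2 != 0.
Proof. by rewrite mulf_neq0 // -oppr_eq0 opprB. Qed.

(* The 2 x 2 minors of a parametrization of a conic and of its derivative are
   proportional to the gradient of the conic. *)
Let wr : z * s' - s * z' = 2 * a2 * r.
Proof. by rewrite /s /r /z /conic_s /conic_r /conic_z /s' /z'; ring. Qed.
Let ws : z * r' - r * z' = - 2 * a1 * s.
Proof. by rewrite /s /r /z /conic_s /conic_r /conic_z /r' /z'; ring. Qed.

(** The parametrization has no base point: the displayed combination of s, r and z equals 2 a2 n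
    identically in x. *)
Lemma conic_nontrivial : s = 0 -> r = 0 -> z = 0 -> False.
Proof.
move=> es er ez; have /eqP := mulf_neq0 (mulf_neq0 two0 a20) n0; apply.
transitivity (a1 * s0 * (s + s0 * z) - a2 * r0 * (r - r0 * z)).
  by rewrite -conic0 /s /r /z /conic_s /conic_r /conic_z; ring.
by rewrite es er ez; ring.
Qed.

Let z_eq0 : z = 0 -> s = 0 \/ r = 0 -> False.
Proof.
move=> ez h; have := conic_point; rewrite ez expr0n mulr0.
case: h => e; rewrite e expr0n mulr0 ?add0r ?addr0 => /eqP; rewrite mulf_eq0 sqrf_eq0.
  by rewrite (negbTE a20) /= => /eqP er; apply: conic_nontrivial.
by rewrite (negbTE a10) /= => /eqP es; apply: conic_nontrivial.
Qed.

(** A double root of u s^2 + v z^2 would, after elimination by the minor [wr], give s r = z r = 0.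
    The relation between r^2 and z^2 excludes r = 0, and s = z = 0 is impossible on the conic. *)
Let simple_sz u v c d : u != 0 -> v != 0 -> d != 0 -> c != 0 ->
  u * s ^+ 2 + v * z ^+ 2 = 0 -> d * r ^+ 2 = c * z ^+ 2 -> u * (s * s') + v * (z * z') != 0.
Proof.
move=> u0 v0 d0 c0 h1 hr; apply/negP => /eqP h2.
have sr : s * r = 0.
  apply: (mulfI (mulf_neq0 (mulf_neq0 two0 a20) u0)); rewrite mulr0.
  transitivity (z * (u * (s * s') + v * (z * z')) - z' * (u * s ^+ 2 + v * z ^+ 2)).
    transitivity (u * s * (2 * a2 * r)); first by ring.
    by rewrite -wr; ring.
  by rewrite h1 h2 !mulr0 subrr.
have zr : z * r = 0.
  apply: (mulfI (mulf_neq0 (mulf_neq0 two0 a20) v0)); rewrite mulr0.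
  transitivity (s' * (u * s ^+ 2 + v * z ^+ 2) - s * (u * (s * s') + v * (z * z'))).
    transitivity (v * z * (2 * a2 * r)); first by ring.
    by rewrite -wr; ring.
  by rewrite h1 h2 !mulr0 subrr.
case: (eqVneq r 0) => [er|r0'].
  move: hr; rewrite er expr0n mulr0 => /esym/eqP; rewrite mulf_eq0 (negbTE c0) sqrf_eq0 /=.
  by move/eqP => ez; apply: z_eq0 => //; right.
move/eqP: sr; move/eqP: zr; rewrite !mulf_eq0 (negbTE r0') !orbF => /eqP ez /eqP es.
by apply: z_eq0 => //; left.
Qed.

Let simple_rz u v c d : u != 0 -> v != 0 -> d != 0 -> c != 0 ->
  u * r ^+ 2 + v * z ^+ 2 = 0 -> d * s ^+ 2 = c * z ^+ 2 -> u * (r * r') + v * (z * z') != 0.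
Proof.
move=> u0 v0 d0 c0 h1 hr; apply/negP => /eqP h2.
have sr : r * s = 0.
  apply: (mulfI (mulf_neq0 (mulf_neq0 two0 a10) u0)); rewrite mulr0.
  transitivity (- (z * (u * (r * r') + v * (z * z')) - z' * (u * r ^+ 2 + v * z ^+ 2))).
    transitivity (- (u * r * (- 2 * a1 * s))); first by ring.
    by rewrite -ws; ring.
  by rewrite h1 h2 !mulr0 subrr oppr0.
have zr : z * s = 0.
  apply: (mulfI (mulf_neq0 (mulf_neq0 two0 a10) v0)); rewrite mulr0.
  transitivity (- (r' * (u * r ^+ 2 + v * z ^+ 2) - r * (u * (r * r') + v * (z * z')))).
    transitivity (- (v * z * (- 2 * a1 * s))); first by ring.
    by rewrite -ws; ring.
  by rewrite h1 h2 !mulr0 subrr oppr0.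
case: (eqVneq s 0) => [er|r0'].
  move: hr; rewrite er expr0n mulr0 => /esym/eqP; rewrite mulf_eq0 (negbTE c0) sqrf_eq0 /=.
  by move/eqP => ez; apply: z_eq0 => //; left.
move/eqP: sr; move/eqP: zr; rewrite !mulf_eq0 (negbTE r0') !orbF => /eqP ez /eqP es.
by apply: z_eq0 => //; right.
Qed.

(** Up to constants these are z^2 (t - e_i) for the parameter t of the conic point; primes denote
    derivatives in x. *)
Let g1 := s ^+ 2 + z ^+ 2.
Let g2 := r ^+ 2 + z ^+ 2.
Let g3 := p * z ^+ 2 - k * s ^+ 2.
Let g1' := 2 * (s * s' + z * z').
Let g2' := 2 * (r * r' + z * z').
Let g3' := 2 * (p * (z * z') - k * (s * s')).

Let zsq0 c : c != 0 -> c * z ^+ 2 = 0 -> z = 0.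
Proof. by move=> c0 /eqP; rewrite mulf_eq0 (negbTE c0) sqrf_eq0 => /eqP. Qed.

Let g12 : g1 = 0 -> g2 = 0 -> False.
Proof.
move=> e1 e2; have ez : z = 0.
  apply: (@zsq0 ((2 * p - q) * (2 * q - p))); first by rewrite mulf_neq0.
  transitivity (a1 * s ^+ 2 + a2 * r ^+ 2 - n * z ^+ 2 - a1 * g1 - a2 * g2); last first.
    by rewrite conic_point e1 e2; ring.
  by rewrite /g1 /g2 /a1 /a2 /n; ring.
apply: z_eq0 => //; left; move: e1; rewrite /g1 ez expr0n addr0 => /eqP.
by rewrite sqrf_eq0 => /eqP.
Qed.

Let g13 : g1 = 0 -> g3 = 0 -> False.
Proof.
move=> e1 e3; have ez : z = 0.
  apply: (@zsq0 (2 * p - q)) => //.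
  transitivity (k * g1 + g3); last by rewrite e1 e3; ring.
  by rewrite /g1 /g3 /k; ring.
apply: z_eq0 => //; left; move: e1; rewrite /g1 ez expr0n addr0 => /eqP.
by rewrite sqrf_eq0 => /eqP.
Qed.

Let g23 : g2 = 0 -> g3 = 0 -> False.
Proof.
move=> e2 e3; have ez : z = 0.
  apply: (@zsq0 (q * (2 * q - p) * (2 * p - q))); first by rewrite !mulf_neq0.
  transitivity (- k * (a1 * s ^+ 2 + a2 * r ^+ 2 - n * z ^+ 2) + k * a2 * g2 - a1 * g3); last first.
    by rewrite conic_point e2 e3; ring.
  by rewrite /g2 /g3 /k /a1 /a2 /n; ring.
apply: z_eq0 => //; right; move: e2; rewrite /g2 ez expr0n addr0 => /eqP.
by rewrite sqrf_eq0 => /eqP.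
Qed.

(** At a zero of the product only one factor vanishes, and its derivative does not. *)
Lemma conic_forms_simple : g1 * g2 * g3 = 0 ->
  (g1' * g2 + g1 * g2') * g3 + g1 * g2 * g3' != 0.
Proof.
have one0 : 1 != 0 :> K := oner_neq0 _.
have prod3 x1 x2 x3 : x1 != 0 -> x2 != 0 -> x3 != 0 -> x1 * x2 * x3 != 0 :> K.
  by move=> ? ? ?; rewrite !mulf_neq0.
move/eqP; rewrite !mulf_eq0 => /orP[/orP[]|] /eqP e.
- have n2 : g2 != 0 by apply/eqP => e2; apply: (g12 e e2).
  have n3 : g3 != 0 by apply/eqP => e3; apply: (g13 e e3).
  rewrite e !mul0r !addr0; apply: prod3 => //; rewrite mulf_neq0 //.
  rewrite -[s * s']mul1r -[z * z']mul1r.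
  apply: (@simple_sz 1 1 (k * (2 * p - q)) a2) => //; rewrite ?mulf_neq0 ?mul1r //.
  transitivity (n * z ^+ 2 - a1 * s ^+ 2); first by rewrite -conic_point; ring.
  have -> : s ^+ 2 = g1 - z ^+ 2 by rewrite /g1; ring.
  by rewrite e /n /a1 /k; ring.
- have n1 : g1 != 0 by apply/eqP => e1; apply: (g12 e1 e).
  have n3 : g3 != 0 by apply/eqP => e3; apply: (g23 e e3).
  rewrite e !mulr0 !add0r mul0r addr0; apply: prod3 => //; rewrite mulf_neq0 //.
  rewrite -[r * r']mul1r -[z * z']mul1r.
  (* Putting r^2 = - z^2 into the conic leaves a1 s^2 = (n + a2) z^2, and n + a2 = - k (2 q - p).
     The two other cases are similar. *)
  apply: (@simple_rz 1 1 (k * - (2 * q - p)) a1) => //; rewrite ?mulf_neq0 ?oppr_eq0 ?mul1r //.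
  transitivity (n * z ^+ 2 - a2 * r ^+ 2); first by rewrite -conic_point; ring.
  have -> : r ^+ 2 = g2 - z ^+ 2 by rewrite /g2; ring.
  by rewrite e /n /a2 /k; ring.
have n1 : g1 != 0 by apply/eqP => e1; apply: (g13 e1 e).
have n2 : g2 != 0 by apply/eqP => e2; apply: (g23 e2 e).
rewrite e mulr0 add0r; apply: prod3 => //; rewrite mulf_neq0 //.
rewrite [p * _ - _]addrC -mulNr.
have nk0 : - k != 0 by rewrite oppr_eq0.
apply: (@simple_sz (- k) p (q ^+ 2 * (2 * p - q)) (k * a2)) => //.
- by rewrite mulf_neq0.
- by rewrite mulf_neq0 // expf_neq0.
- by transitivity g3 => //; rewrite /g3; ring.
transitivity (k * (n * z ^+ 2) - a1 * (k * s ^+ 2)); first by rewrite -conic_point; ring.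
have -> : k * s ^+ 2 = p * z ^+ 2 - g3 by rewrite /g3; ring.
by rewrite e /n /a1 /k; ring.
Qed.

End ConicPoint.

(** * The three quartic forms over the rationals *)

Definition quad (R : nzRingType) (c2 c1 c0 : R) : {poly R} := c2 *: 'X^2 + c1 *: 'X + c0%:P.

Lemma horner_quad (R : comNzRingType) (c2 c1 c0 x : R) :
  (quad c2 c1 c0).[x] = c2 * x ^+ 2 + c1 * x + c0.
Proof. by rewrite /quad !hornerE. Qed.

Lemma deriv_quad (R : comNzRingType) (c2 c1 c0 : R) : (quad c2 c1 c0)^`() = quad 0 (2 * c2) c1.
Proof.
rewrite /quad !derivD derivZ derivZ derivXn derivX derivC addr0 scale0r add0r /= expr1.
by rewrite alg_polyC -scaler_nat scalerA mulrC.
Qed.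

Lemma size_sum_sq_quad (F : fieldType) (u v c2 c1 c0 d2 d1 d0 : F) :
  u * c2 ^+ 2 + v * d2 ^+ 2 != 0 ->
  size (u *: quad c2 c1 c0 ^+ 2 + v *: quad d2 d1 d0 ^+ 2) = 5%N.
Proof.
set w := u * _ + _ => w0.
pose w3 := 2 * (u * c2 * c1 + v * d2 * d1).
pose w2 := u * (2 * c2 * c0 + c1 ^+ 2) + v * (2 * d2 * d0 + d1 ^+ 2).
pose w1 := 2 * (u * c1 * c0 + v * d1 * d0).
pose w0' := u * c0 ^+ 2 + v * d0 ^+ 2.
have -> : u *: quad c2 c1 c0 ^+ 2 + v *: quad d2 d1 d0 ^+ 2 =
    w *: 'X^4 + (w3 *: 'X^3 + w2 *: 'X^2 + w1 *: 'X + w0'%:P).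
  rewrite /quad /w /w3 /w2 /w1 /w0' -!mul_polyC !(polyCM, polyCD, polyC_exp); ring.
rewrite size_polyDl size_scale // size_polyXn //.
rewrite ltnS; do 3?[apply: leq_trans (size_polyD _ _) _; rewrite geq_max; apply/andP; split];
  try by apply: leq_trans (size_scale_leq _ _) _; rewrite ?size_polyXn ?size_polyX.
by rewrite (leq_trans (size_polyC_leq1 _)).
Qed.

Section ConicForms.
Variables p q s0 r0 : rat.
Let k := p - q.
Let a1 := p * (p - 2 * q).
Let a2 := q * (q - 2 * p).
Let n := p ^+ 2 - p * q + q ^+ 2.
Hypothesis conic0 : a1 * s0 ^+ 2 + a2 * r0 ^+ 2 = n.
Hypotheses (p0 : p != 0) (q0 : q != 0) (k0 : k != 0).
Hypotheses (pq0 : 2 * p - q != 0) (qp0 : 2 * q - p != 0).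
Hypothesis g3_lead : p != k * s0 ^+ 2.

Definition poly_s := quad (- a1 * s0) (- 2 * a2 * r0) (a2 * s0).
Definition poly_r := quad (a1 * r0) (- 2 * a1 * s0) (- a2 * r0).
Definition poly_z := quad a1 0 a2.
Definition form1 := poly_s ^+ 2 + poly_z ^+ 2.
Definition form2 := poly_r ^+ 2 + poly_z ^+ 2.
Definition form3 := p *: poly_z ^+ 2 - k *: poly_s ^+ 2.

Let a10 : a1 != 0. Proof. by rewrite mulf_neq0 // -oppr_eq0 opprB. Qed.
Let n0 : n != 0.
Proof.
rewrite /n; have h : 0 < p ^+ 2 - p * q + q ^+ 2.
  have : 0 < p ^+ 2 by rewrite exprn_even_gt0.
  have := sqr_ge0 (p - 2 * q); lra.
by rewrite gt_eqF.
Qed.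

Lemma size_form1 : size form1 = 5%N.
Proof.
rewrite /form1 -[poly_s ^+ 2]scale1r -[poly_z ^+ 2]scale1r; apply: size_sum_sq_quad.
have -> : 1 * (- a1 * s0) ^+ 2 + 1 * a1 ^+ 2 = a1 ^+ 2 * (s0 ^+ 2 + 1) by ring.
by rewrite mulf_neq0 ?expf_neq0 // gt_eqF // ltr_wpDl ?sqr_ge0.
Qed.

Lemma size_form2 : size form2 = 5%N.
Proof.
rewrite /form2 -[poly_r ^+ 2]scale1r -[poly_z ^+ 2]scale1r; apply: size_sum_sq_quad.
have -> : 1 * (a1 * r0) ^+ 2 + 1 * a1 ^+ 2 = a1 ^+ 2 * (r0 ^+ 2 + 1) by ring.
by rewrite mulf_neq0 ?expf_neq0 // gt_eqF // ltr_wpDl ?sqr_ge0.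
Qed.

(** The leading coefficient is a1^2 (p - k s0^2). For the two other forms it is a1^2 times a sum of
    squares and needs no condition on the base point. *)
Lemma size_form3 : size form3 = 5%N.
Proof.
rewrite /form3 -scaleNr; apply: size_sum_sq_quad.
have -> : p * a1 ^+ 2 + - k * (- a1 * s0) ^+ 2 = a1 ^+ 2 * (p - k * s0 ^+ 2) by ring.
by rewrite mulf_neq0 ?expf_neq0 // subr_eq0.
Qed.

Lemma conic_horner (x : rat) :
  a1 * poly_s.[x] ^+ 2 + a2 * poly_r.[x] ^+ 2 = n * poly_z.[x] ^+ 2.
Proof. by rewrite -conic0 /poly_s /poly_r /poly_z !horner_quad; ring. Qed.

(** Coprimality with the derivative is tested at the roots in [algC], which is why the conic was
    studied over an arbitrary field. *)
Lemma separable_forms : separable_poly (form1 * form2 * form3).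
Proof.
pose f : {rmorphism rat -> algC} := ratr.
rewrite unlock -(coprimep_map f); apply: Pdiv.ClosedField.root_coprimep => x.
have nz y : y != 0 -> f y != 0 by move=> y0; rewrite fmorph_eq0.
have mq c2 c1 c0 : map_poly f (quad c2 c1 c0) = quad (f c2) (f c1) (f c0).
  by rewrite /quad !rmorphD /= !map_polyZ /= map_polyXn map_polyX map_polyC.
rewrite /root -deriv_map !rmorphM /= rmorphD rmorphB /= rmorphD /= !map_polyZ /= !rmorphXn /=.
rewrite /poly_s /poly_r /poly_z !mq => /eqP h.
have two : 2 != 0 :> algC by rewrite pnatr_eq0.
have fk : f p - f q != 0 by rewrite -rmorphB nz.
have fpq : 2 * f p - f q != 0.
  by rewrite -[2](rmorph_nat f 2) -rmorphM -rmorphB nz.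
have fqp : 2 * f q - f p != 0.
  by rewrite -[2](rmorph_nat f 2) -rmorphM -rmorphB nz.
have fE (y1 y2 : rat) : f (y1 * (y1 - 2 * y2)) = f y1 * (f y1 - 2 * f y2).
  by rewrite rmorphM rmorphB rmorphM rmorph_nat.
have fN : f n = f p ^+ 2 - f p * f q + f q ^+ 2.
  by rewrite /n rmorphD rmorphB !rmorphXn rmorphM.
have fconic : f p * (f p - 2 * f q) * f s0 ^+ 2 + f q * (f q - 2 * f p) * f r0 ^+ 2 =
    f p ^+ 2 - f p * f q + f q ^+ 2.
  by rewrite -fN -conic0 rmorphD [f (a1 * _)]rmorphM [f (a2 * _)]rmorphM !rmorphXn !fE.
have fn0 : f p ^+ 2 - f p * f q + f q ^+ 2 != 0 by rewrite -fN nz.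
have main := @conic_forms_simple algC (f p) (f q) (f s0) (f r0) x fconic two (nz _ p0) (nz _ q0)
  fk fn0 fpq fqp.
have E1 : f (- a1 * s0) = - (f p * (f p - 2 * f q)) * f s0 by rewrite rmorphM rmorphN fE.
have E2 : f (- 2 * a2 * r0) = - 2 * (f q * (f q - 2 * f p)) * f r0.
  by rewrite rmorphM rmorphM rmorphN rmorph_nat fE.
have E3 : f (a2 * s0) = f q * (f q - 2 * f p) * f s0 by rewrite rmorphM fE.
have E4 : f (a1 * r0) = f p * (f p - 2 * f q) * f r0 by rewrite rmorphM fE.
have E5 : f (- 2 * a1 * s0) = - 2 * (f p * (f p - 2 * f q)) * f s0.
  by rewrite rmorphM rmorphM rmorphN rmorph_nat fE.
have E6 : f (- a2 * r0) = - (f q * (f q - 2 * f p)) * f r0 by rewrite rmorphM rmorphN fE.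
have fk' : f k = f p - f q by rewrite rmorphB.
move: h; rewrite E1 E2 E3 E4 E5 E6 rmorph0 !fE fk' -[ratr p]/(f p).
move: main; move: (f p) (f q) (f s0) (f r0) => P Q S0 R0 main h.
move: main.
set sx := conic_s P Q S0 R0 x; set rx := conic_r P Q S0 R0 x; set zx := conic_z P Q x.
set a := P * (P - 2 * Q); set b := Q * (Q - 2 * P).
have hS : (quad (- a * S0) (- 2 * b * R0) (b * S0)).[x] = sx.
  by rewrite horner_quad /sx /conic_s /a /b; ring.
have hR : (quad (a * R0) (- 2 * a * S0) (- b * R0)).[x] = rx.
  by rewrite horner_quad /rx /conic_r /a /b; ring.
have hZ : (quad a 0 b).[x] = zx by rewrite horner_quad /zx /conic_z /a /b; ring.
have hS' : (quad (- a * S0) (- 2 * b * R0) (b * S0))^`().[x] = - 2 * a * S0 * x - 2 * b * R0.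
  by rewrite deriv_quad horner_quad; ring.
have hR' : (quad (a * R0) (- 2 * a * S0) (- b * R0))^`().[x] = 2 * a * R0 * x - 2 * a * S0.
  by rewrite deriv_quad horner_quad; ring.
have hZ' : (quad a 0 b)^`().[x] = 2 * a * x by rewrite deriv_quad horner_quad; ring.
move: h; move: (quad _ _ _) (quad _ _ _) (quad _ _ _) hS hR hZ hS' hR' hZ'.
move=> SP RP ZP hS hR hZ hS' hR' hZ'.
rewrite !expr2 !(hornerM, hornerD, hornerN, hornerZ) hS hR hZ => h main.
rewrite !(derivM, derivD, derivB, derivN, derivZ, hornerM, hornerD, hornerN, hornerZ).
rewrite hS hR hZ hS' hR' hZ'.
apply: contraNneq (main h) => e; apply/eqP; rewrite -[RHS]e; ring.
Qed.

Lemma int_forms : exists (h1 h2 h3 : {poly int}) (n1 n2 n3 : rat),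
  [/\ [/\ n1 != 0, n2 != 0 & n3 != 0],
    [/\ size h1 = 5%N, size h2 = 5%N & size h3 = 5%N],
    [/\ map_poly intr h1 = n1 *: form1, map_poly intr h2 = n2 *: form2 &
        map_poly intr h3 = n3 *: form3] &
    separable_poly (map_poly intr (h1 * h2 * h3) : {poly rat})].
Proof.
have scale (g : {poly rat}) : size g = 5%N -> exists (h : {poly int}) (m : rat),
    [/\ m != 0, size h = 5%N & map_poly intr h = m *: g].
  move=> gs; have [h [d d0 gE]] := rat_poly_scale g.
  have d0' : d%:~R != 0 :> rat by rewrite intr_eq0.
  have hE : map_poly intr h = d%:~R *: g by rewrite gE scalerA mulfV // scale1r.
  exists h, d%:~R; split=> //.
  rewrite -gs -(size_scale g d0') -hE (size_map_inj_poly (@intr_inj _)) //.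
have [h1 [n1 [n10 hs1 e1]]] := scale _ size_form1.
have [h2 [n2 [n20 hs2 e2]]] := scale _ size_form2.
have [h3 [n3 [n30 hs3 e3]]] := scale _ size_form3.
exists h1, h2, h3, n1, n2, n3; split=> //.
rewrite !rmorphM /= e1 e2 e3 -!scalerAl -!scalerAr -!scalerAl !scalerA.
rewrite unlock derivZ coprimepZl ?mulf_neq0 // coprimepZr ?mulf_neq0 //.
by have := separable_forms; rewrite unlock.
Qed.

End ConicForms.

(** * Group law and 2-descent *)

Section GroupLaw.
Variables lambda D : rat.
Hypotheses (D_neq0 : D != 0) (lambda_neq0 : lambda != 0) (lambda_neq1 : lambda != 1).

Let on := on_twist lambda D.
Let add := ec_add lambda D.

(* The second equation also holds on chords, and determines m on tangents; this makes the
   two cases of the addition law uniform. *)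
Definition is_slope (x1 y1 x2 y2 m : rat) : Prop :=
  m * (x2 - x1) = y2 - y1 /\
  D * m * (y1 + y2) = x1 ^+ 2 + x1 * x2 + x2 ^+ 2 - (1 + lambda) * (x1 + x2) + lambda.

Lemma on_add_opp x y : on (Some (x, y)) -> on (Some (x, - y)).
Proof. by rewrite /on /= sqrrN. Qed.

Lemma ec_add_opp x y : add (Some (x, y)) (Some (x, - y)) = None.
Proof. by rewrite /add /= eqxx opprK eqxx. Qed.

Lemma ec_addNP P : add (ec_opp P) P = None.
Proof. by case: P => [[x y]|]; rewrite /add //= !eqxx. Qed.

Lemma slope_exists x1 y1 x2 y2 : on (Some (x1, y1)) -> on (Some (x2, y2)) ->
  ~~ ((x1 == x2) && (y1 == - y2)) -> exists m, is_slope x1 y1 x2 y2 m.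
Proof.
rewrite /on /= => /eqP on1 /eqP on2.
case: (eqVneq x1 x2) => [ex|nx] /=.
  subst x2 => ny.
  have ey : y2 = y1.
    have /eqP : D * (y2 - y1) * (y1 + y2) = 0.
      have -> : D * (y2 - y1) * (y1 + y2) = D * y2 ^+ 2 - D * y1 ^+ 2 by ring.
      by rewrite on1 on2 subrr.
    rewrite !mulf_eq0 (negbTE D_neq0) /= subr_eq0 addr_eq0 (negbTE ny) orbF.
    by move/eqP.
  subst y2.
  have y0 : y1 != 0 by apply: contra ny => /eqP ->; rewrite oppr0.
  exists ((3 * x1 ^+ 2 - 2 * (1 + lambda) * x1 + lambda) / (2 * D * y1)).
  split; first by rewrite !subrr mulr0.
  by field; rewrite y0 D_neq0.
move=> _; exists ((y2 - y1) / (x2 - x1)).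
have nx' : x2 - x1 != 0 by rewrite subr_eq0 eq_sym.
split; first by field.
apply: (mulIf nx').
have -> : D * ((y2 - y1) / (x2 - x1)) * (y1 + y2) * (x2 - x1) = D * y2 ^+ 2 - D * y1 ^+ 2.
  by field.
by rewrite on1 on2; ring.
Qed.

Lemma ec_addE x1 y1 x2 y2 m :
  ~~ ((x1 == x2) && (y1 == - y2)) -> is_slope x1 y1 x2 y2 m ->
  add (Some (x1, y1)) (Some (x2, y2)) = Some (D * m ^+ 2 + 1 + lambda - x1 - x2,
    - (y1 + m * (D * m ^+ 2 + 1 + lambda - x1 - x2 - x1))).
Proof.
move=> nopp [s1 s2].
rewrite /add /= (negbTE nopp).
suff -> : (if x1 == x2
      then (3 * x1 ^+ 2 - 2 * (1 + lambda) * x1 + lambda) / (2 * D * y1)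
      else (y2 - y1) / (x2 - x1)) = m by [].
move: nopp s1 s2; case: (eqVneq x1 x2) => [<-|nx] /= ny.
  rewrite subrr mulr0 => /esym/eqP; rewrite subr_eq0 => /eqP ey; subst y2 => s2.
  have y0 : y1 != 0 by apply: contra ny => /eqP ->; rewrite oppr0.
  apply: (@mulIf _ (2 * D * y1)); first by rewrite !mulf_neq0.
  rewrite divfK ?mulf_neq0 //.
  transitivity (D * m * (y1 + y1)); last by ring.
  by rewrite s2; ring.
by move=> <- _; rewrite mulfK // subr_eq0 eq_sym.
Qed.

(** An identity in X: at the third abscissa it gives closure under addition, and at a root e of the
    cubic it gives the multiplicativity of the descent map. *)
Lemma line_cubic x1 y1 x2 y2 m X :
  on (Some (x1, y1)) -> is_slope x1 y1 x2 y2 m ->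
  X * (X - 1) * (X - lambda) - D * (y1 + m * (X - x1)) ^+ 2 =
  (X - x1) * (X - x2) * (X - (D * m ^+ 2 + 1 + lambda - x1 - x2)).
Proof.
rewrite /on /= => /eqP on1 [s1 s2].
apply/eqP; rewrite -subr_eq0; apply/eqP.
have e2 : y2 = y1 + m * (x2 - x1) by rewrite s1; ring.
move: s2; rewrite e2 => s2.
transitivity ((x1 * (x1 - 1) * (x1 - lambda) - D * y1 ^+ 2)
  - (X - x1) * (D * m * (y1 + (y1 + m * (x2 - x1))) -
     (x1 ^+ 2 + x1 * x2 + x2 ^+ 2 - (1 + lambda) * (x1 + x2) + lambda))); first by ring.
by rewrite on1 s2; ring.
Qed.

Lemma on_ec_add P Q : on P -> on Q -> on (add P Q).
Proof.
case: P Q => [[x1 y1]|] [[x2 y2]|] // on1 on2.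
case: (boolP ((x1 == x2) && (y1 == - y2))) => [opp|nopp].
  by rewrite /add /= opp.
have [m sl] := slope_exists on1 on2 nopp.
rewrite (ec_addE nopp sl) /on /=.
set x3 := (X in X * _ * _).
have := line_cubic x3 on1 sl; rewrite -/x3 subrr mulr0 => /eqP.
by rewrite subr_eq0 sqrrN eq_sym.
Qed.

Lemma ec_addC P Q : on P -> on Q -> add P Q = add Q P.
Proof.
case: P Q => [[x1 y1]|] [[x2 y2]|] // on1 on2.
case: (boolP ((x1 == x2) && (y1 == - y2))) => [opp|nopp].
  move: (opp) => /andP[/eqP -> /eqP ->].
  by rewrite -{2}[y2]opprK !ec_add_opp.
have [m sl] := slope_exists on1 on2 nopp.
have nopp' : ~~ ((x2 == x1) && (y2 == - y1)).
  by rewrite [x2 == x1]eq_sym -eqr_oppLR [- y2 == _]eq_sym.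
have sl' : is_slope x2 y2 x1 y1 m.
  move: sl => [s1 s2]; split; last by rewrite addrC s2; ring.
  by rewrite -[x1 - x2]opprB mulrN s1 opprB.
rewrite (ec_addE nopp sl) (ec_addE nopp' sl').
have e2 : y2 = y1 + m * (x2 - x1) by case: sl => -> _; ring.
by congr (Some (_, _)); rewrite ?e2; ring.
Qed.

(** The line through -P and P + Q is the reflection of the line through P and Q. *)
Lemma slope_third x1 y1 x2 y2 m (x3 := D * m ^+ 2 + 1 + lambda - x1 - x2) :
  is_slope x1 y1 x2 y2 m -> is_slope x1 (- y1) x3 (- (y1 + m * (x3 - x1))) (- m).
Proof.
move=> [s1 s2]; split; first by ring.
have e2 : y2 = y1 + m * (x2 - x1) by rewrite s1; ring.
move: s2; rewrite e2 => s2.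
apply/eqP; rewrite -subr_eq0; apply/eqP.
transitivity (D * m * (y1 + (y1 + m * (x2 - x1))) -
     (x1 ^+ 2 + x1 * x2 + x2 ^+ 2 - (1 + lambda) * (x1 + x2) + lambda)).
  by rewrite /x3; ring.
by rewrite s2 subrr.
Qed.

Lemma cubic_nonsingular x : x * (x - 1) * (x - lambda) = 0 ->
  3 * x ^+ 2 - 2 * (1 + lambda) * x + lambda != 0.
Proof.
move=> /eqP; rewrite !mulf_eq0 !subr_eq0 => /orP[/orP[]|] /eqP ->.
- by rewrite expr0n /= !mulr0 subrr add0r.
- have -> : 3 * 1 ^+ 2 - 2 * (1 + lambda) * 1 + lambda = 1 - lambda by ring.
  by rewrite subr_eq0 eq_sym.
have -> : 3 * lambda ^+ 2 - 2 * (1 + lambda) * lambda + lambda = lambda * (lambda - 1) by ring.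
by rewrite mulf_neq0 // subr_eq0.
Qed.

Lemma ec_addKl P Q : on P -> on Q -> add (ec_opp P) (add P Q) = Q.
Proof.
case: P Q => [[x1 y1]|] [[x2 y2]|] // on1 on2; last exact: ec_addNP.
case: (boolP ((x1 == x2) && (y1 == - y2))) => [opp|nopp].
  have -> : add (Some (x1, y1)) (Some (x2, y2)) = None by rewrite /add /= opp.
  by move: opp => /andP[/eqP -> /eqP ->]; rewrite /= opprK.
have [m sl] := slope_exists on1 on2 nopp.
rewrite (ec_addE nopp sl).
have sl' := slope_third sl.
set x3 := D * m ^+ 2 + 1 + lambda - x1 - x2 in sl' *.
set y3 := - (y1 + m * (x3 - x1)) in sl' *.
(* Otherwise P + Q = P with Q affine; then y1 = 0, and the slope equation makes x1 a double root of
   the cubic. *)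
have nopp' : ~~ ((x1 == x3) && (- y1 == - y3)).
  apply/negP => /andP[/eqP ex]; rewrite eqr_opp => /eqP ey.
  have y10 : y1 = 0.
    move: ey; rewrite /y3 -ex subrr mulr0 addr0 => /eqP.
    by rewrite -addr_eq0 -mulr2n mulrn_eq0 => /eqP.
  move: (on1); rewrite /on /= y10 expr0n mulr0 eq_sym => /eqP f0.
  have /negP := cubic_nonsingular f0; apply; apply/eqP.
  case: sl' => _; rewrite -ey -ex y10 oppr0 addr0 mulr0 => ->.
  by ring.
rewrite (ec_addE nopp' sl').
have e2 : y2 = y1 + m * (x2 - x1) by case: sl => -> _; ring.
by congr (Some (_, _)); rewrite ?e2 /x3; ring.
Qed.

Lemma ec_oppK : involutive ec_opp.
Proof. by case=> [[x y]|] //=; rewrite opprK. Qed.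

Lemma on_ec_opp P : on P -> on (ec_opp P).
Proof. by case: P => [[x y]|] //= /on_add_opp. Qed.

Lemma ec_opp_add P Q : on P -> on Q -> ec_opp (add P Q) = add (ec_opp P) (ec_opp Q).
Proof.
case: P Q => [[x1 y1]|] [[x2 y2]|] // on1 on2.
rewrite /add /= eqr_opp.
case: (boolP ((x1 == x2) && (y1 == - y2))) => [_ //|_].
pose T := 3 * x1 ^+ 2 - 2 * (1 + lambda) * x1 + lambda.
have mE : (if x1 == x2 then T / (2 * D * - y1) else (- y2 - - y1) / (x2 - x1)) =
    - (if x1 == x2 then T / (2 * D * y1) else (y2 - y1) / (x2 - x1)).
  by case: eqP => _; rewrite ?mulrN ?invrN ?mulrN // -mulNr opprB addrC opprK.
rewrite -/T mE; set m1 := (if _ then _ else _).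
by congr (Some (_, _)); ring.
Qed.

(* With ec_addC and ec_addKl, this instance of associativity implies that doubling is
   additive, which is all that the descent requires.  The proof expresses everything in
   terms of the slopes m, n0, m' of (P, Q), (P, P), (P, P + Q), and of v = x(P + Q) - x(P);
   the slope of (P + P, Q) is then m' + m - n0. *)
Lemma ec_addDA P Q : on P -> on Q -> add P (add P Q) = add (add P P) Q.
Proof.
move=> onP onQ; have onPN := on_ec_opp onP; have onPP := on_ec_add onP onP.
case: P onP onPN onPP => [[x1 y1]|] // on1 onN1 on11.
case: Q onQ => [[x2 y2]|] on2; last by rewrite /= ec_addC.
case: (boolP ((x1 == x2) && (y1 == - y2))) => [opp|nopp].
  move: (opp) => /andP[/eqP ex /eqP ey].
  have -> : Some (x2, y2) = ec_opp (Some (x1, y1)) by rewrite /= ex ey opprK.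
  rewrite [add _ (ec_opp _)]ec_addC // ec_addNP.
  by rewrite [RHS]ec_addC // ec_addKl.
case: (eqVneq y1 0) => [y0|y0].
  have oE : Some (x1, y1) = ec_opp (Some (x1, y1)) by rewrite /= y0 oppr0.
  by rewrite {1}oE ec_addKl // {1}oE ec_addNP.
have nopp1 : ~~ ((x1 == x1) && (y1 == - y1)).
  by rewrite eqxx /= -addr_eq0 -mulr2n mulrn_eq0.
have [m sl] := slope_exists on1 on2 nopp.
have [n0 sl1] := slope_exists on1 on1 nopp1.
have onS := on_ec_add on1 on2.
have SE := ec_addE nopp sl; have WE := ec_addE nopp1 sl1.
(* If P + Q = -P, then Q = -(P + P) and both sides are the point at infinity. *)
case: (eqVneq (add (Some (x1, y1)) (Some (x2, y2))) (ec_opp (Some (x1, y1)))) => [SN|SN].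
  have QE : Some (x2, y2) = ec_opp (add (Some (x1, y1)) (Some (x1, y1))).
    by rewrite -(ec_addKl on1 on2) SN -ec_opp_add.
  by rewrite SN QE ec_addC // ec_addNP [RHS]ec_addC ?ec_addNP // on_ec_opp.
have WN : add (Some (x1, y1)) (Some (x1, y1)) != ec_opp (Some (x2, y2)).
  apply: contra SN => /eqP WN; apply/eqP.
  by rewrite -[Some (x2, y2)]ec_oppK -WN ec_opp_add // -{1}[Some (x1, y1)]ec_oppK ec_addKl.
move: onS SN on11 WN; rewrite SE WE.
set xs := D * m ^+ 2 + 1 + lambda - x1 - x2; set ys := - (y1 + m * (xs - x1)).
set xw := D * n0 ^+ 2 + 1 + lambda - x1 - x1; set yw := - (y1 + n0 * (xw - x1)) => onS SN onW WN.
have nopp2 : ~~ ((x1 == xs) && (y1 == - ys)).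
  apply: contra SN => /andP[/eqP -> /eqP ->]; by rewrite /= opprK.
have nopp3 : ~~ ((xw == x2) && (yw == - y2)).
  by apply: contra WN => /andP[/eqP -> /eqP ->].
have [m' sl2] := slope_exists on1 onS nopp2.
have v0 : xs - x1 != 0.
  apply: contra SN => /eqP v0; rewrite /ys v0 mulr0 addr0.
  by move/eqP: v0; rewrite subr_eq0 => /eqP ->.
move: (sl) (sl1) (sl2) => [a1 a2] [_ b2] [c1 c2].
set v := xs - x1 in v0 c1.
have y1E : y1 = - v * (m' + m) / 2.
  have : m' * v = - (2 * y1 + m * v) by rewrite c1 /ys -/v; ring.
  move=> h; apply: (@mulIf _ 2) => //; rewrite divfK //.
  by transitivity (- (m' * v) - m * v); [rewrite h; ring | ring].
have y2E : y2 = y1 + m * (x2 - x1) by rewrite a1; ring.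
pose n := n0 - m.
have uE : x2 = x1 - D * n * (m' + m).
  have h : 2 * D * y1 * n = (x2 - x1) * v.
    transitivity (D * n0 * (y1 + y1) - D * m * (y1 + y2) + D * m ^+ 2 * (x2 - x1)).
      by rewrite /n y2E; ring.
    by rewrite a2 b2 /v /xs; ring.
  apply: (@mulIf _ v) => //.
  transitivity ((x2 - x1) * v + x1 * v); first by ring.
  by rewrite -h y1E; field.
have sE : 1 + lambda = v - D * m ^+ 2 + 2 * x1 + x2 by rewrite /v /xs; ring.
have lE : lambda = 2 * D * n0 * y1 - 3 * x1 ^+ 2 + 2 * (1 + lambda) * x1.
  have -> : 2 * D * n0 * y1 = D * n0 * (y1 + y1) by ring.
  by rewrite b2; ring.
have n0E : n0 = n + m by rewrite /n; ring.
have xwE : xw = v + x2 + D * (n0 ^+ 2 - m ^+ 2).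
  have -> : xw = D * n0 ^+ 2 + (1 + lambda) - x1 - x1 by rewrite /xw; ring.
  by rewrite sE; ring.
have sl3 : is_slope xw yw x2 y2 (m' - n).
  split; first by rewrite /yw xwE y2E n0E uE y1E; field.
  rewrite [X in _ = _ + X]lE sE /yw xwE y2E n0E uE y1E; by field.
rewrite (ec_addE nopp2 sl2) (ec_addE nopp3 sl3).
have x4E : D * m' ^+ 2 + 1 + lambda - x1 - xs = D * (m' - n) ^+ 2 + 1 + lambda - xw - x2.
  by rewrite [xs](_ : _ = v + x1) ?xwE ?n0E ?uE; [ring | rewrite /v; ring].
rewrite -x4E; congr (Some (_, _)).
have -> : D * m' ^+ 2 + 1 + lambda - x1 - xs = D * m' ^+ 2 - D * m ^+ 2 + x2.
  have -> : xs = v + x1 by rewrite /v; ring.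
  by rewrite -[_ + 1 + lambda]addrA sE; ring.
by rewrite /yw xwE n0E uE y1E; field.
Qed.

(** The derivative of [line_cubic] in X. When the line passes through (e, 0), it writes f'(e) as a
    product over the two other points. *)
Lemma line_cubic_deriv x1 y1 x2 y2 m X :
  is_slope x1 y1 x2 y2 m ->
  let x3 := D * m ^+ 2 + 1 + lambda - x1 - x2 in
  3 * X ^+ 2 - 2 * (1 + lambda) * X + lambda - 2 * D * m * (y1 + m * (X - x1)) =
  (X - x1) * (X - x2) + (X - x1) * (X - x3) + (X - x2) * (X - x3).
Proof.
move=> [s1 s2] x3.
apply/eqP; rewrite -subr_eq0; apply/eqP.
have e2 : y2 = y1 + m * (x2 - x1) by rewrite s1; ring.
move: s2; rewrite e2 => s2.
transitivity (- (D * m * (y1 + (y1 + m * (x2 - x1))) -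
     (x1 ^+ 2 + x1 * x2 + x2 ^+ 2 - (1 + lambda) * (x1 + x2) + lambda))).
  by rewrite /x3; ring.
by rewrite s2 subrr oppr0.
Qed.

(** With S = P + Q, the left side is brought to Q + (P + S) by [ec_addDA]; then P is replaced by S -
    Q. *)
Lemma ec_add_double P Q : on P -> on Q ->
  add (add P P) (add Q Q) = add (add P Q) (add P Q).
Proof.
move=> onP onQ; set S := add P Q.
have onS : on S := on_ec_add onP onQ.
have onPP := on_ec_add onP onP; have onQQ := on_ec_add onQ onQ.
have onQN := on_ec_opp onQ; have onSS := on_ec_add onS onS.
rewrite ec_addC // -ec_addDA // [add Q (add P P)]ec_addC // -ec_addDA // -/S.
have -> : P = add (ec_opp Q) S by rewrite /S [add P Q]ec_addC // ec_addKl.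
have onD := on_ec_add onQN onS.
rewrite [add _ S]ec_addC // [add (ec_opp Q) S]ec_addC // ec_addDA //.
by rewrite [add (add S S) _]ec_addC // -{1}[Q]ec_oppK ec_addKl.
Qed.

Lemma on_ec_mulz m P : on P -> on (ec_mulz lambda D m P).
Proof.
move=> onP.
have onI k : on (iter k (ec_add lambda D P) None).
  by elim: k => //= k IH; apply: on_ec_add.
by case: m => k; [exact: onI | exact: (on_ec_opp (onI k.+1))].
Qed.

Lemma ec_mulz_double m P : on P ->
  ec_mulz lambda D (2 * m) P = add (ec_mulz lambda D m P) (ec_mulz lambda D m P).
Proof.
move=> onP.
have onI k : on (iter k (ec_add lambda D P) None) := on_ec_mulz (Posz k) onP.
have dbl k : iter k.*2 (ec_add lambda D P) None =
    add (iter k (ec_add lambda D P) None) (iter k (ec_add lambda D P) None).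
  elim: k => //= k IH; rewrite -[ec_add lambda D]/add in IH onI *.
  by rewrite IH ec_addDA ?ec_add_double //; apply: on_ec_add.
case: m => k; first by rewrite -PoszM mul2n /= dbl.
have -> : 2 * Negz k = Negz (k.*2.+1) by rewrite !NegzE -doubleS -mul2n PoszM mulrN.
by rewrite /ec_mulz -ec_opp_add ?onI // -dbl.
Qed.

Definition ec_char (chi : Defs.point -> bool) : Prop :=
  [/\ chi None = false, forall P, chi (ec_opp P) = chi P
    & forall P Q, on P -> on Q -> chi (add P Q) = chi P (+) chi Q].

Lemma ec_char_mulz chi m P : ec_char chi -> on P ->
  chi (ec_mulz lambda D m P) = odd `|m| && chi P.
Proof.
move=> [chi0 chiN chiD] onP.
have chiI k : chi (iter k (ec_add lambda D P) None) = odd k && chi P.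
  elim: k => //= k IH; rewrite chiD ?IH //; last exact: (on_ec_mulz (Posz k) onP).
  by case: (odd k); case: (chi P).
by case: m => k; rewrite /ec_mulz ?chiN chiI.
Qed.

Section Independence.
Variables (n : nat) (P : 'I_n -> Defs.point).
Hypothesis onP : forall i, on (P i).

Let comb (m : 'I_n -> int) := \big[add/None]_(i < n) ec_mulz lambda D (m i) (P i).

Lemma on_comb m : on (comb m).
Proof.
by rewrite /comb; elim/big_ind: _ => // [x y|i _]; [apply: on_ec_add | apply: on_ec_mulz].
Qed.

Lemma ec_char_comb chi m : ec_char chi ->
  chi (comb m) = \big[addb/false]_(i < n) (odd `|m i| && chi (P i)).
Proof.
move=> chiP; have [chi0 chiN chiD] := chiP.
suff [] : on (comb m) /\ chi (comb m) = \big[addb/false]_(i < n) (odd `|m i| && chi (P i)) by [].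
rewrite /comb; elim/big_ind2: _ => // [x1 x2 y1 y2 [on1 <-] [on2 <-]|i _].
  by split; [apply: on_ec_add | rewrite chiD].
by split; [apply: on_ec_mulz | rewrite ec_char_mulz].
Qed.

Lemma comb_double m : comb (fun i => 2 * m i) = add (comb m) (comb m).
Proof.
suff [] : on (comb m) /\ comb (fun i => 2 * m i) = add (comb m) (comb m) by [].
rewrite /comb; elim/big_ind2: _ => // [x1 x2 y1 y2 [on1 ->] [on2 ->]|i _].
  by split; [apply: on_ec_add | rewrite ec_add_double].
by split; [apply: on_ec_mulz | rewrite ec_mulz_double].
Qed.

(* By beta a relation has even coefficients; half of it is a 2-torsion point on which all
   characters vanishing on the P j vanish, hence is again a relation. *)
Lemma ec_indep_of_chars (beta : 'I_n -> Defs.point -> bool) :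
  (forall i, ec_char (beta i)) ->
  (forall eps : 'I_n -> bool,
    (forall i, \big[addb/false]_(j < n) (eps j && beta i (P j)) = false) ->
    forall j, eps j = false) ->
  (forall T, on T -> T <> None -> add T T = None ->
    exists chi, [/\ ec_char chi, forall j, chi (P j) = false & chi T]) ->
  ec_indep lambda D P.
Proof.
move=> betaP beta_inj tors m0 comb0.
have key k : forall m, comb m = None -> forall i, (2 ^ k %| `|m i|)%N.
  elim: k => [|k IH] m mE i; first by rewrite dvd1n.
  have ev j : odd `|m j| = false.
    apply: (beta_inj (fun j => odd `|m j|)) => i0; rewrite -ec_char_comb // mE.
    by case: (betaP i0).
  pose m' j : int := (m j %/ 2)%Z.
  have mm' j : m j = 2 * m' j.
    rewrite /m' mulrC divzK // dvdzE (_ : `|2|%N = 2%N) // dvdn2 ev //.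
  have m'E : comb m' = None.
    apply: contrapT => /(tors _ (on_comb m')) [].
      rewrite -comb_double -mE /comb; apply: eq_bigr => j _; by rewrite -mm'.
    move=> chi [chiP chi0]; rewrite ec_char_comb // big1 // => j _.
    by rewrite chi0 andbF.
  by rewrite mm' abszM expnS dvdn_pmul2l // IH.
move=> i; apply/eqP; rewrite -absz_eq0 -leqn0 leqNgt; apply/negP => h.
have := dvdn_leq h (key `|m0 i|%N m0 comb0 i).
by rewrite leqNgt ltn_expl.
Qed.

End Independence.

(** * The descent characters *)

Section Descent.
Variable phi : rat -> bool.
Hypothesis phiM : forall x y, x != 0 -> y != 0 -> phi (x * y) = phi x (+) phi y.
Variable e : rat.
Hypothesis e_root : e * (e - 1) * (e - lambda) = 0.

(** The usual map x - e modulo squares, for the Weierstrass model with abscissa D x; at x = e its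
    value is the product f'(e) of the differences with the other two roots, up to D^2. *)
Definition descent (P : Defs.point) : bool :=
  if P is Some (x, y) then
    phi (if x == e then 3 * e ^+ 2 - 2 * (1 + lambda) * e + lambda else D * (x - e))
  else false.

(** For collinear points none of which lies above e, the product of the D (x_i - e) is (D^2 l)^2,
    where l is the ordinate of the line at e. *)
Lemma descent_char : ec_char descent.
Proof.
have df0 := cubic_nonsingular e_root.
split=> // [[[x y]|]|] //.
move=> [[x1 y1]|] [[x2 y2]|] on1 on2; rewrite ?addbF //.
case: (boolP ((x1 == x2) && (y1 == - y2))) => [opp|nopp].
  by rewrite {1}/add /= opp; move: opp => /andP[/eqP -> _]; rewrite addbb.
have [m sl] := slope_exists on1 on2 nopp.
rewrite (ec_addE nopp sl).
set x3 := D * m ^+ 2 + 1 + lambda - x1 - x2.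
have h1 := line_cubic e on1 sl; have h2 := line_cubic_deriv e sl.
rewrite /= -/x3 in h1 h2; rewrite /=.
rewrite e_root sub0r in h1.
set l := y1 + m * (e - x1) in h1 h2.
have sq z : z != 0 -> phi (z ^+ 2) = false by move=> z0; rewrite expr2 phiM // addbb.
set C := 3 * e ^+ 2 - 2 * (1 + lambda) * e + lambda in df0 h2 *.
have main a b : a - e != 0 -> b - e != 0 -> C = (e - a) * (e - b) ->
    phi C = phi (D * (a - e)) (+) phi (D * (b - e)).
  move=> a0 b0 CE.
  rewrite -phiM ?mulf_neq0 //.
  have -> : D * (a - e) * (D * (b - e)) = D ^+ 2 * C by rewrite CE; ring.
  by rewrite phiM ?expf_neq0 // sq.
(* If one abscissa is e, the line passes through (e, 0), and [line_cubic_deriv] puts the situation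
   in the form of [main]. *)
have l0 : (x1 - e) * (x2 - e) * (x3 - e) = 0 -> l = 0.
  move=> h; move: h1.
  have -> : (e - x1) * (e - x2) * (e - x3) = - ((x1 - e) * (x2 - e) * (x3 - e)) by ring.
  by rewrite h => /eqP; rewrite eqr_opp mulf_eq0 (negbTE D_neq0) /= sqrf_eq0 => /eqP.
case: (eqVneq x1 e) => [x1e|]; last rewrite -subr_eq0 => x10.
  move: h2; rewrite l0 x1e !(subrr, mul0r, mulr0, subr0, add0r, addr0) // => CE.
  move: (df0); rewrite {1}CE mulf_eq0 !(subr_eq0 e) !(eq_sym e) negb_or => /andP[x20 x30].
  rewrite (negbTE x20) (negbTE x30).
  move: x20 x30; rewrite -(subr_eq0 x2) -(subr_eq0 x3) => x20 x30.
  by rewrite (main x2 x3) // addbC addbA addbb.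
case: (eqVneq x2 e) => [x2e|]; last rewrite -subr_eq0 => x20.
  move: h2; rewrite l0 x2e !(subrr, mul0r, mulr0, subr0, add0r, addr0) // => CE.
  move: (df0); rewrite {1}CE mulf_eq0 !(subr_eq0 e) !(eq_sym e) negb_or => /andP[_ x30].
  rewrite (negbTE x30).
  move: x30; rewrite -(subr_eq0 x3) => x30.
  by rewrite (main x1 x3) // addbA addbb.
case: (eqVneq x3 e) => [x3e|]; last rewrite -subr_eq0 => x30.
  move: h2; rewrite l0 x3e !(subrr, mul0r, mulr0, subr0, add0r, addr0) // => CE.
  by rewrite (main x1 x2).
suff : phi (D * (x1 - e)) (+) phi (D * (x2 - e)) (+) phi (D * (x3 - e)) = false.
  by do 3!case: (phi _).
rewrite -!phiM ?mulf_neq0 //.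
have -> : D * (x1 - e) * (D * (x2 - e)) * (D * (x3 - e)) =
    D ^+ 3 * - ((e - x1) * (e - x2) * (e - x3)) by ring.
rewrite -h1 opprK.
have -> : D ^+ 3 * (D * l ^+ 2) = (D ^+ 2 * l) ^+ 2 by ring.
rewrite sq // mulf_neq0 // ?expf_neq0 //; apply/eqP => l00.
have n0 z : z - e != 0 -> e - z != 0 by rewrite -oppr_eq0 opprB.
have : (e - x1) * (e - x2) * (e - x3) != 0 by rewrite !mulf_neq0 ?n0.
by rewrite -h1 l00 expr0n mulr0 oppr0 eqxx.
Qed.

End Descent.

End GroupLaw.

(** * Three independent points on one twist *)

Section ThreePoints.
Variables (lambda D e1 e2 e3 s r t y : rat).
Let p := e1 - e3.
Let q := e2 - e3.
Let k := e1 - e2.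
Hypotheses (lambda_neq0 : lambda != 0) (lambda_neq1 : lambda != 1) (D_neq0 : D != 0).
Hypothesis fE : forall x, x * (x - 1) * (x - lambda) = (x - e1) * (x - e2) * (x - e3).
Hypotheses (p_neq0 : p != 0) (q_neq0 : q != 0) (k_neq0 : k != 0).
Hypotheses (pq_neq0 : 2 * p - q != 0) (qp_neq0 : 2 * q - p != 0).
Hypotheses (s_neq0 : s != 0) (r_neq0 : r != 0).
Hypothesis conic : p * (p - 2 * q) * s ^+ 2 + q * (q - 2 * p) * r ^+ 2 =
  p ^+ 2 - p * q + q ^+ 2.
Hypothesis tE : t = e1 - p * k * (1 + s ^+ 2) / (2 * p - q).
Hypothesis yE : D * y ^+ 2 = t * (t - 1) * (t - lambda).

(** [tE] expresses t by s alone; the conic is the condition that the analogous expression by r gives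
    the same t. *)
Lemma conic_t : t = e2 + q * k * (1 + r ^+ 2) / (2 * q - p).
Proof.
rewrite tE; apply/eqP; rewrite -subr_eq0; apply/eqP.
apply: (@mulIf _ ((2 * p - q) * (2 * q - p))); first by rewrite mulf_neq0.
rewrite mul0r.
transitivity (k * (p * (p - 2 * q) * s ^+ 2 + q * (q - 2 * p) * r ^+ 2 -
  (p ^+ 2 - p * q + q ^+ 2))); last by rewrite conic subrr mulr0.
have -> : e1 = e3 + p by rewrite /p; ring.
have -> : e2 = e3 + q by rewrite /q; ring.
have -> : k = p - q by rewrite /k /p /q; ring.
by field; rewrite pq_neq0 qp_neq0.
Qed.

(* The images of t under the Moebius maps fixing e1, resp. e2, and exchanging the two other
   roots. *)
Let x1 := e1 + (t - e1) / s ^+ 2.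
Let x2 := e2 + (t - e2) / r ^+ 2.

Let e1E : e1 = e3 + p. Proof. by rewrite /p; ring. Qed.
Let e2E : e2 = e3 + q. Proof. by rewrite /q; ring. Qed.
Let kE : k = p - q. Proof. by rewrite /k /p /q; ring. Qed.

Lemma x1_sub1 : x1 - e1 = (t - e1) / s ^+ 2. Proof. by rewrite /x1; ring. Qed.
(** The Moebius map exchanges the factors t - e2 and t - e3. The constants here and in [x1_sub3]
    have product 1, so the image lies on the same twist. *)
Lemma x1_sub2 : x1 - e2 = (- 1) * (e1 - e2) / p * (t - e3) / s ^+ 2.
Proof.
rewrite -/k /x1 tE e1E e2E; have := k_neq0; rewrite kE => k0.
by field; rewrite pq_neq0 s_neq0 p_neq0.
Qed.
Lemma x1_sub3 : x1 - e3 = (- 1) * p / k * (t - e2) / s ^+ 2.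
Proof.
rewrite /x1 tE e1E e2E; have := k_neq0; rewrite kE => k0.
by field; rewrite pq_neq0 s_neq0 k0.
Qed.
Lemma x2_sub2 : x2 - e2 = (t - e2) / r ^+ 2. Proof. by rewrite /x2; ring. Qed.
Lemma x2_sub1 : x2 - e1 = k / q * (t - e3) / r ^+ 2.
Proof.
rewrite /x2 conic_t e1E e2E; have := k_neq0; rewrite kE => k0.
by field; rewrite qp_neq0 r_neq0 q_neq0.
Qed.
Lemma x2_sub3 : x2 - e3 = q / k * (t - e1) / r ^+ 2.
Proof.
rewrite /x2 conic_t e1E e2E; have := k_neq0; rewrite kE => k0.
by field; rewrite qp_neq0 r_neq0 k0.
Qed.

Lemma on_three_points : [/\ on_twist lambda D (Some (t, y)),
  on_twist lambda D (Some (x1, y / s ^+ 3)) & on_twist lambda D (Some (x2, y / r ^+ 3))].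
Proof.
have yE' := yE; rewrite fE in yE'.
split; rewrite /= fE ?x1_sub1 ?x1_sub2 ?x1_sub3 ?x2_sub1 ?x2_sub2 ?x2_sub3; apply/eqP => //.
- have -> : D * (y / s ^+ 3) ^+ 2 = D * y ^+ 2 / s ^+ 6 by field.
  rewrite yE' -/k; have := k_neq0 => k0.
  by field; rewrite s_neq0 p_neq0 k0.
have -> : D * (y / r ^+ 3) ^+ 2 = D * y ^+ 2 / r ^+ 6 by field.
rewrite yE'; have := k_neq0 => k0.
by field; rewrite r_neq0 q_neq0 k0.
Qed.

Variables phi1 phi2 phi3 : rat -> bool.
Let isch (phi : rat -> bool) :=
  [/\ forall x y, x != 0 -> y != 0 -> phi (x * y) = phi x (+) phi y,
      phi (- 1) = false, phi D & [/\ phi p = false, phi q = false & phi k = false]].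
Hypotheses (ch1 : isch phi1) (ch2 : isch phi2) (ch3 : isch phi3).
Hypotheses (t1_neq0 : t - e1 != 0) (t2_neq0 : t - e2 != 0) (t3_neq0 : t - e3 != 0).
Hypotheses (phi11 : phi1 (t - e1)) (phi12 : phi1 (t - e2) = false) (phi13 : phi1 (t - e3) = false).
Hypotheses (phi21 : phi2 (t - e1) = false) (phi22 : phi2 (t - e2)) (phi23 : phi2 (t - e3) = false).
Hypotheses (phi31 : phi3 (t - e1) = false) (phi32 : phi3 (t - e2) = false) (phi33 : phi3 (t - e3)).

Lemma three_indep_points (R : realType) : (3%:R%:E <= ec_rank R lambda D)%E.
Proof.
apply: ereal_sup_ubound; exists 3%N => //=.
pose P (i : 'I_3) : Defs.point :=
  nth None [:: Some (t, y); Some (x1, y / s ^+ 3); Some (x2, y / r ^+ 3)] i.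
exists P.
have [on0 on1 on2] := on_three_points.
have onP i : on_twist lambda D (P i) by case: i => [[|[|[|]]]].
split=> //.
have root1 : e1 * (e1 - 1) * (e1 - lambda) = 0 by rewrite fE subrr !mul0r.
have root2 : e2 * (e2 - 1) * (e2 - lambda) = 0 by rewrite fE subrr mulr0 mul0r.
have root3 : e3 * (e3 - 1) * (e3 - lambda) = 0 by rewrite fE subrr mulr0.
have dE phi e : isch phi -> t - e != 0 -> descent lambda D phi e (Some (t, y)) = ~~ phi (t - e).
  move=> [phiM _ phiD _] te; rewrite /= -subr_eq0 (negbTE te) phiM // phiD.
  by case: (phi _).
have phiV phi x : isch phi -> x != 0 -> phi x^-1 = phi x.
  move=> [phiM _ _ _] x0; have h := phiM 1 1 (oner_neq0 _) (oner_neq0 _).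
  have := phiM x x^-1 x0; rewrite invr_neq0 // => /(_ isT).
  rewrite mulfV // => h2; move: h h2; rewrite mulr1.
  by case: (phi 1) => //; case: (phi x); case: (phi x^-1).
(* Since phi is odd on D, a difference x0 - e equal to w up to squares and phi-even constants has
   image phi(D w) = [~~ phi w]. *)
have cE phi x0 y0 e c w u : isch phi -> x0 - e = c * w / u ^+ 2 -> c != 0 -> phi c = false ->
    w != 0 -> u != 0 -> descent lambda D phi e (Some (x0, y0)) = ~~ phi w.
  move=> chp xE c0 phic w0 u0; have [phiM _ phiD _] := chp.
  have x00 : x0 - e != 0 by rewrite xE !mulf_neq0 // invr_neq0 // expf_neq0.
  rewrite /= -subr_eq0 (negbTE x00) phiM // phiD xE phiM ?mulf_neq0 ?invr_neq0 ?expf_neq0 //.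
  rewrite phiV ?expf_neq0 // expr2 !phiM // phic.
  by case: (phi u); case: (phi w).
have c1 phi : isch phi -> phi 1 = false.
  move=> [phiM _ _ _]; have := phiM 1 1 (oner_neq0 _) (oner_neq0 _); rewrite mulr1.
  by case: (phi 1).
have N1 : -1 != 0 :> rat by [].
have P1E phi e w (c := if e == e1 then 1 else if e == e2 then -1 * (e1 - e2) / p else - 1 * p / k) :
  isch phi -> x1 - e = c * w / s ^+ 2 -> w != 0 ->
  descent lambda D phi e (Some (x1, y / s ^+ 3)) = ~~ phi w.
  move=> chp xE w0; have [phiM phiN phiD [phip phiq phik]] := chp.
  apply: (cE _ _ _ _ c w s) => //; rewrite /c; do 2?case: ifP => _;
    by rewrite ?c1 ?phiM ?phiV ?phiN ?phip ?phik ?mulf_neq0 ?invr_neq0 ?oner_neq0.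
have P2E phi e w (c := if e == e1 then k / q else if e == e2 then 1 else q / k) :
  isch phi -> x2 - e = c * w / r ^+ 2 -> w != 0 ->
  descent lambda D phi e (Some (x2, y / r ^+ 3)) = ~~ phi w.
  move=> chp xE w0; have [phiM phiN phiD [phip phiq phik]] := chp.
  apply: (cE _ _ _ _ c w r) => //; rewrite /c; do 2?case: ifP => _;
    by rewrite ?c1 ?phiM ?phiV ?phiN ?phiq ?phik ?mulf_neq0 ?invr_neq0 ?oner_neq0.
have e21 : (e2 == e1) = false by apply/negbTE; rewrite eq_sym -subr_eq0.
have e31 : (e3 == e1) = false by apply/negbTE; rewrite eq_sym -subr_eq0.
have e32 : (e3 == e2) = false by apply/negbTE; rewrite eq_sym -subr_eq0.
have d11 phi : isch phi -> descent lambda D phi e1 (Some (x1, y / s ^+ 3)) = ~~ phi (t - e1).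
  by move=> h; apply: P1E; rewrite ?eqxx ?mul1r ?x1_sub1.
have d12 phi : isch phi -> descent lambda D phi e2 (Some (x1, y / s ^+ 3)) = ~~ phi (t - e3).
  by move=> h; apply: P1E; rewrite ?eqxx ?e21 ?x1_sub2.
have d21 phi : isch phi -> descent lambda D phi e1 (Some (x2, y / r ^+ 3)) = ~~ phi (t - e3).
  by move=> h; apply: P2E; rewrite ?eqxx ?x2_sub1.
have d22 phi : isch phi -> descent lambda D phi e2 (Some (x2, y / r ^+ 3)) = ~~ phi (t - e2).
  by move=> h; apply: P2E; rewrite ?eqxx ?e21 ?mul1r ?x2_sub2.
(* The three points involve one t - e_i each, so their images under Phi vanish, whereas
   Phi is odd on D and hence detects the 2-torsion. *)
pose Phi x := phi1 x (+) phi2 x (+) phi3 x.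
have chP : isch Phi.
  move: ch1 ch2 ch3 => [M1 N1' D1 [p1 q1 k1]] [M2 N2 D2 [p2 q2 k2]] [M3 N3 D3 [p3 q3 k3]].
  rewrite /Phi; split; rewrite ?N1' ?N2 ?N3 ?D1 ?D2 ?D3 ?p1 ?p2 ?p3 ?q1 ?q2 ?q3 ?k1 ?k2 ?k3 //.
  move=> a b a0 b0; rewrite M1 // M2 // M3 //.
  by case: (phi1 a); case: (phi1 b); case: (phi2 a); case: (phi2 b); case: (phi3 a); case: (phi3 b).
(* On the points with abscissas t, x1, x2 the rows are (0, 0, 1), (0, 1, 0) and (1, 1, 0), an
   invertible matrix. The third character is the default of [nth]. *)
pose beta (i : 'I_3) := nth (descent lambda D phi3 e1)
  [:: descent lambda D phi1 e1; descent lambda D phi2 e2] i.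
apply: (@ec_indep_of_chars _ _ D_neq0 lambda_neq0 lambda_neq1 _ _ onP beta).
- have [M1 _ _ _] := ch1; have [M2 _ _ _] := ch2; have [M3 _ _ _] := ch3.
  by case=> [[|[|[|]]]] //= ?; apply: descent_char.
- move=> eps h.
  have := h ord0; have := h (lift ord0 ord0); have := h (lift ord0 (lift ord0 ord0)).
  rewrite !big_ord_recl !big_ord0 /P /beta.
  rewrite ![nth _ _ _]/=.
  rewrite !dE // !d11 // !d12 // !d21 // !d22 //.
  rewrite phi11 phi22 phi31 phi13 phi23 phi33 /= !(andbF, andbT) => h3 h2 h1 j.
  have -> : j = [:: ord0; lift ord0 ord0; lift ord0 (lift ord0 ord0)]`_j.
    by case: j => [[|[|[|]]]] //= ?; apply: val_inj.
  move: h1 h2 h3; case: j => [[|[|[|]]]] //= ?;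
  by case: (eps _); case: (eps _); case: (eps _).
move=> [[x w]|] // onT _ TT.
have w0 : w = 0.
  move: TT; rewrite /= eqxx /=; case: (eqVneq w (- w)) => // h _.
  by apply/eqP; move/eqP: h; rewrite -addr_eq0 -mulr2n mulrn_eq0.
move: onT; rewrite /= w0 expr0n mulr0 eq_sym fE !mulf_eq0 => fx0.
have zero e : (e == e1) || (e == e2) -> forall j, descent lambda D Phi e (P j) = false.
  move=> eE; case=> [[|[|[|m]]] jlt]; last (by case: (notF jlt)); rewrite /P [nth _ _ _]/=.
  + by case/orP: eE => /eqP ->; rewrite dE // /Phi ?phi11 ?phi12 ?phi21 ?phi22 ?phi31 ?phi32.
  + by case/orP: eE => /eqP ->; rewrite ?d11 ?d12 // /Phi ?phi11 ?phi21 ?phi31 ?phi13 ?phi23 ?phi33.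
  by case/orP: eE => /eqP ->; rewrite ?d21 ?d22 // /Phi ?phi12 ?phi22 ?phi32 ?phi13 ?phi23 ?phi33.
have [PhiM PhiN PhiD [Phip Phiq Phik]] := chP.
case: (eqVneq x e1) => xe1.
  exists (descent lambda D Phi e2).
  split; [exact: descent_char | by apply: zero; rewrite eqxx orbT |].
  by rewrite /= xe1 eq_sym e21 PhiM // PhiD Phik.
exists (descent lambda D Phi e1).
split; [exact: descent_char | by apply: zero; rewrite eqxx |].
rewrite /= (negbTE xe1) PhiM ?subr_eq0 // PhiD.
move: fx0; rewrite !subr_eq0 (negbTE xe1) /= => /orP[] /eqP ->.
  by rewrite -opprB -mulN1r PhiM ?PhiN ?Phik.
by rewrite -opprB -mulN1r PhiM ?PhiN ?Phip.
Qed.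

End ThreePoints.

(** * Counting the twists *)

Lemma squarefree_part_nat n : (0 < n)%N -> exists d e : nat,
  [/\ n = (d * e ^ 2)%N, (0 < d)%N, (0 < e)%N & forall p, prime p -> ~~ (p ^ 2 %| d)%N].
Proof.
elim/ltn_ind: n => n IH n0.
have [[p pp /dvdnP[k nE]]|h] := pselect (exists2 p, prime p & (p ^ 2 %| n)%N); last first.
  exists n, 1%N; rewrite exp1n muln1; split=> // p pp; apply/negP => pn.
  by apply: h; exists p.
have k0 : (0 < k)%N by move: n0; rewrite nE muln_gt0 => /andP[].
have p1 := prime_gt1 pp.
have kn : (k < n)%N by rewrite nE -[X in (X < _)%N]muln1 ltn_pmul2l // -(exp1n 2) ltn_exp2r.
have [d [e [kE d0 e0 dP]]] := IH k kn k0.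
exists d, (e * p)%N; split=> //; last by rewrite muln_gt0 e0 ltnW.
by rewrite nE kE expnMn mulnA.
Qed.

Lemma squarefree_part_rat (c : rat) : c != 0 -> exists (d : int) (w : rat),
  [/\ w != 0, d != 0, c = d%:~R * w ^+ 2 & forall p, prime p -> ~~ (p ^ 2 %| `|d|)%N].
Proof.
move=> c0; pose n := numq c * denq c.
have n0 : (0 < `|n|)%N by rewrite absz_gt0 mulf_neq0 ?numq_eq0 ?denq_neq0.
have [d [e [nE d0 e0 dP]]] := squarefree_part_nat n0.
have dq0 : (denq c)%:~R != 0 :> rat by rewrite intr_eq0 denq_neq0.
have eq0 : e%:R != 0 :> rat by rewrite pnatr_eq0 -lt0n.
exists (Num.sg n * d%:Z), (e%:R / (denq c)%:~R); split.
- by rewrite mulf_neq0 ?invr_neq0.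
- by rewrite mulf_neq0 // ?sgr_eq0 -absz_gt0.
- have nE' : n = Num.sg n * d%:Z * e%:Z ^+ 2.
    by rewrite {1}(numEsg n) -abszE nE PoszM -mulrA -rmorphXn.
  transitivity (n%:~R / (denq c)%:~R ^+ 2 : rat).
    by rewrite /n rmorphM /= numqE; field.
  by rewrite {1}nE' !rmorphM /=; field.
by move=> p pp; rewrite abszM absz_sg mulf_neq0 ?numq_eq0 ?denq_neq0 // mul1n dP.
Qed.

Lemma squarefreeP (D : int) : (forall p, prime p -> ~~ (p ^ 2 %| `|D|)%N) -> squarefree D.
Proof.
move=> h d d1; apply: contra (h _ (pdiv_prime d1)) => /(dvdn_trans _); apply.
by rewrite dvdn_exp2r // pdiv_dvd.
Qed.

Lemma vparity_exact (l : nat) (m : int) : prime l -> m != 0 -> (l %| `|m|)%N ->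
  ~~ (l ^ 2 %| `|m|)%N -> vparity l m%:~R.
Proof.
move=> pl m0 lm lm2; have m0' : (0 < `|m|)%N by rewrite absz_gt0.
rewrite vparity_int // (_ : logn l _ = 1%N) //.
by apply/eqP; rewrite eqn_leq -pfactor_dvdn // expn1 lm andbT -ltnS ltnNge -pfactor_dvdn.
Qed.

Lemma vparity_ndvd (l : nat) (m : int) : m != 0 -> ~~ (l %| `|m|)%N -> vparity l m%:~R = false.
Proof.
move=> m0 lm; rewrite vparity_int // (_ : logn l _ = 0%N) //.
by apply/eqP; rewrite -leqn0 leqNgt logn_gt0 mem_primes; apply: contra lm => /and3P[].
Qed.

Section Twist.
Variables (lambda e1 e2 e3 s0 r0 : rat).
Let p := e1 - e3.
Let q := e2 - e3.
Let k := e1 - e2.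
Hypotheses (lambda_neq0 : lambda != 0) (lambda_neq1 : lambda != 1).
Hypothesis fE : forall x, x * (x - 1) * (x - lambda) = (x - e1) * (x - e2) * (x - e3).
Hypotheses (p_neq0 : p != 0) (q_neq0 : q != 0) (k_neq0 : k != 0).
Hypotheses (pq_neq0 : 2 * p - q != 0) (qp_neq0 : 2 * q - p != 0).
Hypothesis conic0 : p * (p - 2 * q) * s0 ^+ 2 + q * (q - 2 * p) * r0 ^+ 2 =
  p ^+ 2 - p * q + q ^+ 2.

Let kE : p - q = k. Proof. by rewrite /k /p /q; ring. Qed.
Let kappa1 := - (p * k) / (2 * p - q).
Let kappa2 := q * k / (2 * q - p).
Let kappa3 := p / (2 * p - q).

Variables (h1 h2 h3 : {poly int}) (n1 n2 n3 : rat) (f1 f2 f3 : int) (B : nat).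
Hypotheses (n1_neq0 : n1 != 0) (n2_neq0 : n2 != 0) (n3_neq0 : n3 != 0).
Hypotheses (hs1 : size h1 = 5%N) (hs2 : size h2 = 5%N) (hs3 : size h3 = 5%N).
Hypotheses (hE1 : map_poly intr h1 = n1 *: form1 p q s0 r0)
  (hE2 : map_poly intr h2 = n2 *: form2 p q s0 r0)
  (hE3 : map_poly intr h3 = n3 *: form3 p q s0 r0).
Hypotheses (f1_neq0 : f1 != 0) (f2_neq0 : f2 != 0) (f3_neq0 : f3 != 0).

(** These are the constants for which t - e_i = c_i m_i up to a square, so the twist is by m times
    the squarefree part d of c1 c2 c3. *)
Let c1 := kappa1 * f1%:~R / n1.
Let c2 := kappa2 * f2%:~R / n2.
Let c3 := kappa3 * f3%:~R / n3.

Hypothesis good_prime : forall l, prime l -> ~~ (l %| B)%N ->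
  [/\ vparity l p = false, vparity l q = false, vparity l k = false &
    [/\ vparity l c1 = false, vparity l c2 = false, vparity l c3 = false &
      [/\ ~~ (l %| `|f1|)%N, ~~ (l %| `|f2|)%N, vparity l n1 = false & vparity l n2 = false]]].

Variables (d : int) (w : rat).
Hypotheses (w_neq0 : w != 0) (d_neq0 : d != 0) (dE : c1 * c2 * c3 = d%:~R * w ^+ 2).

Variables (m m1 m2 m3 a b : int).
Hypotheses (m_cop : coprime `|m| B) (m_sqf : forall l, prime l -> ~~ (l ^ 2 %| `|m|)%N).
Hypotheses (b_neq0 : b != 0) (mE : m = m1 * m2 * m3).
Hypotheses (m1_gt1 : (1 < `|m1|)%N) (m2_gt1 : (1 < `|m2|)%N) (m3_gt1 : (1 < `|m3|)%N).
Hypotheses (v1 : homog 4 h1 a b = f1 * m1) (v2 : homog 4 h2 a b = f2 * m2)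
  (v3 : homog 4 h3 a b = f3 * m3).

(** As m is squarefree, a prime factor of x1 divides it exactly once and divides neither x2 nor
    x3. *)
Lemma prime_factor_exact (x1 x2 x3 : int) : m = x1 * x2 * x3 -> (1 < `|x1|)%N ->
  exists l, [/\ prime l, ~~ (l %| B)%N, vparity l x1%:~R, vparity l x2%:~R = false &
    vparity l x3%:~R = false /\ (l %| `|x1|)%N].
Proof.
move=> xE x1_gt1; pose l := pdiv `|x1|; have pl : prime l := pdiv_prime x1_gt1.
have lx : (l %| `|x1|)%N := pdiv_dvd _.
have m0 : m != 0 by apply/eqP => m0; have := m_sqf (isT : prime 2); rewrite m0.
have [[x10 x20] x30] : (x1 != 0 /\ x2 != 0) /\ x3 != 0.
  by move: m0; rewrite xE !mulf_eq0 !negb_or => /andP[/andP[-> ->] ->].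
have sq := m_sqf pl; rewrite xE !abszM in sq.
exists l; split=> //.
- apply/negP => lB; have : (l %| gcdn `|m| B)%N by rewrite dvdn_gcd lB xE !abszM -mulnA dvdn_mulr.
  by rewrite (eqP m_cop) dvdn1 => /eqP l1; move: pl; rewrite l1.
- apply: vparity_exact => //; apply: contra sq => h; by rewrite -mulnA dvdn_mulr.
- apply: vparity_ndvd => //; apply: contra sq => h.
  by rewrite dvdn_mulr // expnS expn1 dvdn_mul.
split=> //; apply: vparity_ndvd => //; apply: contra sq => h.
by rewrite mulnAC dvdn_mulr // expnS expn1 dvdn_mul.
Qed.

Lemma twist_rank (R : realType) : (3%:R%:E <= ec_rank R lambda (d * m)%:~R)%E.
Proof.
have [l1 [pl1 l1B vp11 vp12 [vp13 l1m]]] := prime_factor_exact mE m1_gt1.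
have [l2 [pl2 l2B vp22 vp21 [vp23 l2m]]] : exists l, [/\ prime l, ~~ (l %| B)%N, vparity l m2%:~R,
    vparity l m1%:~R = false & vparity l m3%:~R = false /\ (l %| `|m2|)%N].
  by apply: prime_factor_exact; rewrite // mE; ring.
have [l3 [pl3 l3B vp33 vp31 [vp32 l3m]]] : exists l, [/\ prime l, ~~ (l %| B)%N, vparity l m3%:~R,
    vparity l m1%:~R = false & vparity l m2%:~R = false /\ (l %| `|m3|)%N].
  by apply: prime_factor_exact; rewrite // mE; ring.
have m0 : m != 0 by apply/eqP => m0; have := m_sqf (isT : prime 2); rewrite m0.
have [[m10 m20] m30] : (m1 != 0 /\ m2 != 0) /\ m3 != 0.
  by move: m0; rewrite mE !mulf_eq0 !negb_or => /andP[/andP[-> ->] ->].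
have [[q10 q20] q30] : (m1%:~R != 0 :> rat /\ m2%:~R != 0 :> rat) /\ m3%:~R != 0 :> rat.
  by rewrite !intr_eq0.
have fr1 : f1%:~R != 0 :> rat by rewrite intr_eq0.
have fr2 : f2%:~R != 0 :> rat by rewrite intr_eq0.
have fr3 : f3%:~R != 0 :> rat by rewrite intr_eq0.
have b0 : b%:~R != 0 :> rat by rewrite intr_eq0.
pose al : rat := a%:~R / b%:~R.
set sx := (poly_s p q s0 r0).[al]; set rx := (poly_r p q s0 r0).[al]; set zx := (poly_z p q).[al].
have g1E : sx ^+ 2 + zx ^+ 2 = f1%:~R * m1%:~R / n1 / b%:~R ^+ 4.
  have := homog_horner a (eq_leq hs1) b_neq0; rewrite v1 hE1 rmorphM /= => ->.
  rewrite -/al hornerZ /form1 hornerD !horner_exp -/sx -/zx.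
  by move: (sx ^+ 2 + zx ^+ 2) => g; field; rewrite n1_neq0 b0.
have g2E : rx ^+ 2 + zx ^+ 2 = f2%:~R * m2%:~R / n2 / b%:~R ^+ 4.
  have := homog_horner a (eq_leq hs2) b_neq0; rewrite v2 hE2 rmorphM /= => ->.
  rewrite -/al hornerZ /form2 hornerD !horner_exp -/rx -/zx.
  by move: (rx ^+ 2 + zx ^+ 2) => g; field; rewrite n2_neq0 b0.
have g3E : p * zx ^+ 2 - k * sx ^+ 2 = f3%:~R * m3%:~R / n3 / b%:~R ^+ 4.
  have := homog_horner a (eq_leq hs3) b_neq0; rewrite v3 hE3 rmorphM /= => ->.
  rewrite -/al hornerZ /form3 kE hornerD hornerN !hornerZ !horner_exp -/sx -/zx.
  by move: (p * zx ^+ 2 - k * sx ^+ 2) => g; field; rewrite n3_neq0 b0.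
have conicx : p * (p - 2 * q) * sx ^+ 2 + q * (q - 2 * p) * rx ^+ 2 =
  (p ^+ 2 - p * q + q ^+ 2) * zx ^+ 2 := conic_horner conic0 al.
(* If s, r or z vanished, one of the forms would be a square. *)
have notsq l (f m' : int) n u : prime l -> ~~ (l %| `|f|)%N -> f != 0 -> m' != 0 -> n != 0 ->
    vparity l n = false -> vparity l m'%:~R ->
    u ^+ 2 = f%:~R * m'%:~R / n / b%:~R ^+ 4 -> False.
  move=> pl lf f0 m0' n0 ln lm uE.
  have fr : f%:~R != 0 :> rat by rewrite intr_eq0.
  have mr : m'%:~R != 0 :> rat by rewrite intr_eq0.
  have u0 : u != 0.
    rewrite -sqrf_eq0 uE; by rewrite !mulf_neq0 ?invr_neq0 ?expf_neq0.
  have := vparity_sq l u0; rewrite uE -[4%N]/(2 * 2)%N exprM.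
  rewrite !vparityM ?mulf_neq0 ?invr_neq0 ?expf_neq0 // !vparityV vparity_sq ?expf_neq0 //.
  by rewrite ln lm (vparity_ndvd f0 lf).
have [vl1p vl1q vl1k [vl1c1 vl1c2 vl1c3 [l1f1 l1f2 l1n1 l1n2]]] := good_prime pl1 l1B.
have [vl2p vl2q vl2k [vl2c1 vl2c2 vl2c3 [l2f1 l2f2 l2n1 l2n2]]] := good_prime pl2 l2B.
have [vl3p vl3q vl3k [vl3c1 vl3c2 vl3c3 _]] := good_prime pl3 l3B.
have zx0 : zx != 0.
  apply/eqP => zx0; apply: (notsq l1 f1 m1 n1 sx) => //.
  by rewrite -g1E zx0 expr0n addr0.
have sx0 : sx != 0.
  apply/eqP => sx0; apply: (notsq l1 f1 m1 n1 zx) => //.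
  by rewrite -g1E sx0 expr0n add0r.
have rx0 : rx != 0.
  apply/eqP => rx0; apply: (notsq l2 f2 m2 n2 zx) => //.
  by rewrite -g2E rx0 expr0n add0r.
pose s := sx / zx; pose r := rx / zx.
pose t := e1 - p * k * (1 + s ^+ 2) / (2 * p - q).
pose bz := b%:~R ^+ 2 * zx.
have bz0 : bz != 0 by rewrite mulf_neq0 ?expf_neq0.
have conic' : p * (p - 2 * q) * s ^+ 2 + q * (q - 2 * p) * r ^+ 2 = p ^+ 2 - p * q + q ^+ 2.
  apply: (mulIf (expf_neq0 2 zx0)); rewrite -conicx /s /r; by field.
have t1 : t - e1 = c1 * m1%:~R / bz ^+ 2.
  have -> : t - e1 = kappa1 * (sx ^+ 2 + zx ^+ 2) / zx ^+ 2.
    by rewrite /t /kappa1 /s; field; rewrite zx0 pq_neq0.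
  by rewrite g1E /c1 /bz; field; rewrite zx0 b0 n1_neq0.
have t2 : t - e2 = c2 * m2%:~R / bz ^+ 2.
  have -> : t - e2 = kappa2 * (rx ^+ 2 + zx ^+ 2) / zx ^+ 2.
    rewrite (@conic_t e1 e2 e3 s r t pq_neq0 qp_neq0 conic' (erefl _)).
    by rewrite -/p -/q -/k /kappa2 /r; field; rewrite zx0 qp_neq0.
  by rewrite g2E /c2 /bz; field; rewrite zx0 b0 n2_neq0.
have t3 : t - e3 = c3 * m3%:~R / bz ^+ 2.
  have -> : t - e3 = kappa3 * (p * zx ^+ 2 - k * sx ^+ 2) / zx ^+ 2.
    rewrite /t /kappa3 /s.
    have -> : e1 = e3 + p by rewrite /p; ring.
    rewrite -kE; by field; rewrite zx0 pq_neq0.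
  by rewrite g3E /c3 /bz; field; rewrite zx0 b0 n3_neq0.
have c10 : c1 != 0 by rewrite !mulf_neq0 ?invr_neq0 ?oppr_eq0 ?mulf_neq0.
have c20 : c2 != 0 by rewrite !mulf_neq0 ?invr_neq0 ?mulf_neq0.
have c30 : c3 != 0 by rewrite !mulf_neq0 ?invr_neq0 ?mulf_neq0.
have D0 : (d * m)%:~R != 0 :> rat by rewrite intr_eq0 mulf_neq0.
have vpt l c (m' : int) : c != 0 -> m'%:~R != 0 :> rat -> vparity l c = false ->
   vparity l (c * m'%:~R / bz ^+ 2) = vparity l m'%:~R.
  move=> c0 mr lc; have i0 := invr_neq0 (expf_neq0 2 bz0).
  by rewrite (vparityM l (mulf_neq0 c0 mr) i0) (vparityM l c0 mr) vparityV vparity_sq // lc addbF.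
have vpd l : vparity l c1 = false -> vparity l c2 = false -> vparity l c3 = false ->
    vparity l d%:~R = false.
  move=> lc1 lc2 lc3; have dr : d%:~R != 0 :> rat by rewrite intr_eq0.
  have := congr1 (vparity l) dE.
  rewrite (vparityM l (mulf_neq0 c10 c20) c30) (vparityM l c10 c20) lc1 lc2 lc3.
  by rewrite (vparityM l dr (expf_neq0 2 w_neq0)) vparity_sq // !addbF => <-.
have vpD l : vparity l c1 = false -> vparity l c2 = false -> vparity l c3 = false ->
    vparity l (d * m)%:~R = vparity l m1%:~R (+) vparity l m2%:~R (+) vparity l m3%:~R.
  move=> lc1 lc2 lc3; have dr : d%:~R != 0 :> rat by rewrite intr_eq0.
  rewrite mE !rmorphM /= !vparityM ?mulf_neq0 //.
  by rewrite (vpd _ lc1 lc2 lc3).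
have s_neq0 : s != 0 by rewrite mulf_neq0 ?invr_neq0.
have r_neq0 : r != 0 by rewrite mulf_neq0 ?invr_neq0.
(* The ordinate comes from f(t) = c1 c2 c3 m / bz^6 = d m (w / bz^3)^2. *)
apply: (@three_indep_points lambda _ e1 e2 e3 s r t (w / bz ^+ 3) lambda_neq0 lambda_neq1 D0 fE
  p_neq0 q_neq0 k_neq0 pq_neq0 qp_neq0 s_neq0 r_neq0 conic' (erefl _) _
  (vparity l1) (vparity l2) (vparity l3)).
- rewrite fE t1 t2 t3 mE !rmorphM /=.
  transitivity (d%:~R * w ^+ 2 * (m1%:~R * m2%:~R * m3%:~R) / bz ^+ 6); first by field.
  by rewrite -dE; field.
- split; [exact: vparityM | exact: vparityN1 | by rewrite vpD // vp11 vp12 vp13 | by split].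
- split; [exact: vparityM | exact: vparityN1 | by rewrite vpD // vp21 vp22 vp23 | by split].
- split; [exact: vparityM | exact: vparityN1 | by rewrite vpD // vp31 vp32 vp33 | by split].
- by rewrite t1; apply: mulf_neq0; [apply: mulf_neq0 | rewrite invr_neq0 ?expf_neq0].
- by rewrite t2; apply: mulf_neq0; [apply: mulf_neq0 | rewrite invr_neq0 ?expf_neq0].
- by rewrite t3; apply: mulf_neq0; [apply: mulf_neq0 | rewrite invr_neq0 ?expf_neq0].
all: by rewrite ?t1 ?t2 ?t3 vpt.
Qed.

(** A prime of m lies outside B, so it has even valuation in c1 c2 c3 and hence in d; as d is
    squarefree, d and m are coprime. *)
Lemma twist_squarefree : (forall l, prime l -> ~~ (l ^ 2 %| `|d|)%N) -> squarefree (d * m).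
Proof.
move=> d_sqf; apply: squarefreeP => l pl; rewrite abszM.
case: (boolP (l %| `|m|)%N) => lm.
  have lB : ~~ (l %| B)%N.
    apply/negP => lB; have : (l %| gcdn `|m| B)%N by rewrite dvdn_gcd lB lm.
    by rewrite (eqP m_cop) dvdn1 => /eqP l1; move: pl; rewrite l1.
  have [_ _ _ [lc1 lc2 lc3 _]] := good_prime pl lB.
  have c10 : c1 != 0 by rewrite !mulf_neq0 ?invr_neq0 ?oppr_eq0 ?mulf_neq0 ?intr_eq0.
  have c20 : c2 != 0 by rewrite !mulf_neq0 ?invr_neq0 ?mulf_neq0 ?intr_eq0.
  have c30 : c3 != 0 by rewrite !mulf_neq0 ?invr_neq0 ?mulf_neq0 ?intr_eq0.
  have vd : vparity l d%:~R = false.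
    have dr : d%:~R != 0 :> rat by rewrite intr_eq0.
    have := congr1 (vparity l) dE.
    rewrite (vparityM l (mulf_neq0 c10 c20) c30) (vparityM l c10 c20) lc1 lc2 lc3.
    by rewrite (vparityM l dr (expf_neq0 2 w_neq0)) vparity_sq // !addbF => <-.
  have ld : ~~ (l %| `|d|)%N.
    by apply/negP => ld; have := vparity_exact pl d_neq0 ld (d_sqf l pl); rewrite vd.
  by rewrite Gauss_dvdr ?m_sqf // coprimeXl // prime_coprime.
by rewrite Gauss_dvdl ?d_sqf // coprimeXl // prime_coprime.
Qed.

End Twist.

(** * From values of the forms to the lower bound *)

Lemma num_twists_ge (R : realType) (lambda : rat) (r : nat) (x : R) (s : seq int) :
  uniq s -> (forall D, D \in s -> [/\ squarefree D, `|D|%:~R < x &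
    (r%:R%:E <= ec_rank R lambda D%:~R)%E]) -> (size s <= num_twists lambda r x)%N.
Proof.
move=> us sP; rewrite /num_twists; set A := (X in fset_set X).
(* [fset_set] reflects membership for finite sets only. *)
have finA : finite_set A.
  have [n xn] : exists n : nat, x <= n%:R.
    exists (Num.bound `|x|); apply: le_trans (ler_norm x) (ltW (archi_boundP (normr_ge0 x))).
  apply: (@sub_finite_set _ _ [set` [seq i%:Z | i <- iota 0 n] ++ [seq - i%:Z | i <- iota 0 n]]).
    move=> D [_ Dx _] /=; have Dn : (`|D| < n)%N.
      rewrite -ltz_nat abszE -(ltr_int R); exact: lt_le_trans Dx xn.
    rewrite mem_cat; apply/orP; case: D Dn {Dx} => i.
      by left; apply/mapP; exists i => //; rewrite mem_iota.
    by move=> Dn; right; apply/mapP; exists i.+1; rewrite ?NegzE // mem_iota.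
  exact: finite_seq.
rewrite -(undup_id us) -card_fseq; apply: fsubset_leq_card; apply/fsubsetP => D.
rewrite !inE in_fset_set // => Ds; rewrite inE; exact: sP.
Qed.

Lemma powR_sixth_le (R : realType) (x : R) (n : nat) : 0 <= x -> x <= n%:R ^+ 6 ->
  x `^ (1 / 6) <= n%:R.
Proof.
move=> x0 xn; apply: le_trans (_ : (n%:R ^+ 6) `^ (1 / 6) <= _).
  by apply: ge0_ler_powR; rewrite ?nnegrE ?exprn_ge0 ?divr_ge0.
rewrite -powR_mulrn // -powRrM mulrC divfK ?pnatr_eq0 //.
by rewrite powRr1.
Qed.

(** Take the largest J at which the bound on the twists is still below x; passing from J to J + 1
    loses a factor 4 in x^(1/6). *)
Lemma counting_bound (R : realType) (lambda : rat) (C E J0 : nat) :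
  (0 < C)%N -> (0 < E)%N ->
  (forall J, (J0 <= J)%N -> exists s : seq int, [/\ uniq s, (4 ^ J <= C * size s)%N &
    forall D, D \in s -> [/\ squarefree D, (`|D| <= E * 2 ^ (12 * J))%N &
      (3%:R%:E <= ec_rank R lambda D%:~R)%E]]) ->
  exists c x0 : R, 0 < c /\
    forall x : R, x0 <= x -> c * x `^ (1 / 6) <= (num_twists lambda 3 x)%:R.
Proof.
move=> C0 E0 H.
pose a J : nat := (E * 2 ^ (12 * J))%N.
have D0 : (0 < 4 * E * C)%N by rewrite !muln_gt0 E0.
exists ((4 * E * C)%N%:R^-1), ((a J0).+1%:R); split; first by rewrite invr_gt0 ltr0n.
move=> x hx; have x0 : 0 <= x by apply: le_trans hx.
pose n := Num.bound x; have xn : x < n%:R by have := archi_boundP x0.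
pose P J := ((a J)%:R < x).
have PJ0 : P J0 by apply: lt_le_trans hx; rewrite ltr_nat.
have Pub J : P J -> (J <= n)%N.
  move=> PJ; rewrite -(ler_nat R); apply/ltW; apply: le_lt_trans xn; apply: le_trans (ltW PJ).
  rewrite ler_nat /a; apply: leq_trans (ltnW (ltn_expl J (isT : 1 < 2)%N)) _.
  by apply: leq_trans (leq_pmull _ E0); rewrite leq_exp2l // leq_pmull.
case: (ex_maxnP (ex_intro P J0 PJ0) Pub) => J PJ Jmax.
have hJ := Jmax _ PJ0.
have [s [us ss sP]] := H J hJ.
have le1 : (size s <= num_twists lambda 3 x)%N.
  apply: num_twists_ge => // D /sP[sqf le rk]; split=> //.
  by apply: le_lt_trans PJ; rewrite -abszE -pmulrn ler_nat.
have xJ : x <= (a J.+1)%:R.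
  by rewrite leNgt; apply/negP => h; have := Jmax _ h; rewrite ltnn.
(* By maximality x <= E 2^(12 (J + 1)) <= (4 E 4^J)^6, using E <= E^6. *)
have le2 : x `^ (1 / 6) <= (4 * E * 4 ^ J)%N%:R.
  apply: powR_sixth_le => //; apply: le_trans xJ _; rewrite -natrX ler_nat /a.
  have four m : (4 ^ m = 2 ^ (2 * m))%N by rewrite expnM.
  rewrite mulnS expnD !expnMn four four -expnM (_ : 2 * J * 6 = 12 * J)%N; last first.
    by rewrite mulnAC.
  rewrite mulnCA -mulnA leq_mul2l; apply/orP; right.
  by rewrite leq_mul2r -{1}[E]expn1 leq_pexp2l ?orbT.
rewrite mulrC ler_pdivrMr ?ltr0n //; apply: le_trans le2 _.
rewrite -natrM ler_nat; apply: leq_trans (leq_mul (leqnn (4 * E)) ss) _.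
by rewrite mulnA mulnC leq_mul2r le1 orbT.
Qed.

Section Core.
Variables (R : realType) (lambda e1 e2 e3 s0 r0 : rat).
Let p := e1 - e3.
Let q := e2 - e3.
Let k := e1 - e2.
Hypotheses (lambda_neq0 : lambda != 0) (lambda_neq1 : lambda != 1).
Hypothesis fE : forall x, x * (x - 1) * (x - lambda) = (x - e1) * (x - e2) * (x - e3).
Hypotheses (p_neq0 : p != 0) (q_neq0 : q != 0) (k_neq0 : k != 0).
Hypotheses (pq_neq0 : 2 * p - q != 0) (qp_neq0 : 2 * q - p != 0).
Hypothesis conic0 : p * (p - 2 * q) * s0 ^+ 2 + q * (q - 2 * p) * r0 ^+ 2 =
  p ^+ 2 - p * q + q ^+ 2.
Hypothesis lead_neq : p != k * s0 ^+ 2.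

Lemma rank3_twists_of_conic : exists c x0 : R, 0 < c /\
    forall x : R, x0 <= x -> c * x `^ (1 / 6) <= (num_twists lambda 3 x)%:R.
Proof.
have kE : p - q = k by rewrite /k /p /q; ring.
have k_neq0' : p - q != 0 by rewrite kE.
have lead' : p != (p - q) * s0 ^+ 2 by rewrite kE.
have [h1 [h2 [h3 [n1 [n2 [n3 [[n10 n20 n30] [hs1 hs2 hs3] [hE1 hE2 hE3] sep]]]]]]] :=
  int_forms conic0 p_neq0 q_neq0 k_neq0' pq_neq0 qp_neq0 lead'.
pose kappa1 := - (p * k) / (2 * p - q).
pose kappa2 := q * k / (2 * q - p).
pose kappa3 := p / (2 * p - q).
have kp1 : kappa1 != 0 by rewrite mulf_neq0 ?invr_neq0 ?oppr_eq0 ?mulf_neq0.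
have kp2 : kappa2 != 0 by rewrite mulf_neq0 ?invr_neq0 ?mulf_neq0.
have kp3 : kappa3 != 0 by rewrite mulf_neq0 ?invr_neq0.
pose l := [:: p; q; k; kappa1; kappa2; kappa3; n1; n2; n3].
have l_neq0 c : c \in l -> c != 0.
  rewrite !inE; do 8!(case/orP; first by move/eqP ->); by move/eqP ->.
(* At a prime not dividing [B0], all the fixed constants of the construction are units. *)
pose B0 := (\prod_(c <- l) `|(numq c * denq c)%R|)%N.
have B0_gt0 : (0 < B0)%N.
  rewrite /B0 big_seq; apply: prodn_cond_gt0 => c /l_neq0 c0.
  by rewrite absz_gt0 mulf_neq0 ?numq_eq0 ?denq_neq0.
have [B [f1 [f2 [f3 [C [J0 [B_gt0 B0B C_gt0 [f10 f20 f30 fB] H]]]]]]] :=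
  sieve_binary_quartics hs1 hs2 hs3 sep B0_gt0.
have bad pr c : ~~ (pr %| B)%N -> c \in l -> vparity pr c = false.
  move=> prB cl; apply: vparity_coprime; apply: contra prB => h.
  apply: dvdn_trans B0B; apply: dvdn_trans h _.
  by rewrite /B0 (big_rem c cl) /= dvdn_mulr.
have fbad pr : ~~ (pr %| B)%N -> [/\ ~~ (pr %| `|f1|)%N, ~~ (pr %| `|f2|)%N & ~~ (pr %| `|f3|)%N].
  move=> prB; split; apply: contra prB => h; apply: dvdn_trans fB; rewrite !abszM.
  - by rewrite -mulnA dvdn_mulr.
  - by rewrite dvdn_mulr // dvdn_mull.
  by rewrite dvdn_mull.
have f1r : f1%:~R != 0 :> rat by rewrite intr_eq0.
have f2r : f2%:~R != 0 :> rat by rewrite intr_eq0.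
have f3r : f3%:~R != 0 :> rat by rewrite intr_eq0.
pose c1 := kappa1 * f1%:~R / n1; pose c2 := kappa2 * f2%:~R / n2; pose c3 := kappa3 * f3%:~R / n3.
have vc pr kappa (f : int) n : kappa != 0 -> f != 0 -> n != 0 -> vparity pr kappa = false ->
    ~~ (pr %| `|f|)%N -> vparity pr n = false -> vparity pr (kappa * f%:~R / n) = false.
  move=> kappa0 f0 n0 vk vf vn; have fr : f%:~R != 0 :> rat by rewrite intr_eq0.
  rewrite (vparityM pr (mulf_neq0 kappa0 fr) (invr_neq0 n0)) (vparityM pr kappa0 fr) vparityV vk vn.
  by rewrite (vparity_ndvd f0 vf).
have good_prime pr : prime pr -> ~~ (pr %| B)%N ->
  [/\ vparity pr p = false, vparity pr q = false, vparity pr k = false &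
    [/\ vparity pr c1 = false, vparity pr c2 = false, vparity pr c3 = false &
      [/\ ~~ (pr %| `|f1|)%N, ~~ (pr %| `|f2|)%N, vparity pr n1 = false & vparity pr n2 = false]]].
  move=> _ prB; have [g1 g2 g3] := fbad _ prB; have b := bad _ _ prB.
  split; [apply: b | apply: b | apply: b |]; rewrite ?inE ?eqxx ?orbT //.
  by split; [apply: vc | apply: vc | apply: vc | split]; rewrite // b // !inE eqxx ?orbT.
have c0 : c1 * c2 * c3 != 0.
  have i1 := mulf_neq0 (mulf_neq0 kp1 f1r) (invr_neq0 n10).
  have i2 := mulf_neq0 (mulf_neq0 kp2 f2r) (invr_neq0 n20).
  have i3 := mulf_neq0 (mulf_neq0 kp3 f3r) (invr_neq0 n30).
  exact: mulf_neq0 (mulf_neq0 i1 i2) i3.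
have [d [w [w0 d0 dE d_sqf]]] := squarefree_part_rat c0.
have d_gt0 : (0 < `|d|)%N by rewrite absz_gt0.
apply: (@counting_bound R lambda C (`|d| * C) J0) => //; first by rewrite muln_gt0 d_gt0.
move=> J hJ; have [s [us ss sP]] := H J hJ.
exists [seq d * m | m <- s]; split; rewrite ?size_map ?map_inj_uniq //; first exact: mulfI.
move=> D /mapP[m ms ->].
have [m_le m_cop m_sqf [a [b [m1 [m2 [m3 [b0 mE [g1 g2 g3] [v1 v2 v3]]]]]]]] := sP m ms.
split.
- exact: (twist_squarefree p_neq0 q_neq0 k_neq0 pq_neq0 qp_neq0 n10 n20 n30 f10 f20 f30 good_prime
    w0 d0 dE m_cop m_sqf d_sqf).
- by rewrite abszM -mulnA leq_mul2l m_le orbT.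
exact: (twist_rank lambda_neq0 lambda_neq1 fE p_neq0 q_neq0 k_neq0 pq_neq0 qp_neq0 conic0
  n10 n20 n30 hs1 hs2 hs3 hE1 hE2 hE3 f10 f20 f30 good_prime w0 d0 dE m_cop m_sqf b0 mE
  g1 g2 g3 v1 v2 v3).
Qed.

End Core.

Theorem theorem5p5 (R : realType) (lambda : rat)
    (lambda_neq0 : lambda != 0) (lambda_neq1 : lambda != 1)
    (lambda_form : exists a : rat,
      [\/ lambda = - 2 * a ^+ 2,
          lambda = (1 - a ^+ 2) / (a ^+ 2 + 2)
        | lambda = a * (a - 2) / (a ^+ 2 + 1)]) :
  exists c x0 : R, 0 < c /\
    forall x : R, x0 <= x ->
      c * x `^ (1 / 6) <= (num_twists lambda 3 x)%:R.
Proof.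
have l1 : 1 - lambda != 0 by rewrite subr_eq0 eq_sym.
case: lambda_form => a [] lE.
- have a0 : a != 0 by apply: contra lambda_neq0 => /eqP a0; rewrite lE a0 expr0n mulr0.
  have a2 : 0 <= a ^+ 2 := sqr_ge0 a.
  (* With p = 1 and q = lambda the conic is (1 + 4 a^2) s^2 + 4 a^2 (a^2 + 1) r^2 = 4 a^4 + 2 a^2 +
     1, and the right side is (1 + 4 a^2) a^2 + (a^2 + 1). *)
  apply: (@rank3_twists_of_conic R lambda 1 lambda 0 a (1 / (2 * a))) => //.
  + by move=> x; ring.
  + by rewrite subr0.
  + by rewrite lE; apply/negP => /eqP; lra.
  + by rewrite lE; apply/negP => /eqP; lra.
  + by rewrite lE; field.
  rewrite -subr_eq0 lE.
  have -> : 1 - 0 - (1 - -2 * a ^+ 2) * a ^+ 2 = (1 - 2 * a ^+ 2) * (1 + a ^+ 2) by ring.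
  rewrite mulf_neq0 //; last by rewrite gt_eqF // ltr_wpDr.
  (* 2 a^2 = 1 would make 2 the square of 1/a. *)
  apply/negP => /eqP h.
  have /eqP := sqrt_prime_irrational a^-1 (isT : prime 2); apply.
  have -> : 2%:R = 1 / a ^+ 2 * (2 * a ^+ 2) :> rat by field.
  by rewrite (_ : 2 * a ^+ 2 = 1) ?mulr1 ?exprVn ?div1r //; lra.
- have a2 : 0 <= a ^+ 2 := sqr_ge0 a.
  have d0 : a ^+ 2 + 2 != 0 by rewrite gt_eqF // ltr_wpDl.
  (* At s = 1 the conic reduces to (q - 2 p) r^2 = p + q, that is (1 + lambda) r^2 = 1 - 2 lambda;
     solving for lambda with r = a gives this family. *)
  apply: (@rank3_twists_of_conic R lambda 0 1 lambda 1 a) => //.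
  + by move=> x; ring.
  + by rewrite sub0r oppr_eq0.
  + have e : (2 * (0 - lambda) - (1 - lambda)) * (a ^+ 2 + 2) = - 3 by rewrite lE; field.
    by apply/negP => /eqP h; move: e; rewrite h mul0r; lra.
  + have e : (2 * (1 - lambda) - (0 - lambda)) * (a ^+ 2 + 2) = 3 * (a ^+ 2 + 1).
      by rewrite lE; field.
    by apply/negP => /eqP h; move: e; rewrite h mul0r; lra.
  + by rewrite lE; field.
  by rewrite -subr_eq0 expr1n (_ : _ - _ = 1 - lambda) //; ring.
have a2 : 0 <= a ^+ 2 := sqr_ge0 a.
have d0 : a ^+ 2 + 1 != 0 by rewrite gt_eqF // ltr_wpDl.
(* The denominator of the conic point below; if it vanished, 5 would be the square of 2 a + 1. *)
have z0 : a ^+ 2 + a - 1 != 0.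
  apply/negP => /eqP h; have /eqP := sqrt_prime_irrational (2 * a + 1) (isT : prime 5); apply.
  have -> : (2 * a + 1) ^+ 2 = 4 * (a ^+ 2 + a - 1) + 5%:R by ring.
  by rewrite h mulr0 add0r.
have q1 : 0 < 2 * a ^+ 2 - 2 * a + 1.
  by have := sqr_ge0 (2 * a - 1); lra.
have q2 : 0 < a ^+ 2 + 2 * a + 2 by have := sqr_ge0 (a + 1); lra.
have l1E : (1 - lambda) * (a ^+ 2 + 1) = 2 * a + 1 by rewrite lE; field.
have a3 : 2 * a + 1 != 0 by rewrite -l1E mulf_neq0.
apply: (@rank3_twists_of_conic R lambda 0 1 lambda ((a ^+ 2 + 1) / (a ^+ 2 + a - 1))
  ((2 * a + 1) / (a ^+ 2 + a - 1))) => //.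
+ by move=> x; ring.
+ by rewrite sub0r oppr_eq0.
+ have e : (2 * (0 - lambda) - (1 - lambda)) * (a ^+ 2 + 1) = - (2 * a ^+ 2 - 2 * a + 1).
    by rewrite lE; field.
  by apply/negP => /eqP h; move: e; rewrite h mul0r; lra.
+ have e : (2 * (1 - lambda) - (0 - lambda)) * (a ^+ 2 + 1) = a ^+ 2 + 2 * a + 2.
    by rewrite lE; field.
  by apply/negP => /eqP h; move: e; rewrite h mul0r; lra.
+ by rewrite lE; field; rewrite z0 d0.
(* p - k s0^2, cleared of denominators; 2 a + 1 is nonzero because lambda is not 1. *)
have e : (0 - lambda - (0 - 1) * ((a ^+ 2 + 1) / (a ^+ 2 + a - 1)) ^+ 2) *
   ((a ^+ 2 + 1) * (a ^+ 2 + a - 1) ^+ 2) = (2 * a + 1) ^+ 2 * (2 * a ^+ 2 - 2 * a + 1).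
  by rewrite lE; field; rewrite z0 d0.
rewrite -subr_eq0; apply/negP => /eqP h; move: e; rewrite h mul0r => /esym/eqP.
by rewrite mulf_eq0 sqrf_eq0 (negbTE a3) gt_eqF.
Qed.
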